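(* Let $\epsilon,\delta\in[0,1]$ and a budget $\ell\in\mathbb{N}$ be given, and let $B=\max_{i}\mathrm{tr}(O_i^2)$. There is an algorithm using $$N=\mathcal{O}\left(\frac{\sqrt{B\ell}\,\log(B)\log(M)\log(1/\epsilon\delta)^{5/2}}{\epsilon^2}\right)$$ copies of an unknown state $\rho$ that responds to an adaptively chosen online sequence of observable/threshold pairs $(O_1,\theta_1),\dots,(O_M,\theta_M)$ and, with probability at least $1-\delta$, for all $i\in[M]$: outputs ''No'' whenever $\mathrm{tr}(O_i\rho)>\theta_i$; outputs ''Yes'' whenever $\mathrm{tr}(O_i\rho)\le\theta_i-\epsilon$; and terminates once the number of ''No'' outputs exceeds $\ell$.
   Context: Observables are Hermitian with $\|O_i\|_\infty\le1$ and thresholds satisfy $\theta_i\in[0,1]$. Pairs arrive one at a time; each pair may be chosen depending on all previous pairs and outputs.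
   Formalization: ε and δ are taken in (0,1], since the bound is undefined at 0; in the bound √(Bℓ), log B, log M and log(1/εδ) are each replaced by their maximum with 1 (otherwise B=1, M=1 or ℓ=0 gives N=0); B is an upper bound on all tr(O_i²) known in advance. *)

(* Defs.v *)
From HB Require Import structures.
From mathcomp Require Import all_boot all_order all_algebra.
From mathcomp Require Import reals exp.
From mathcomp.real_closed Require Import complex mxtens.

Set Implicit Arguments.
Unset Strict Implicit.
Unset Printing Implicit Defensive.

Import Order.TTheory GRing.Theory Num.Theory.
Local Open Scope ring_scope.

Section QDefs.
Variable R : realType.
Local Notation C := (R[i]).

Definition adj m n (A : 'M[C]_(m, n)) : 'M[C]_(n, m) :=
  (map_mx (fun z : C => conjc z) A)^T.

Definition hermitian d (O : 'M[C]_d) : Prop := adj O = O.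

Definition opnorm_le1 d (O : 'M[C]_d) : Prop :=
  forall v : 'cV[C]_d, (adj (O *m v) *m (O *m v)) 0 0 <= (adj v *m v) 0 0.

Definition psd d (rho : 'M[C]_d) : Prop :=
  forall v : 'cV[C]_d, 0 <= (adj v *m rho *m v) 0 0.

Definition density d (rho : 'M[C]_d) : Prop := psd rho /\ \tr rho = 1.

(* tr(O rho) (real for hermitian O and psd rho) *)
Definition expect d (O rho : 'M[C]_d) : R := complex.Re (\tr (O *m rho)).

Definition valid_query d (B : R) (q : 'M[C]_d * R) : Prop :=
  [/\ hermitian q.1, opnorm_le1 q.1,
      complex.Re (\tr (q.1 *m q.1)) <= B & 0 <= q.2 <= 1].

Fixpoint pw (d n : nat) : nat := if n is n'.+1 then (d * pw d n')%N else 1%N.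

Fixpoint tpow d (rho : 'M[C]_d) (n : nat) : 'M[C]_(pw d n) :=
  if n is n'.+1 return 'M[C]_(pw d n) then tensmx rho (tpow rho n') else 1%:M.

(* a quantum instrument with two outcomes (true = "Yes", false = "No"),
   each outcome given by a finite list of Kraus operators; trace preserving *)
Definition instrument_ok D (ins : bool -> seq 'M[C]_D) : Prop :=
  \sum_(o : bool) \sum_(K <- ins o) adj K *m K = 1%:M.

(* A general (adaptive, online) quantum algorithm on d-dimensional states:
   it holds ncopies copies of the unknown state plus an ancilla of dimension
   anc.+1 initialised to |0><0|; when query i arrives it applies an instrument
   chosen as a function of all queries so far (including the current one) and
   its previous outputs; the outcome of the instrument is its output. *)
Record algorithm (d : nat) := Algorithm {
  ncopies : nat;
  anc : nat;
  step : seq ('M[C]_d * R) -> seq bool -> bool -> seq 'M[C]_(pw d ncopies * anc.+1);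
  step_ok : forall qs os, instrument_ok (step qs os)
}.

(* An adaptive (deterministic) adversary maps the previous outputs to the next
   observable/threshold pair. *)
Definition adversary d := seq bool -> 'M[C]_d * R.

Definition queries d (adv : adversary d) (h : seq bool) : seq ('M[C]_d * R) :=
  [seq adv (take k h) | k <- iota 0 (size h).+1].

Definition init_state d (alg : algorithm d) (rho : 'M[C]_d)
  : 'M[C]_(pw d (ncopies alg) * (anc alg).+1) :=
  tensmx (tpow rho (ncopies alg)) (delta_mx (0 : 'I_(anc alg).+1) 0).

(* unnormalised post-measurement state after the transcript of outputs os *)
Definition post d (alg : algorithm d) (adv : adversary d) (rho : 'M[C]_d)
  (os : seq bool) : 'M[C]_(pw d (ncopies alg) * (anc alg).+1) :=
  foldl (fun sigma i => let h := take i os in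
           \sum_(K <- step alg (queries adv h) h (nth true os i))
              K *m sigma *m adj K)
        (init_state alg rho) (iota 0 (size os)).

Definition prob d (alg : algorithm d) (adv : adversary d) (rho : 'M[C]_d)
  (os : seq bool) : R := complex.Re (\tr (post alg adv rho os)).

Definition halted (ell M : nat) (os : seq bool) : bool :=
  (ell < count negb os)%N || (M <= size os)%N.

Definition terminal (ell M : nat) (os : seq bool) : bool :=
  halted ell M os && all (fun k => ~~ halted ell M (take k os)) (iota 0 (size os)).

Definition correct d (adv : adversary d) (rho : 'M[C]_d) (eps : R)
  (os : seq bool) : bool :=
  all (fun i => let q := adv (take i os) in let o := nth true os i in
         ((q.2 < expect q.1 rho) ==> ~~ o) && ((expect q.1 rho <= q.2 - eps) ==> o))
      (iota 0 (size os)).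

Definition success_prob d (alg : algorithm d) (adv : adversary d)
  (rho : 'M[C]_d) (eps : R) (ell M : nat) : R :=
  \sum_(m < M.+1) \sum_(t : m.-tuple bool | terminal ell M t && correct adv rho eps t)
     prob alg adv rho t.

(* logarithmic factors in big-O bounds, floored at 1 *)
Definition lg (x : R) : R := Num.max 1 (ln x).

Definition copy_bound (B : R) (ell M : nat) (eps delta : R) : R :=
  Num.max 1 (Num.sqrt (B * ell%:R)) * lg B * lg M%:R
  * powR (lg (1 / (eps * delta))) (5%:R / 2%:R) / eps ^+ 2.

End QDefs.

(* Main.v *)
Require Import Defs.
From HB Require Import structures.
From mathcomp Require Import all_boot all_order all_algebra.
From mathcomp Require Import reals sequences exp.
From mathcomp.real_closed Require Import complex mxtens.
From mathcomp Require Import ring lra.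
Set Implicit Arguments.
Unset Strict Implicit.
Unset Printing Implicit Defensive.
Import Order.TTheory GRing.Theory Num.Theory.
Local Open Scope ring_scope.

(** Since Yes/No answers only need a margin, all copies are measured at once and gently. For a query
    (O, theta) rescaled to operator norm 1, put g = 1 + eta (t - O) with t slightly below theta, and
    G equal to the n-th tensor power of g; the threshold instrument answers "Yes" with weight
    G^2 / (1 + G^2) and "No" with weight 1 / (1 + G^2).

    Purify the state to a vector psi and let W count the copies that have left psi. A wrong answer
    is exponentially unlikely unless W >= k, because on the range of psi the operator G is
    exponentially large (resp. small) when the mean of O is below theta - eps (resp. above theta).
    The moments F = (k + W)^(2p) stay under control: splitting each outcome into two Kraus
    operators, the average back-action on F is -Z [G, [G, F]] Z with Z = 1 / (1 + G^2), so a query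
    raises F by at most c times its "No" part, where c = O((p eta)^2 n / k). Discounting F by 1 - c at
    each of the at most ell + 1 "No" answers gives a supermartingale, and Markov's inequality for F
    bounds the probability that W ever reaches k.

    The bound B enters only through the rescaling of the observables by min(1, 2 sqrt B). When
    2 sqrt B <= eps, every mean is within eps / 2 of 0 and no copy is needed. *)

(** * Adjoints, the real inner product and operator bounds *)

(** The number M of queries may far exceed what the copies could pay for one by one, so disturbance
    may be charged to the few No answers only. The double commutator is sandwiched between two
    factors Z, and Z is the weight of No: this is why the charge lands there.

    The root of ell comes from a mismatch of orders. The evidence carried by G is linear in eta, the
    back-action quadratic. Keeping c (ell + 1) bounded allows eta of order 1 / (p sqrt (n / k) sqrt
    (ell + 1)), while M reliable answers need (eta / e) k above log (M / delta); with n / k of order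
    1 / e^2 this makes k grow like sqrt (ell + 1).

    The offset k in k + W sets the scale. Relative to k + W, a one-body operator that changes W has
    size sqrt (n / k), one that preserves W has size n / k. Conjugation by G has a purely W-changing
    first-order term, so its expansion has the single small parameter eta sqrt (n / k).

    High powers are needed because the first moment would give only a constant from Markov's
    inequality; the power 2p gives 4^-p.

    Off psi nothing is known about g. Fewer than k escaped copies can spoil G only by a factor
    exponential in (eta / e) k, and n / k is chosen so that the remaining copies win. *)

Notation "r *r A" := (real_complex _ r *: A) (at level 40, left associativity) : ring_scope.

Section Hilbert.
Variable R : realType.
Local Notation herm := (@Defs.hermitian R _).
Local Notation C := (R[i]).

Lemma adjE m n (A : 'M[C]_(m, n)) i j : adj A i j = conjc (A j i).
Proof. by rewrite !mxE. Qed.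

Lemma adjK m n (A : 'M[C]_(m, n)) : adj (adj A) = A.
Proof. by apply/matrixP=> i j; rewrite !adjE conjcK. Qed.

Lemma adjM m n p (A : 'M[C]_(m, n)) (B : 'M[C]_(n, p)) : adj (A *m B) = adj B *m adj A.
Proof.
apply/matrixP=> i j; rewrite adjE !mxE rmorph_sum; apply: eq_bigr=> k _.
by rewrite !adjE rmorphM mulrC.
Qed.

Lemma adjD m n (A B : 'M[C]_(m, n)) : adj (A + B) = adj A + adj B.
Proof. by apply/matrixP=> i j; rewrite !(adjE, mxE) rmorphD. Qed.

Lemma adjN m n (A : 'M[C]_(m, n)) : adj (- A) = - adj A.
Proof. by apply/matrixP=> i j; rewrite !(adjE, mxE) rmorphN. Qed.

Lemma adj0 m n : adj (0 : 'M[C]_(m, n)) = 0.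
Proof. by apply/matrixP=> i j; rewrite !(adjE, mxE) rmorph0. Qed.

Lemma adj1 n : adj (1%:M : 'M[C]_n) = 1%:M.
Proof. by apply/matrixP=> i j; rewrite !(adjE, mxE) rmorph_nat eq_sym. Qed.

Lemma adjZ m n r (A : 'M[C]_(m, n)) : adj (r *r A) = r *r adj A.
Proof. by apply/matrixP=> i j; rewrite !(adjE, mxE) rmorphM /= oppr0. Qed.

Lemma adj_tens m n p q (A : 'M[C]_(m, n)) (B : 'M[C]_(p, q)) :
  adj (tensmx A B) = tensmx (adj A) (adj B).
Proof. by apply/matrixP=> i j; rewrite !mxE rmorphM. Qed.

Lemma hermitian_adjM m n (A : 'M[C]_(m, n)) : herm (adj A *m A).
Proof. by rewrite /herm adjM adjK. Qed.

Lemma hermitianZ n r (A : 'M[C]_n) : herm A -> herm (r *r A).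
Proof. by rewrite /herm adjZ=> ->. Qed.

Lemma hermitianD n (A B : 'M[C]_n) : herm A -> herm B -> herm (A + B).
Proof. by rewrite /herm adjD=> -> ->. Qed.

Lemma hermitianB n (A B : 'M[C]_n) : herm A -> herm B -> herm (A - B).
Proof. by rewrite /herm adjD adjN=> -> ->. Qed.

Lemma hermitian1 n : herm (1%:M : 'M[C]_n).
Proof. exact: adj1. Qed.

(* The real part of the complex inner product: a real inner product for which adj is still the adjoint. *)
Definition rd n (u v : 'cV[C]_n) : R := complex.Re ((adj u *m v) 0 0).

Lemma rdDr n (u v w : 'cV[C]_n) : rd u (v + w) = rd u v + rd u w.
Proof. by rewrite /rd mulmxDr mxE raddfD. Qed.

Lemma rdC n (u v : 'cV[C]_n) : rd u v = rd v u.
Proof.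
rewrite /rd; have -> : adj u *m v = adj (adj v *m u) by rewrite adjM adjK.
by rewrite adjE; case: ((adj v *m u) 0 0).
Qed.

Lemma rdDl n (u v w : 'cV[C]_n) : rd (v + w) u = rd v u + rd w u.
Proof. by rewrite rdC rdDr !(rdC u). Qed.

Lemma rdZr n r (u v : 'cV[C]_n) : rd u (r *r v) = r * rd u v.
Proof. by rewrite /rd -scalemxAr mxE; case: ((adj u *m v) 0 0)=> a b /=; rewrite mul0r subr0. Qed.

Lemma rdZl n r (u v : 'cV[C]_n) : rd (r *r u) v = r * rd u v.
Proof. by rewrite rdC rdZr rdC. Qed.

Lemma rN1 m n (A : 'M[C]_(m, n)) : - A = (-1) *r A.
Proof. by rewrite rmorphN rmorph1 scaleN1r. Qed.

Lemma rdNr n (u v : 'cV[C]_n) : rd u (- v) = - rd u v.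
Proof. by rewrite rN1 rdZr mulN1r. Qed.

Lemma rdNl n (u v : 'cV[C]_n) : rd (- u) v = - rd u v.
Proof. by rewrite rdC rdNr rdC. Qed.

Lemma rdBr n (u v w : 'cV[C]_n) : rd u (v - w) = rd u v - rd u w.
Proof. by rewrite rdDr rdNr. Qed.

Lemma rdBl n (u v w : 'cV[C]_n) : rd (v - w) u = rd v u - rd w u.
Proof. by rewrite rdDl rdNl. Qed.

Lemma rd0r n (u : 'cV[C]_n) : rd u 0 = 0.
Proof. by rewrite /rd mulmx0 mxE. Qed.

Lemma rd0l n (u : 'cV[C]_n) : rd 0 u = 0.
Proof. by rewrite rdC rd0r. Qed.

Lemma rd_adjl m n (A : 'M[C]_(m, n)) u v : rd (A *m u) v = rd u (adj A *m v).
Proof. by rewrite /rd adjM mulmxA. Qed.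

Lemma rd_adjr m n (A : 'M[C]_(m, n)) u v : rd u (A *m v) = rd (adj A *m u) v.
Proof. by rewrite rd_adjl adjK. Qed.

Lemma rd_sumsq n (v : 'cV[C]_n) :
  rd v v = \sum_i ((complex.Re (v i 0)) ^+ 2 + (complex.Im (v i 0)) ^+ 2).
Proof.
rewrite /rd mxE raddf_sum; apply: eq_bigr=> i _; rewrite adjE.
by case: (v i 0)=> a b /=; rewrite mulNr opprK !expr2.
Qed.

Lemma rd_ge0 n (v : 'cV[C]_n) : 0 <= rd v v.
Proof. by rewrite rd_sumsq sumr_ge0 // => i _; rewrite addr_ge0 ?sqr_ge0. Qed.

Lemma rd_eq0 n (v : 'cV[C]_n) : rd v v = 0 -> v = 0.
Proof.
move/eqP; rewrite rd_sumsq psumr_eq0; last by move=> i _; rewrite addr_ge0 ?sqr_ge0.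
move/allP=> H; apply/matrixP=> i j; rewrite ord1 mxE.
have := H i (mem_index_enum i); rewrite /= paddr_eq0 ?sqr_ge0 // !sqrf_eq0.
by case: (v i 0)=> a b /= /andP[/eqP -> /eqP ->].
Qed.

Lemma rd_complex n (v : 'cV[C]_n) : (adj v *m v) 0 0 = real_complex R (rd v v).
Proof.
rewrite /rd; have : adj (adj v *m v) = adj v *m v by rewrite adjM adjK.
move/matrixP/(_ 0 0); rewrite adjE; case: (_ 0 0)=> a b [] /eqP.
by rewrite -subr_eq0 -opprD oppr_eq0 -mulr2n mulrn_eq0 /= => /eqP ->.
Qed.

Definition nr n (v : 'cV[C]_n) : R := Num.sqrt (rd v v).

Lemma nr_ge0 n (v : 'cV[C]_n) : 0 <= nr v. Proof. exact: sqrtr_ge0. Qed.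

Lemma nr2 n (v : 'cV[C]_n) : nr v ^+ 2 = rd v v.
Proof. by rewrite sqr_sqrtr ?rd_ge0. Qed.

Lemma nrZ n r (v : 'cV[C]_n) : nr (r *r v) = `|r| * nr v.
Proof. by rewrite /nr rdZl rdZr mulrA -expr2 sqrtrM ?sqr_ge0 // sqrtr_sqr. Qed.

Lemma nrN n (v : 'cV[C]_n) : nr (- v) = nr v.
Proof. by rewrite rN1 nrZ normrN1 mul1r. Qed.

Lemma rd_le_nr n (u v : 'cV[C]_n) : rd u v <= nr u * nr v.
Proof.
have H t : 0 <= rd u u - t * 2 * rd u v + t ^+ 2 * rd v v.
  have := rd_ge0 (u - t *r v).
  rewrite rdBl !rdBr !rdZl !rdZr (rdC v u).
  by move=> h; nra.
have [v0|v0] := eqVneq (nr v) 0.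
  have /rd_eq0 -> : rd v v = 0 by rewrite -nr2 v0 expr0n.
  by rewrite rd0r mulr_ge0 ?nr_ge0.
have vp : 0 < nr v by rewrite lt_def v0 nr_ge0.
have [u0|u0] := eqVneq (nr u) 0.
  have /rd_eq0 -> : rd u u = 0 by rewrite -nr2 u0 expr0n.
  by rewrite rd0l mulr_ge0 ?nr_ge0.
have up : 0 < nr u by rewrite lt_def u0 nr_ge0.
(* At this value of t the two squares agree, and the quadratic becomes a multiple of nr u * nr v -
   rd u v. *)
have := H (nr u / nr v); rewrite -!nr2 => {}H.
have E : nr u / nr v * nr v = nr u by rewrite divfK.
have : 0 <= 2 * nr u ^+ 2 - 2 * (nr u / nr v) * rd u v.
  by move: E H; set t := nr u / nr v => E H; rewrite -E; rewrite -E in H; nra.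
have -> : 2 * nr u ^+ 2 - 2 * (nr u / nr v) * rd u v =
  2 * (nr u / nr v) * (nr u * nr v - rd u v) by field.
by rewrite pmulr_rge0 ?subr_ge0 // mulr_gt0 // divr_gt0.
Qed.

Lemma nrD n (u v : 'cV[C]_n) : nr (u + v) <= nr u + nr v.
Proof.
rewrite -(@ler_pXn2r _ 2) ?nnegrE ?addr_ge0 ?nr_ge0 // sqrrD !nr2.
rewrite rdDl !rdDr (rdC v u); have := rd_le_nr u v; lra.
Qed.

Lemma nrB n (u v : 'cV[C]_n) : nr (u - v) <= nr u + nr v.
Proof. by rewrite -[nr v]nrN nrD. Qed.

Lemma nrB_ge n (u v : 'cV[C]_n) : nr u - nr v <= nr (u + v).
Proof. by rewrite lerBlDr; have := nrB (u + v) v; rewrite addrK. Qed.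

Lemma nr_le_sq n m (u : 'cV[C]_n) (v : 'cV[C]_m) c : 0 <= c ->
  (nr u <= c * nr v) = (rd u u <= c ^+ 2 * rd v v).
Proof.
by move=> c0; rewrite -!nr2 -exprMn ler_pXn2r ?nnegrE ?mulr_ge0 ?nr_ge0.
Qed.

(** An operator-norm bound as a predicate, so that no supremum has to be formed. *)
Definition nb m n (c : R) (A : 'M[C]_(m, n)) := forall v, nr (A *m v) <= c * nr v.

Lemma nb_ge m n c c' (A : 'M[C]_(m, n)) : c <= c' -> nb c A -> nb c' A.
Proof. by move=> h H v; apply: (le_trans (H v)); rewrite ler_wpM2r ?nr_ge0. Qed.

Lemma nbD m n a b (A B : 'M[C]_(m, n)) : nb a A -> nb b B -> nb (a + b) (A + B).
Proof.
move=> HA HB v; rewrite mulmxDl mulrDl.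
by apply: (le_trans (nrD _ _)); rewrite lerD.
Qed.

Lemma nbN m n a (A : 'M[C]_(m, n)) : nb a A -> nb a (- A).
Proof. by move=> H v; rewrite mulNmx nrN. Qed.

Lemma nbB m n a b (A B : 'M[C]_(m, n)) : nb a A -> nb b B -> nb (a + b) (A - B).
Proof. by move=> HA HB; apply: nbD=> //; apply: nbN. Qed.

Lemma nbM m n p a b (A : 'M[C]_(m, n)) (B : 'M[C]_(n, p)) : 0 <= a ->
  nb a A -> nb b B -> nb (a * b) (A *m B).
Proof.
move=> a0 HA HB v; rewrite -mulmxA -mulrA.
by apply: (le_trans (HA _)); rewrite ler_wpM2l.
Qed.

Lemma nbZ m n r a (A : 'M[C]_(m, n)) : nb a A -> nb (`|r| * a) (r *r A).
Proof. by move=> H v; rewrite -scalemxAl nrZ -mulrA ler_wpM2l. Qed.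

Lemma nb1 n : nb 1 (1%:M : 'M[C]_n).
Proof. by move=> v; rewrite mul1mx mul1r. Qed.

Lemma nb0 m n : nb 0 (0 : 'M[C]_(m, n)).
Proof. by move=> v; rewrite mul0mx /nr rd0r sqrtr0 mul0r. Qed.

Lemma nb_adj m n c (A : 'M[C]_(m, n)) : 0 <= c -> nb c A -> nb c (adj A).
Proof.
move=> c0 H v; have [v0|v0] := eqVneq (nr (adj A *m v)) 0.
  by rewrite v0 mulr_ge0 ?nr_ge0.
have vp : 0 < nr (adj A *m v) by rewrite lt_def v0 nr_ge0.
rewrite -(ler_pM2r vp) -expr2 nr2 rd_adjl adjK.
apply: (le_trans (rd_le_nr _ _)).
by rewrite -mulrA mulrCA ler_wpM2l ?nr_ge0.
Qed.

Lemma nb_sq m n c (A : 'M[C]_(m, n)) : 0 <= c ->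
  (forall v, rd (A *m v) (A *m v) <= c ^+ 2 * rd v v) -> nb c A.
Proof. by move=> c0 H v; rewrite nr_le_sq. Qed.

Lemma nb_rd m n c (A : 'M[C]_(m, n)) v : 0 <= c -> nb c A ->
  rd (A *m v) (A *m v) <= c ^+ 2 * rd v v.
Proof. by move=> c0 H; rewrite -nr_le_sq. Qed.

End Hilbert.

(** * Positive operators and tensor products *)

Notation "A *t B" := (tensmx A B) (at level 40, left associativity) : ring_scope.

Section Positivity.
Variable R : realType.
Local Notation C := (R[i]).
Local Notation herm := (@Defs.hermitian R _).

Lemma trC_adj m n (A : 'M[C]_(m, n)) : map_mx (@Num.conj C) A^T = adj A.
Proof. by apply/matrixP=> i j; rewrite !mxE. Qed.

Lemma mxform_delta n (B : 'M[C]_n) i j (a b : C) :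
  (adj (a *: delta_mx i 0 : 'cV_n) *m B *m (b *: delta_mx j 0 : 'cV_n)) 0 0
  = conjc a * b * B i j.
Proof.
have -> : adj (a *: delta_mx i 0 : 'cV_n) = conjc a *: delta_mx 0 i.
  apply/matrixP=> x y; rewrite adjE !mxE rmorphM andbC.
  by congr (_ * _); rewrite rmorph_nat.
by rewrite -!scalemxAl -scalemxAr -rowE -colE !mxE mulrA.
Qed.

(** Polarization over the complex field: testing on basis vectors i and j gives B i j + B j i = 0,
    and multiplying the second one by the imaginary unit gives B i j - B j i = 0. *)
Lemma mxform_eq0 n (B : 'M[C]_n) :
  (forall v : 'cV_n, (adj v *m B *m v) 0 0 = 0) -> B = 0.
Proof.
move=> H; have H2 (u w : 'cV_n) : (adj u *m B *m w) 0 0 + (adj w *m B *m u) 0 0 = 0.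
  have := H (u + w); rewrite adjD !mulmxDl !mulmxDr !mxE.
  by have := H u; have := H w; rewrite !mxE => -> ->; rewrite addr0 add0r.
apply/matrixP=> i j; rewrite [RHS]mxE.
have h2 := H2 (1 *: delta_mx i 0) (1 *: delta_mx j 0).
have h1 := H2 (1 *: delta_mx i 0) ('i%C *: delta_mx j 0).
have E1 : conjc (1 : C) = 1 by exact: rmorph1.
rewrite (mxform_delta B i j) (mxform_delta B j i) E1 !mul1r in h2.
rewrite (mxform_delta B i j) (mxform_delta B j i) E1 !mul1r in h1.
have i0 : ('i%C : C) != 0.
  by apply/eqP=> - [] /eqP; rewrite oner_eq0.
have E : conjc ('i%C : C) = - 'i%C by rewrite /= /GRing.opp /= oppr0.
move: h1; rewrite E mulr1 mulNr -mulrBr => /eqP; rewrite mulf_eq0 (negbTE i0) /= subr_eq0 => /eqP e.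
by move: h2; rewrite -e -mulr2n => /eqP; rewrite mulrn_eq0 /= => /eqP.
Qed.

(** In the order on complex numbers [0 <= z] says that z is real as well, so the quadratic form of A
    - adj A vanishes. *)
Lemma psd_herm n (A : 'M[C]_n) : psd A -> herm A.
Proof.
move=> H; rewrite /Defs.hermitian; apply/eqP; rewrite -subr_eq0; apply/eqP.
apply: mxform_eq0 => v; rewrite mulmxBr mulmxBl.
have -> : adj v *m adj A *m v = adj (adj v *m A *m v) by rewrite !adjM adjK mulmxA.
have := H v; set z := adj v *m A *m v; move=> z0.
rewrite mxE adjE [(- z) 0 0]mxE; move: z0; case: (z 0 0)=> a b; rewrite lecE /= => /andP[/eqP -> _].
by rewrite oppr0 subrr.
Qed.

(** Positivity as a factorization with any number of rows: sums, tensor products and congruences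
    then have explicit factors and need no spectral theory. *)
Definition pos n (A : 'M[C]_n) := exists m (X : 'M[C]_(m, n)), A = adj X *m X.

Lemma pos_rd n (A : 'M[C]_n) v : pos A -> 0 <= rd v (A *m v).
Proof. by case=> m [X ->]; rewrite -mulmxA rd_adjr adjK rd_ge0. Qed.

Lemma pos_sq m n (X : 'M[C]_(m, n)) : pos (adj X *m X).
Proof. by exists m, X. Qed.

Lemma pos_sqC m n (X : 'M[C]_(n, m)) : pos (X *m adj X).
Proof. by exists m, (adj X); rewrite adjK. Qed.

Lemma posD n (A B : 'M[C]_n) : pos A -> pos B -> pos (A + B).
Proof.
case=> m [X ->] [p [Y ->]]; exists (m + p)%N, (col_mx X Y).
by rewrite /adj map_col_mx tr_col_mx mul_row_col.
Qed.

Lemma posZ n r (A : 'M[C]_n) : 0 <= r -> pos A -> pos (r *r A).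
Proof.
move=> r0 [m [X ->]]; exists m, (Num.sqrt r *r X).
by rewrite adjZ -scalemxAl -scalemxAr scalerA -rmorphM -expr2 sqr_sqrtr.
Qed.

Lemma pos_congr m n (A : 'M[C]_n) (Y : 'M[C]_(n, m)) : pos A -> pos (adj Y *m A *m Y).
Proof. by case=> p [X ->]; exists p, (X *m Y); rewrite adjM !mulmxA. Qed.

Lemma pos_tens m n (A : 'M[C]_m) (B : 'M[C]_n) : pos A -> pos B -> pos (A *t B).
Proof.
case=> p [X ->] [q [Y ->]]; exists (p * q)%N, (X *t Y).
by rewrite adj_tens tensmx_mul.
Qed.

Lemma pos1 n : pos (1%:M : 'M[C]_n).
Proof. by exists n, 1%:M; rewrite adj1 mulmx1. Qed.

Lemma pos0 n : pos (0 : 'M[C]_n).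
Proof. by exists n, 0; rewrite mulmx0. Qed.

(** This direction uses the spectral theorem: the factor is the square root of the diagonal part
    times the diagonalizing unitary. *)
Lemma psd_factor n (A : 'M[C]_n) : psd A -> pos A.
Proof.
move=> H; have hA := psd_herm H.
have nA : A \is normalmx by apply/normalmxP; rewrite trC_adj hA.
have /orthomx_spectralP E := nA.
move: E (spectral_unitarymx A); set P := spectralmx A; set sp := spectral_diag A.
move=> E uP; have EP : invmx P = adj P by rewrite invmx_unitary ?trC_adj.
have PP : P *m adj P = 1%:M by move/unitarymxP: uP; rewrite trC_adj.
have sp0 i : 0 <= sp 0 i.
  have := H (adj P *m (delta_mx i 0)).
  rewrite E EP adjM adjK -!mulmxA.
  rewrite (mulmxA P (adj P)) PP mul1mx (mulmxA P (adj P)) PP mul1mx mulmxA.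
  rewrite -[delta_mx i 0]scale1r mxform_delta rmorph1 !mul1r.
  by rewrite mxE eqxx.
exists n, (diag_mx (\row_j sqrtc (sp 0 j)) *m P).
rewrite adjM {1}E EP -!mulmxA; congr (_ *m _); rewrite mulmxA; congr (_ *m _).
apply/matrixP=> i j; rewrite !mxE (bigD1 i) //= big1 ?addr0 => [|k ki].
  rewrite !mxE eqxx mulr1n; have [->|ij] := eqVneq i j; last first.
    by rewrite !mulr0n mulr0.
  rewrite !mulr1n; have := sp0 j; rewrite -sqrtc_ge0 => s0.
  have -> : conjc (sqrtc (sp 0 j)) = sqrtc (sp 0 j).
    by move: s0; case: (sqrtc _)=> a b; rewrite lecE /= => /andP[/eqP -> _]; rewrite oppr0.
  by rewrite -expr2 sqr_sqrtc.
by rewrite !mxE (negbTE ki) mulr0n rmorph0 mul0r.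
Qed.

Lemma rd_psd n (A : 'M[C]_n) : herm A -> (forall v, 0 <= rd v (A *m v)) -> psd A.
Proof.
move=> hA H v; have := H v; rewrite /rd mulmxA.
have : adj (adj v *m A *m v) = adj v *m A *m v by rewrite !adjM adjK hA mulmxA.
move/matrixP/(_ 0 0); rewrite adjE; case: (_ 0 0)=> a b [] /eqP.
rewrite -subr_eq0 -opprD oppr_eq0 -mulr2n mulrn_eq0 /= => /eqP -> h.
by rewrite lecE /= eqxx.
Qed.

Lemma rd_pos n (A : 'M[C]_n) : herm A -> (forall v, 0 <= rd v (A *m v)) -> pos A.
Proof. by move=> hA H; apply: psd_factor; apply: rd_psd. Qed.

Lemma nb_pos m n c (A : 'M[C]_(m, n)) : 0 <= c -> nb c A -> pos (c ^+ 2 *r 1%:M - adj A *m A).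
Proof.
move=> c0 H; apply: rd_pos => [|v].
  by apply: hermitianB; [apply: hermitianZ; exact: hermitian1|exact: hermitian_adjM].
rewrite mulmxBl -scalemxAl mul1mx rdBr rdZr -mulmxA rd_adjr adjK subr_ge0.
exact: nb_rd.
Qed.

End Positivity.

Section Tensors.
Variable R : realType.
Local Notation C := (R[i]).

Lemma tensDl m n p q (A B : 'M[C]_(m, n)) (D : 'M[C]_(p, q)) : (A + B) *t D = A *t D + B *t D.
Proof. by apply/matrixP=> i j; rewrite !mxE mulrDl. Qed.

Lemma tensDr m n p q (A B : 'M[C]_(m, n)) (D : 'M[C]_(p, q)) : D *t (A + B) = D *t A + D *t B.
Proof. by apply/matrixP=> i j; rewrite !mxE mulrDr. Qed.

Lemma tensZl m n p q r (A : 'M[C]_(m, n)) (D : 'M[C]_(p, q)) : (r *r A) *t D = r *r (A *t D).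
Proof. by apply/matrixP=> i j; rewrite !mxE mulrA. Qed.

Lemma tensZr m n p q r (A : 'M[C]_(m, n)) (D : 'M[C]_(p, q)) : D *t (r *r A) = r *r (D *t A).
Proof. by apply/matrixP=> i j; rewrite !mxE mulrCA. Qed.

Lemma tensNl m n p q (A : 'M[C]_(m, n)) (D : 'M[C]_(p, q)) : (- A) *t D = - (A *t D).
Proof. by rewrite rN1 tensZl -rN1. Qed.

Lemma tensNr m n p q (A : 'M[C]_(m, n)) (D : 'M[C]_(p, q)) : D *t (- A) = - (D *t A).
Proof. by rewrite rN1 tensZr -rN1. Qed.

Lemma tens_suml m n p q I (s : seq I) (F : I -> 'M[C]_(m, n)) (D : 'M[C]_(p, q)) :
  (\sum_(i <- s) F i) *t D = \sum_(i <- s) F i *t D.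
Proof. by elim/big_rec2: _ => [|i x y _ <-]; rewrite ?tens0mx ?tensDl. Qed.

Lemma tens_sumr m n p q I (s : seq I) (F : I -> 'M[C]_(m, n)) (D : 'M[C]_(p, q)) :
  D *t (\sum_(i <- s) F i) = \sum_(i <- s) D *t F i.
Proof. by elim/big_rec2: _ => [|i x y _ <-]; rewrite ?tensmx0 ?tensDr. Qed.

Lemma tens11 m n : (1%:M : 'M[C]_m) *t (1%:M : 'M[C]_n) = 1%:M.
Proof.
apply/matrixP=> i j; case: (mxtens_indexP i)=> a b; case: (mxtens_indexP j)=> c d.
rewrite tensmxE !mxE -natrM mulnb; congr (_%:R); congr nat_of_bool.
by rewrite (can_eq (@mxtens_indexK _ _)) xpair_eqE.
Qed.

Lemma mxtrace_tens m n (A : 'M[C]_m) (B : 'M[C]_n) : \tr (A *t B) = \tr A * \tr B.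
Proof.
rewrite /mxtrace mulr_sum; apply: eq_bigr=> i _.
by rewrite mxE.
Qed.

End Tensors.

(** * Product and one-body operators *)

Section MatrixRing.
Variable K : pzRingType.
Variables m n : nat.
Implicit Types A B : 'M[K]_(m, n).
Lemma mx_add A B i j : (A + B) i j = A i j + B i j. Proof. by rewrite mxE. Qed.
Lemma mx_opp A i j : (- A) i j = - A i j. Proof. by rewrite mxE. Qed.
Lemma mx_scale c A i j : (c *: A) i j = c * A i j. Proof. by rewrite mxE. Qed.
Lemma mx_zero i j : (0 : 'M[K]_(m, n)) i j = 0. Proof. by rewrite mxE. Qed.
End MatrixRing.

Ltac mxring := let i := fresh "i" in let j := fresh "j" in
  apply/matrixP=> i j; rewrite !(mx_add, mx_opp, mx_scale, mx_zero); ring.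
Ltac mxfield := let i := fresh "i" in let j := fresh "j" in
  apply/matrixP=> i j; rewrite !(mx_add, mx_opp, mx_scale, mx_zero); field.

Section Sites.
Variable R : realType.
Local Notation C := (R[i]).
Local Notation herm := (@Defs.hermitian R _).
Variable D : nat.
Implicit Types a b A B : 'M[C]_D.

Lemma tpowM A B n : tpow (A *m B) n = tpow A n *m tpow B n.
Proof. by elim: n => [|n IH] /=; rewrite ?mulmx1 // tensmx_mul IH. Qed.

Lemma tpow1 n : tpow (1%:M : 'M[C]_D) n = 1%:M.
Proof. by elim: n => [|n IH] //=; rewrite IH tens11. Qed.

Lemma adj_tpow A n : adj (tpow A n) = tpow (adj A) n.
Proof. by elim: n => [|n IH] /=; rewrite ?adj1 // adj_tens IH. Qed.

Lemma tpowZ r A n : tpow (r *r A) n = (r ^+ n) *r tpow A n.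
Proof.
elim: n => [|n IH] /=; first by rewrite expr0 rmorph1 scale1r.
by rewrite IH tensZl tensZr scalerA -rmorphM exprS.
Qed.

Lemma pos_tpow A n : pos A -> pos (tpow A n).
Proof. by move=> pA; elim: n => [|n IH] /=; [exact: pos1|exact: pos_tens]. Qed.

Lemma tpow_mono A B n : pos A -> pos (B - A) -> pos (tpow B n - tpow A n).
Proof.
move=> pA pBA; have pB : pos B by rewrite -[B](subrK A); exact: posD.
elim: n => [|n IH] /=; first by rewrite subrr; exact: pos0.
(* Telescoping: one tensor factor is exchanged at a time, and every summand is a tensor product of
   positive operators. *)
have -> : B *t tpow B n - A *t tpow A n =
  (B - A) *t tpow B n + A *t (tpow B n - tpow A n).
  by rewrite tensDl tensDr tensNl tensNr addrA subrK.
by apply: posD; apply: pos_tens=> //; exact: pos_tpow.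
Qed.

(* The one-body operator a(1) + ... + a(n), where a(j) acts as a on the j-th tensor factor. *)
Fixpoint sm a n : 'M[C]_(pw D n) :=
  if n is n'.+1 return 'M[C]_(pw D n) then a *t 1%:M + 1%:M *t sm a n' else 0.

Lemma smD a b n : sm (a + b) n = sm a n + sm b n.
Proof.
elim: n => [|n IH] /=; first by rewrite addr0.
by rewrite IH tensDl tensDr addrACA.
Qed.

Lemma smZ r a n : sm (r *r a) n = r *r sm a n.
Proof.
elim: n => [|n IH] /=; first by rewrite scaler0.
by rewrite IH tensZl tensZr scalerDr.
Qed.

Lemma smN a n : sm (- a) n = - sm a n.
Proof. by rewrite rN1 smZ -rN1. Qed.

Lemma smB a b n : sm (a - b) n = sm a n - sm b n.
Proof. by rewrite smD smN. Qed.

Lemma adj_sm a n : adj (sm a n) = sm (adj a) n.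
Proof.
elim: n => [|n IH] /=; first by rewrite adj0.
by rewrite adjD !adj_tens IH !adj1.
Qed.

Lemma sm1 n : sm 1%:M n = n%:R *r 1%:M.
Proof.
elim: n => [|n IH] /=; first by rewrite scale0r.
by rewrite IH tensZr !tens11 -natr1 rmorphD rmorph1 scalerDl scale1r addrC.
Qed.

Lemma tpow_sm g a b n : g *m a = b *m g -> tpow g n *m sm a n = sm b n *m tpow g n.
Proof.
move=> E; elim: n => [|n IH] /=; first by rewrite mulmx0 mul0mx.
by rewrite mulmxDr mulmxDl !tensmx_mul !mulmx1 !mul1mx E IH.
Qed.

Lemma pos_sm a n : pos a -> pos (sm a n).
Proof.
move=> pa; elim: n => [|n IH] /=; first exact: pos0.
by apply: posD; apply: pos_tens=> //; exact: pos1.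
Qed.

(** Terms on different tensor factors commute, so only the n commutators on equal factors
    survive. *)
Lemma sm_comm a b n : sm a n *m sm b n - sm b n *m sm a n = sm (a *m b - b *m a) n.
Proof.
elim: n => [|n IH] /=; first by rewrite !mulmx0 subrr.
rewrite -IH !mulmxDr !mulmxDl !tensmx_mul !mulmx1 !mul1mx tensDl tensDr tensNl tensNr.
mxring.
Qed.

(** Cauchy-Schwarz for the n operator-valued summands of [sm a]. *)
Lemma sm_cauchy a n : pos (n%:R *r sm (a *m adj a) n - sm a n *m adj (sm a n)).
Proof.
elim: n => [|n IH] /=; first by rewrite scale0r mul0mx subrr; exact: pos0.
rewrite !(adjD, adj_tens, adj1).
have [n0|n0] := eqVneq n 0%N.
  subst n; rewrite /= !(tensmx0, adj0, addr0, scale1r) tensmx_mul mulmx1 subrr.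
  exact: pos0.
have nR : (n%:R : R) != 0 by rewrite pnatr_eq0.
set S := sm a n in IH *; set T := sm _ n in IH *.
(* The square of [X] compares the new summand with the average of the n old ones; the weight 1 / n
   makes the cross terms match. *)
pose X : 'M[C]_(pw D n.+1) := n%:R *r (a *t 1%:M) - 1%:M *t S.
suff -> : n.+1%:R *r ((a *m adj a) *t 1%:M + 1%:M *t T) -
   (a *t 1%:M + 1%:M *t S) *m (adj a *t 1%:M + 1%:M *t adj S) =
   (1 + n%:R^-1) *r (1%:M *t (n%:R *r T - S *m adj S)) + n%:R^-1 *r (X *m adj X).
  apply: posD; apply: posZ; rewrite ?addr_ge0 ?invr_ge0 ?ler0n //.
    by apply: pos_tens=> //; exact: pos1.
  exact: pos_sqC.
rewrite /X adjD adjN adjZ !adj_tens !adj1.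
rewrite !(mulmxDl, mulmxDr, mulmxN, mulNmx) -!scalemxAl -!scalemxAr !tensmx_mul.
rewrite !(mulmx1, mul1mx, tensDr, tensNr, tensZr).
rewrite -natr1 !(rmorphD, rmorph1, rmorph_nat, fmorphV) /=.
mxfield.
all: by rewrite pnatr_eq0.
Qed.

End Sites.

(** * Counting the tensor factors orthogonal to the state *)

Section Levels.
Variable R : realType.
Local Notation C := (R[i]).
Local Notation herm := (@Defs.hermitian R _).
Variable D : nat.
Variable P : 'M[C]_D.
Hypothesis hP : herm P.
Hypothesis PP : P *m P = P.
Local Notation Q := (1%:M - P).
Implicit Types a A B : 'M[C]_D.
Implicit Types f g h : nat -> R.

Lemma QQ : Q *m Q = Q.
Proof. by rewrite mulmxBl mul1mx mulmxBr mulmx1 PP subrr subr0. Qed.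
Lemma PQ : P *m Q = 0. Proof. by rewrite mulmxBr mulmx1 PP subrr. Qed.
Lemma QP : Q *m P = 0. Proof. by rewrite mulmxBl mul1mx PP subrr. Qed.
Lemma hQ : herm Q. Proof. by apply: hermitianB=> //; exact: hermitian1. Qed.

Lemma posP : pos P.
Proof. by rewrite -PP -{1}hP; exact: pos_sq. Qed.
Lemma posQ : pos Q.
Proof. by rewrite -QQ -{1}hQ; exact: pos_sq. Qed.

Lemma nb_proj A : herm A -> A *m A = A -> nb 1 A.
Proof.
move=> hA AA; apply: nb_sq => // v; rewrite expr1n mul1r.
have E : rd v v = rd (A *m v) (A *m v) + rd (v - A *m v) (v - A *m v).
  have O : rd (A *m v) (v - A *m v) = 0.
    by rewrite rd_adjl hA mulmxBr mulmxA AA subrr rd0r.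
  have pyth (x y : 'cV[C]_D) : rd x y = 0 -> rd (x + y) (x + y) = rd x x + rd y y.
    by move=> xy; rewrite rdDl !rdDr xy (rdC y) xy addr0 add0r.
  by rewrite -(pyth _ _ O) addrC subrK.
rewrite E lerDl; exact: rd_ge0.
Qed.

Lemma nbP : nb 1 P. Proof. exact: nb_proj. Qed.
Lemma nbQ : nb 1 Q. Proof. by apply: nb_proj; [exact: hQ|exact: QQ]. Qed.

(* lv f is f(W), where W = sm Q counts the tensor factors orthogonal to the range of P. *)
Fixpoint lv f n : 'M[C]_(pw D n) :=
  if n is n'.+1 return 'M[C]_(pw D n) then P *t lv f n' + Q *t lv (fun w => f w.+1) n'
  else f 0%N *r 1%:M.

Lemma eq_lv f g n : f =1 g -> lv f n = lv g n.
Proof.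
elim: n f g => [|n IH] f g E /=; first by rewrite E.
by rewrite (IH _ _ E) (IH (fun w => f w.+1) (fun w => g w.+1)).
Qed.

Lemma lvM f g n : lv f n *m lv g n = lv (fun w => f w * g w) n.
Proof.
elim: n f g => [|n IH] f g /=.
  by rewrite -scalemxAl -scalemxAr mulmx1 scalerA -rmorphM.
rewrite !mulmxDl !mulmxDr !tensmx_mul PP PQ QP QQ !tens0mx.
by rewrite addr0 add0r !IH.
Qed.

Lemma lvD f g n : lv f n + lv g n = lv (fun w => f w + g w) n.
Proof.
elim: n f g => [|n IH] f g /=; first by rewrite -scalerDl -rmorphD.
by rewrite addrACA -!tensDr !IH.
Qed.

Lemma lvZ r f n : r *r lv f n = lv (fun w => r * f w) n.
Proof.
elim: n f => [|n IH] f /=; first by rewrite scalerA -rmorphM.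
by rewrite scalerDr -!tensZr !IH.
Qed.

Lemma lvB f g n : lv f n - lv g n = lv (fun w => f w - g w) n.
Proof. by rewrite rN1 lvZ lvD; apply: eq_lv=> w; rewrite mulN1r. Qed.

Lemma adj_lv f n : adj (lv f n) = lv f n.
Proof.
elim: n f => [|n IH] f /=; first by rewrite adjZ adj1.
by rewrite adjD !adj_tens !IH hP hQ.
Qed.

Lemma lv_cst r n : lv (fun=> r) n = r *r 1%:M.
Proof. by elim: n => [|n IH] //=; rewrite IH -tensDl addrC subrK tensZr tens11. Qed.

Lemma lv_id n : lv (fun w => w%:R) n = sm Q n.
Proof.
elim: n => [|n IH] /=; first by rewrite scale0r.
have -> : lv (fun w => w.+1%:R) n = sm Q n + 1%:M.
  rewrite -IH -[1%:M]scale1r -(rmorph1 (real_complex R)) -lv_cst lvD.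
  by apply: eq_lv=> w; rewrite natr1.
by rewrite IH tensDr addrA -tensDl addrCA subrr addr0 addrC.
Qed.

Lemma lv_exp c n : lv (fun w => c ^+ w) n = tpow (P + c *r Q) n.
Proof.
elim: n => [|n IH] /=; first by rewrite expr0 rmorph1 scale1r.
rewrite IH -[lv _ n](eq_lv (f := fun w => c * c ^+ w)) => [|w]; last by rewrite exprS.
by rewrite -lvZ IH tensZr -tensZl -tensDl.
Qed.

Lemma pos_lv f n : (forall w, 0 <= f w) -> pos (lv f n).
Proof.
elim: n f => [|n IH] f H /=; first by apply: posZ=> //; exact: pos1.
by apply: posD; apply: pos_tens; [exact: posP|exact: IH|exact: posQ|exact: IH].
Qed.

Lemma rd_lv_le f g n v : (forall w, f w <= g w) -> rd v (lv f n *m v) <= rd v (lv g n *m v).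
Proof.
move=> H; rewrite -subr_ge0 -rdBr -mulmxBl lvB.
by apply: pos_rd; apply: pos_lv=> w; rewrite subr_ge0.
Qed.

(** The hypotheses say a = Q a P: such an operator moves one factor out of the range of P, hence
    raises W by one. *)
Lemma lv_raise f a n : P *m a = 0 -> a *m P = a ->
  lv f n *m sm a n = sm a n *m lv (fun w => f w.+1) n.
Proof.
move=> H1 H2; elim: n f => [|n IH] f /=; first by rewrite mulmx0 mul0mx.
have H3 : Q *m a = a by rewrite mulmxBl mul1mx H1 subr0.
have H4 : a *m Q = 0 by rewrite mulmxBr mulmx1 H2 subrr.
rewrite !mulmxDl !mulmxDr !tensmx_mul H1 H2 H3 H4 !tens0mx !mulmx1 !mul1mx !IH.
by rewrite add0r addr0 addrCA addrA.
Qed.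

Lemma lv_lower f a n : P *m a = a -> a *m P = 0 ->
  lv (fun w => f w.+1) n *m sm a n = sm a n *m lv f n.
Proof.
move=> H1 H2; have := @lv_raise f (adj a) n.
rewrite -{1}hP -adjM H2 adj0 -[X in _ *m X = adj a]hP -adjM H1.
by move=> /(_ erefl erefl)/(congr1 (@adj _ _ _)); rewrite !adjM !adj_lv adj_sm adjK => <-.
Qed.

Lemma lv_diag f a n : P *m a = a *m P -> lv f n *m sm a n = sm a n *m lv f n.
Proof.
move=> H; elim: n f => [|n IH] f /=; first by rewrite mulmx0 mul0mx.
have HQ : Q *m a = a *m Q by rewrite mulmxBl mulmxBr mul1mx mulmx1 H.
by rewrite !mulmxDl !mulmxDr !tensmx_mul !mulmx1 !mul1mx !IH H HQ addrACA.
Qed.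

Lemma sub_sq_proj_gen Z b a : herm Z -> Z *m Z = Z ->
  0 <= b -> nb b a -> Z *m a = a -> pos (b ^+ 2 *r Z - a *m adj a).
Proof.
move=> hZ ZZ b0 Hb E; have := pos_congr Z (nb_pos b0 (nb_adj b0 Hb)).
have E2 : adj a *m Z = adj a by rewrite -{1}hZ -adjM E.
rewrite adjK hZ mulmxBr mulmxBl -!scalemxAr -scalemxAl mulmx1 ZZ.
by rewrite mulmxA E -mulmxA E2.
Qed.

Lemma sub_sq_proj b a : 0 <= b -> nb b a -> Q *m a = a -> pos (b ^+ 2 *r Q - a *m adj a).
Proof. by apply: sub_sq_proj_gen; [exact: hQ|exact: QQ]. Qed.

Lemma rd_sm_cauchy a n v :
  rd (adj (sm a n) *m v) (adj (sm a n) *m v) <= n%:R * rd v (sm (a *m adj a) n *m v).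
Proof.
have := pos_rd v (sm_cauchy a n).
by rewrite mulmxBl rdBr -scalemxAl rdZr subr_ge0 rd_adjl adjK mulmxA.
Qed.

Lemma rd_sm_le a1 a2 n v : pos (a2 - a1) -> rd v (sm a1 n *m v) <= rd v (sm a2 n *m v).
Proof. by move=> /(pos_sm n)/(pos_rd v); rewrite smB mulmxBl rdBr subr_ge0. Qed.

Lemma rd_smQ_le x n v : x * rd v (sm Q n *m v) = rd v (lv (fun w => x * w%:R) n *m v).
Proof. by rewrite -lvZ -scalemxAl rdZr lv_id. Qed.

Lemma rd_sm_sq b a n v : nb b a -> 0 <= b -> rd v (sm (adj a *m a) n *m v) <= b ^+ 2 * n%:R * rd v v.
Proof.
move=> Hb b0; apply: (le_trans (rd_sm_le v (nb_pos b0 Hb))).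
by rewrite smZ sm1 -!scalemxAl mul1mx !rdZr mulrA.
Qed.

Lemma rd_sm_sqQ b a n v : nb b a -> 0 <= b -> Q *m a = a ->
  rd v (sm (a *m adj a) n *m v) <= b ^+ 2 * rd v (sm Q n *m v).
Proof.
move=> Hb b0 Ha; apply: (le_trans (rd_sm_le v (sub_sq_proj b0 Hb Ha))).
by rewrite smZ -scalemxAl rdZr.
Qed.

(** A quadratic-form bound by a function of W reduces the norm estimate to a scalar inequality on
    each level. *)
Lemma nb_lv_comp a h g n K : 0 <= K ->
  (forall v, rd (sm a n *m v) (sm a n *m v) <= rd v (lv g n *m v)) ->
  (forall w, g w * h w ^+ 2 <= K ^+ 2) -> nb K (sm a n *m lv h n).
Proof.
move=> K0 H HK; apply: nb_sq=> // v; rewrite -mulmxA.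
apply: (le_trans (H _)).
rewrite rd_adjl adj_lv !mulmxA !lvM.
apply: (@le_trans _ _ (rd v (lv (fun=> K ^+ 2) n *m v))); last first.
  by rewrite lv_cst -scalemxAl mul1mx rdZr.
by apply: rd_lv_le=> w; apply: le_trans (HK w); rewrite mulrC mulrCA mulrA -expr2 mulrC.
Qed.

(** As for a creation operator: [adj (sm a) *m sm a] equals [sm a *m adj (sm a)], which is at most n
    b^2 W by [sm_cauchy] and a adj a <= b^2 Q, plus a commutator that is one-body and at most n
    b^2. *)
Lemma nb_sm_raise b a h n K : 0 <= b -> 0 <= K -> nb b a -> P *m a = 0 -> a *m P = a ->
  (forall w, b ^+ 2 * n%:R * (w%:R + 1) * h w ^+ 2 <= K ^+ 2) ->
  nb K (sm a n *m lv h n).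
Proof.
move=> b0 K0 Hb H1 H2; apply: nb_lv_comp=> // u.
have H3 : Q *m a = a by rewrite mulmxBl mul1mx H1 subr0.
have q1 := rd_sm_cauchy a u.
have q2 := rd_sm_sqQ u Hb b0 H3.
have q3 := rd_sm_sq u Hb b0.
have q4 : 0 <= rd u (sm (a *m adj a) n *m u) by apply/pos_rd/pos_sm/pos_sqC.
have -> : rd (sm a n *m u) (sm a n *m u) = rd (adj (sm a n) *m u) (adj (sm a n) *m u)
   + rd u (sm (adj a *m a) n *m u) - rd u (sm (a *m adj a) n *m u).
  rewrite -addrA -rdBr -mulmxBl -smB -sm_comm mulmxBl rdBr -!mulmxA.
  by rewrite -!adj_sm (rd_adjl (sm a n)) (rd_adjl (adj (sm a n))) adjK addrC subrK.
have -> : rd u (lv (fun w => b ^+ 2 * n%:R * (w%:R + 1)) n *m u) =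
  b ^+ 2 * n%:R * rd u (sm Q n *m u) + b ^+ 2 * n%:R * rd u u.
  have -> : b ^+ 2 * n%:R * rd u u = rd u (lv (fun=> b ^+ 2 * n%:R) n *m u).
    by rewrite lv_cst -scalemxAl mul1mx rdZr.
  rewrite rd_smQ_le -rdDr -mulmxDl lvD.
  by congr (rd u (_ *m u)); apply: eq_lv => w; rewrite mulrDr mulr1.
have n0 : (0 : R) <= n%:R by rewrite ler0n.
move: q1 q2 q3 q4 n0; move: (rd _ _) (rd _ _) (rd _ _) (rd _ _) (rd _ _) n%:R (b ^+ 2).
move=> x1 x2 x3 x4 x5 N B q1 q2 q3 q4 n0.
have := ler_wpM2l n0 q2; rewrite mulrA (mulrC N) => le1; clear -le1 q1 q3 q4; lra.
Qed.

(** For a lowering operator [sm_cauchy] applies in the right order at once, so no commutator appears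
    and W replaces W + 1. *)
Lemma nb_sm_lower b a h n K : 0 <= b -> 0 <= K -> nb b a -> P *m a = a -> a *m P = 0 ->
  (forall w, b ^+ 2 * n%:R * w%:R * h w ^+ 2 <= K ^+ 2) ->
  nb K (sm a n *m lv h n).
Proof.
move=> b0 K0 Hb H1 H2; apply: nb_lv_comp=> // u.
have H3 : Q *m adj a = adj a.
  by rewrite mulmxBl mul1mx -{1}hP -adjM H2 adj0 subr0.
have q1 := rd_sm_cauchy (adj a) u.
have q2 := rd_sm_sqQ u (nb_adj b0 Hb) b0 H3.
rewrite adj_sm !adjK in q1 q2; apply: (le_trans q1).
by rewrite -rd_smQ_le mulrAC mulrC ler_wpM2r // mulrC.
Qed.

Lemma nb_sm b a n : 0 <= b -> nb b a -> nb (b * n%:R) (sm a n).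
Proof.
move=> b0 Hb; apply: nb_sq=> [|v]; first by rewrite mulr_ge0.
have q1 := rd_sm_cauchy (adj a) v.
have q3 := rd_sm_sq v Hb b0.
rewrite adj_sm !adjK in q1; apply: (le_trans q1).
apply: (@le_trans _ _ (n%:R * (b ^+ 2 * n%:R * rd v v))); first by rewrite ler_wpM2l.
by rewrite le_eqVlt; apply/orP; left; apply/eqP; ring.
Qed.

Lemma nb_lv h n K : 0 <= K -> (forall w, `|h w| <= K) -> nb K (lv h n).
Proof.
move=> K0 H; apply: nb_sq=> // v.
rewrite rd_adjl adj_lv mulmxA lvM.
have -> : K ^+ 2 * rd v v = rd v (lv (fun=> K ^+ 2) n *m v).
  by rewrite lv_cst -scalemxAl mul1mx rdZr.
apply: rd_lv_le=> w; rewrite -expr2 -real_normK ?num_real //.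
by rewrite ler_pXn2r ?nnegrE.
Qed.

End Levels.

(** * One-body operators measured against powers of k + W *)

Section OneBody.
Variable R : realType.
Local Notation C := (R[i]).
Local Notation herm := (@Defs.hermitian R _).
Variable D : nat.
Variable P : 'M[C]_D.
Hypothesis hP : herm P.
Hypothesis PP : P *m P = P.
Local Notation Q := (1%:M - P).
Variables (k n : nat) (r : R).
Hypothesis k0 : (0 < k)%N.
Hypothesis kn : (k <= n)%N.
Hypothesis r0 : 0 <= r.
Hypothesis r2 : r ^+ 2 = n%:R / k%:R.
Implicit Types (a e : 'M[C]_D) (b x : R).

(** The offset [k] makes all powers invertible, and for 2 i <= k it keeps the values at neighbouring
    levels within a factor 2 of each other ([ff_ratio]). *)
Definition ff i (w : nat) : R := (k + w)%:R ^+ i.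

Lemma kw_gt0 w : (0 : R) < (k + w)%:R.
Proof. by rewrite ltr0n addn_gt0 k0. Qed.

Lemma ff_gt0 i w : 0 < ff i w.
Proof. by rewrite exprn_gt0 // kw_gt0. Qed.

(** Bernoulli's inequality for (1 - 1 / (x + 1)) ^ i, cleared of denominators. *)
Lemma bernoulli_ratio x i : 0 <= x -> (x + 1 - i%:R) * (x + 1) ^+ i <= x ^+ i * (x + 1).
Proof.
move=> x0; elim: i => [|i IH]; first by rewrite !expr0; lra.
rewrite !exprS -natr1.
have h : 0 <= (x + 1) ^+ i by rewrite exprn_ge0 //; lra.
have h2 : 0 <= i%:R :> R by rewrite ler0n.
have := ler_wpM2l x0 IH; move: ((x + 1) ^+ i) (x ^+ i) h => y z h.
have := mulr_ge0 h2 h; nra.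
Qed.

Lemma ff_ratio i w : (2 * i <= k)%N -> ff i w.+1 <= 2 * ff i w.
Proof.
move=> ik; rewrite /ff addnS -natr1; have := kw_gt0 w.
have : 2 * i%:R <= (k + w)%:R :> R by rewrite -natrM ler_nat (leq_trans ik) // leq_addr.
move: (k + w)%:R => x h x0; have := bernoulli_ratio i (ltW x0).
have h1 : 0 <= (x + 1) ^+ i by rewrite exprn_ge0 //; lra.
move: ((x + 1) ^+ i) (x ^+ i) h1 => y z h1 h2.
have : (x + 1) * y <= (x + 1) * (2 * z) by nra.
by rewrite ler_pM2l //; lra.
Qed.

(** The relative size of a perturbation of factor number i: since F_i (F_1 + sm a) = (1 + conjT i a)
    F_(i+1), where F_i is [lv P (ff i) n], a product of perturbed factors becomes a product of
    near-identities times an unperturbed power. *)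
Definition conjT i a : 'M[C]_(pw D n) :=
  lv P (ff i) n *m sm a n *m lv P (fun w => (ff i.+1 w)^-1) n.

Lemma conjTD i a e : conjT i (a + e) = conjT i a + conjT i e.
Proof. by rewrite /conjT smD mulmxDr mulmxDl. Qed.

Lemma r_ge1 : 1 <= r ^+ 2.
Proof. by rewrite r2 ler_pdivlMr ?ltr0n // mul1r ler_nat. Qed.

Lemma r_le : r <= r ^+ 2.
Proof. have := r_ge1; nra. Qed.

(** Moving [sm a] to the left leaves one factor k + W in the denominator and a ratio of powers below
    2; then sqrt (n (W + 1)) / (k + W) <= sqrt (n / k) = r. *)
Lemma nb_conjT_raise i a b : 0 <= b -> nb b a -> (2 * i <= k)%N ->
  P *m a = 0 -> a *m P = a -> nb (2 * b * r) (conjT i a).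
Proof.
move=> b0 Hb ik H1 H2; rewrite /conjT (lv_raise _ _ H1 H2) // -mulmxA lvM //.
apply: (nb_sm_raise hP PP b0 _ Hb H1 H2) => [|w]; first by rewrite !mulr_ge0.
have X0 := kw_gt0 w; have fr := ff_ratio w ik; have f0 := ff_gt0 i w; have f1 := ff_gt0 i w.+1.
set h := _ / _.
have hle : h <= 2 / (k + w)%:R.
  rewrite /h /ff exprS -/(ff i w) invfM mulrA mulrAC ler_pM2r ?invr_gt0 //.
  by rewrite ler_pdivrMr.
have h0 : 0 <= h by rewrite divr_ge0 // ltW // ff_gt0.
have hsq : h ^+ 2 <= 4 / (k + w)%:R ^+ 2.
  have -> : 4 / (k + w)%:R ^+ 2 = (2 / (k + w)%:R) ^+ 2 :> R by rewrite expr_div_n; congr (_ / _); ring.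
  by rewrite ler_pXn2r // nnegrE // divr_ge0 // ltW.
have -> : (2 * b * r) ^+ 2 = 4 * (b ^+ 2 * n%:R) * (1 / k%:R) by rewrite !exprMn r2; ring.
have kw : (w%:R + 1) / (k + w)%:R ^+ 2 <= 1 / k%:R :> R.
  rewrite ler_pdivrMr ?exprn_gt0 // mulrAC mul1r ler_pdivlMr ?ltr0n //.
  rewrite natr1 -!natrM expr2 -natrM ler_nat.
  by rewrite (leq_trans (n := (k + w) * k)%N) ?leq_mul // ?leq_addr // -addn1 addnC leq_add2r.
have bn : 0 <= b ^+ 2 * n%:R by rewrite mulr_ge0 ?sqr_ge0 ?ler0n.
have w1 : 0 <= w%:R + 1 :> R by rewrite natr1 ler0n.
apply: (@le_trans _ _ (b ^+ 2 * n%:R * (w%:R + 1) * (4 / (k + w)%:R ^+ 2))).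
  by rewrite ler_wpM2l // mulr_ge0.
have -> : b ^+ 2 * n%:R * (w%:R + 1) * (4 / (k + w)%:R ^+ 2) =
   4 * (b ^+ 2 * n%:R) * ((w%:R + 1) / (k + w)%:R ^+ 2) by ring.
by rewrite ler_wpM2l // mulr_ge0.
Qed.

Lemma nb_conjT_lower i a b : 0 <= b -> nb b a ->
  P *m a = a -> a *m P = 0 -> nb (b * r) (conjT i a).
Proof.
move=> b0 Hb H1 H2; rewrite /conjT.
(* A lowering operator kills level 0, so the value of [f'] there is free; 0 makes the bound on that
   level trivial. *)
pose f' w : R := if w is w'.+1 then ff i w' else 0.
rewrite (lv_lower hP f' _ H1 H2) // -mulmxA lvM //.
apply: (nb_sm_lower hP PP b0 _ Hb H1 H2) => [|[|w]]; first by rewrite !mulr_ge0.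
  by rewrite mulr0 mul0r sqr_ge0.
have X0 := kw_gt0 w.+1; have X1 := kw_gt0 w; have f0 := ff_gt0 i w.+1; have f1 := ff_gt0 i w.
rewrite /f'; set h := _ / _.
have hle : h <= 1 / (k + w.+1)%:R.
  rewrite /h /ff exprS -/(ff i w.+1) invfM mulrA mulrAC ler_pM2r ?invr_gt0 //.
  rewrite ler_pdivrMr // mul1r /ff lerXn2r ?nnegrE ?ler0n // ler_nat.
  by rewrite leq_add2l.
have h0 : 0 <= h by rewrite divr_ge0 // ltW // ff_gt0.
have hsq : h ^+ 2 <= 1 / (k + w.+1)%:R ^+ 2.
  have -> : 1 / (k + w.+1)%:R ^+ 2 = (1 / (k + w.+1)%:R) ^+ 2 :> R by rewrite expr_div_n expr1n.
  by rewrite ler_pXn2r // nnegrE // divr_ge0 // ltW.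
have -> : (b * r) ^+ 2 = (b ^+ 2 * n%:R) * (1 / k%:R) by rewrite exprMn r2; ring.
have kw : w.+1%:R / (k + w.+1)%:R ^+ 2 <= 1 / k%:R :> R.
  rewrite ler_pdivrMr ?exprn_gt0 // mulrAC mul1r ler_pdivlMr ?ltr0n //.
  rewrite -!natrM expr2 -natrM ler_nat.
  by rewrite (leq_trans (n := (k + w.+1) * k)%N) ?leq_mul // ?leq_addr // leq_addl.
have bn : 0 <= b ^+ 2 * n%:R by rewrite mulr_ge0 ?sqr_ge0 ?ler0n.
have w1 : 0 <= w.+1%:R :> R by rewrite ler0n.
apply: (@le_trans _ _ (b ^+ 2 * n%:R * w.+1%:R * (1 / (k + w.+1)%:R ^+ 2))).
  by rewrite ler_wpM2l // mulr_ge0.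
have -> : b ^+ 2 * n%:R * w.+1%:R * (1 / (k + w.+1)%:R ^+ 2) =
   (b ^+ 2 * n%:R) * (w.+1%:R / (k + w.+1)%:R ^+ 2) by ring.
by rewrite ler_wpM2l.
Qed.

Lemma nb_conjT_diag i a b : 0 <= b -> nb b a -> P *m a = a *m P ->
  nb (b * r ^+ 2) (conjT i a).
Proof.
move=> b0 Hb H; rewrite /conjT lv_diag // -mulmxA lvM // r2 mulrA.
apply: nbM; first by rewrite mulr_ge0.
  exact: nb_sm.
apply: nb_lv=> // [|w]; first by rewrite invr_ge0.
have f0 := ff_gt0 i w; rewrite /ff exprS invfM mulrCA mulfV ?mulr1; last by rewrite gt_eqF.
rewrite ger0_norm ?invr_ge0 ?ler0n // lef_pV2 ?posrE ?ltr0n ?addn_gt0 ?k0 //.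
by rewrite ler_nat leq_addr.
Qed.

Lemma mx_blocks (X Y a : 'M[C]_D) : X + Y = 1%:M ->
  a = X *m a *m Y + Y *m a *m X + (Y *m a *m Y + X *m a *m X).
Proof.
move=> XY; rewrite -{1}[a]mul1mx -{1}[_ *m a]mulmx1 -XY !mulmxDl !mulmxDr.
mxring.
Qed.

(** Without diagonal blocks the cost is r only, whereas a diagonal block costs n / k = r ^+ 2. The
    first-order term of the conjugation by the gain is of this cheap kind, so first and second order
    scale as z r and (z r) ^+ 2. *)
Lemma nb_conjT_off i a b : 0 <= b -> nb b a -> (2 * i <= k)%N ->
  P *m a *m P = 0 -> Q *m a *m Q = 0 -> nb (3 * b * r) (conjT i a).
Proof.
move=> b0 Hb ik H1 H2.
have E : a = Q *m a *m P + P *m a *m Q.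
  by rewrite [LHS](mx_blocks a (subrK P 1%:M)) H1 H2 !addr0.
have -> : 3 * b * r = 2 * b * r + b * r by ring.
rewrite E conjTD.
have n1 := nbP hP PP; have n2 := nbQ hP PP.
have nQP : nb b (Q *m a *m P).
  by rewrite -[b]mulr1 -[b * 1]mul1r mulrA; apply: nbM=> //; [rewrite mul1r|apply: nbM].
have nPQ : nb b (P *m a *m Q).
  by rewrite -[b]mulr1 -[b * 1]mul1r mulrA; apply: nbM=> //; [rewrite mul1r|apply: nbM].
apply: nbD.
  apply: nb_conjT_raise=> //; first by rewrite !mulmxA PQ // !mul0mx.
  by rewrite -mulmxA PP.
apply: nb_conjT_lower=> //; first by rewrite !mulmxA PP.
by rewrite -mulmxA QP // mulmx0.
Qed.

Lemma nb_conjT i a b : 0 <= b -> nb b a -> (2 * i <= k)%N ->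
  nb (5 * b * r ^+ 2) (conjT i a).
Proof.
move=> b0 Hb ik.
have E : a = (Q *m a *m P + P *m a *m Q) + (P *m a *m P + Q *m a *m Q).
  exact: mx_blocks (subrK P 1%:M).
have n1 := nbP hP PP; have n2 := nbQ hP PP.
have nn X Y : nb 1 X -> nb 1 Y -> nb b (X *m a *m Y).
  move=> h1 h2; rewrite -[b]mulr1 -[b * 1]mul1r mulrA.
  by apply: nbM=> //; [rewrite mul1r|apply: nbM].
have -> : 5 * b * r ^+ 2 = (2 * b * r ^+ 2 + b * r ^+ 2) + 2 * b * r ^+ 2 by ring.
have rl := ler_wpM2l b0 r_le.
rewrite E conjTD (conjTD _ (Q *m a *m P)); apply: nbD; first apply: nbD.
- apply: (@nb_ge _ _ _ (2 * b * r)); first by lra.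
  apply: nb_conjT_raise; [exact: b0|exact: nn|exact: ik| |].
    by rewrite !mulmxA PQ // !mul0mx.
  by rewrite -mulmxA PP.
- apply: (@nb_ge _ _ _ (b * r)) => //.
  apply: nb_conjT_lower; [exact: b0|exact: nn| |].
    by rewrite !mulmxA PP.
  by rewrite -mulmxA QP // mulmx0.
apply: nb_conjT_diag; first by rewrite mulr_ge0.
  by have -> : 2 * b = b + b by [ring]; apply: nbD; apply: nn.
have e1 : P *m (Q *m a *m Q) = 0 by rewrite !mulmxA PQ // !mul0mx.
have e2 : Q *m a *m Q *m P = 0 by rewrite -mulmxA QP // mulmx0.
move: e1 e2; move: (Q *m a *m Q) => Y e1 e2.
by rewrite mulmxDr mulmxDl e1 e2 !addr0 !mulmxA PP -(mulmxA _ P) PP.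
Qed.

End OneBody.

(** * Back-action on the moments of the count *)

Section Perturbation.
Variable R : realType.
Local Notation C := (R[i]).
Variable N : nat.
Implicit Types (B : nat -> 'M[C]_N) (x : R).

Fixpoint pprod B j : 'M[C]_N := if j is j'.+1 then pprod B j' *m (1%:M + B j') else 1%:M.

Lemma nb_pprod B p x : 0 <= x -> 2 * p%:R * x <= 1 -> (forall i, (i < p)%N -> nb x (B i)) ->
  forall j, (j <= p)%N -> nb (2 * j%:R * x) (pprod B j - 1%:M).
Proof.
move=> x0 px HB; elim=> [|j IH] jp /=; first by rewrite subrr mulr0 mul0r; exact: nb0.
have {}IH := IH (ltnW jp); have Hj := HB j jp.
have -> : pprod B j *m (1%:M + B j) - 1%:M = (pprod B j - 1%:M) *m B j + (pprod B j - 1%:M) + B j.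
  by rewrite mulmxDr mulmx1 mulmxBl mul1mx; mxring.
have jx : 2 * j%:R * x <= 1.
  by apply: le_trans px; rewrite ler_wpM2r // ler_wpM2l // ler_nat ltnW.
have j0 : 0 <= 2 * j%:R * x by rewrite !mulr_ge0.
apply: (nb_ge _ (nbD (nbD (nbM j0 IH Hj) IH) Hj)).
have -> : 2 * j.+1%:R * x = 2 * j%:R * x + 2 * x by rewrite -natr1; ring.
have := ler_wpM2r x0 jx; rewrite mul1r; lra.
Qed.

Lemma nb_pprod2 B p x : 0 <= x -> 2 * p%:R * x <= 1 -> (forall i, (i < p)%N -> nb x (B i)) ->
  forall j, (j <= p)%N -> nb (j%:R ^+ 2 * x ^+ 2) (pprod B j - 1%:M - \sum_(i < j) B i).
Proof.
move=> x0 px HB; elim=> [|j IH] jp /=.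
  by rewrite big_ord0 subr0 subrr expr0n mul0r; exact: nb0.
have {}IH := IH (ltnW jp); have Hj := HB j jp.
have H1 := nb_pprod x0 px HB (ltnW jp).
have j0 : 0 <= 2 * j%:R * x by rewrite !mulr_ge0.
rewrite big_ord_recr /=; set S := \sum_(i < j) _ in IH *.
have -> : pprod B j *m (1%:M + B j) - 1%:M - (S + B j) =
  (pprod B j - 1%:M - S) + (pprod B j - 1%:M) *m B j.
  by rewrite mulmxDr mulmx1 mulmxBl mul1mx; mxring.
apply: (nb_ge _ (nbD IH (nbM j0 H1 Hj))).
have -> : j.+1%:R ^+ 2 * x ^+ 2 = j%:R ^+ 2 * x ^+ 2 + 2 * j%:R * x * x + x ^+ 2.
  by rewrite -natr1; ring.
by rewrite lerDl sqr_ge0.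
Qed.

Lemma nb_sum p (B : 'I_p -> 'M[C]_N) x : (forall i, nb x (B i)) -> nb (p%:R * x) (\sum_i B i).
Proof.
move=> H; elim: p B H => [|p IH] B H; first by rewrite big_ord0 mul0r; exact: nb0.
rewrite big_ord_recr /= -natr1 mulrDl mul1r; apply: nbD=> //.
by apply: IH => i.
Qed.

(* Polarization: since the first-order terms of the two products almost cancel in the sum, the error is quadratic in p x. *)
Lemma rd_pprod_ge B B' p x x2 (t : 'cV[C]_N) : 0 <= x -> 0 <= x2 ->
  2 * p%:R * x <= 1 -> p%:R * x2 + 2 * (p%:R * x) ^+ 2 <= 2 ->
  (forall i, (i < p)%N -> nb x (B i)) -> (forall i, (i < p)%N -> nb x (B' i)) ->
  (forall i, (i < p)%N -> nb x2 (B i + B' i)) ->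
  (1 - (p%:R * x2 + 6 * (p%:R * x) ^+ 2)) * rd t t <= rd (pprod B' p *m t) (pprod B p *m t).
Proof.
move=> x0 x20 px px2 HB HB' HBB.
set X := pprod B p *m t; set Y := pprod B' p *m t.
have pol : 4 * rd Y X = nr (X + Y) ^+ 2 - nr (X - Y) ^+ 2.
  rewrite !nr2 !rdDl !rdDr !rdNl !rdNr (rdC X Y).
  move: (rd _ _) (rd _ _) (rd _ _) => *; ring.
pose e := p%:R * x2 + 2 * (p%:R * x) ^+ 2.
have sumXY : nr (X + Y) >= (2 - e) * nr t.
  have H : nb e (pprod B p + pprod B' p - 2 *r 1%:M).
    have -> : pprod B p + pprod B' p - 2 *r 1%:M =
      \sum_(i < p) (B i + B' i) + ((pprod B p - 1%:M - \sum_(i < p) B i)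
        + (pprod B' p - 1%:M - \sum_(i < p) B' i)).
      by rewrite big_split /= rmorphD !rmorph1; mxring.
    have s1 : nb (p%:R * x2) (\sum_(i < p) (B i + B' i)).
      by apply: nb_sum => i; exact: HBB.
    apply: (nb_ge _ (nbD s1 (nbD (nb_pprod2 x0 px HB (leqnn p)) (nb_pprod2 x0 px HB' (leqnn p))))).
    by rewrite /e exprMn; lra.
  have E : X + Y = 2 *r t + (pprod B p + pprod B' p - 2 *r 1%:M) *m t.
    by rewrite mulmxBl mulmxDl -scalemxAl mul1mx [RHS]addrC subrK.
  rewrite E; apply: le_trans (nrB_ge _ _).
  rewrite nrZ ger0_norm // mulrBl lerB //.
have difXY : nr (X - Y) <= 4 * (p%:R * x) * nr t.
  have -> : X - Y = ((pprod B p - 1%:M) - (pprod B' p - 1%:M)) *m t.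
    by rewrite /X /Y -mulmxBl; congr (_ *m _); mxring.
  have := nbB (nb_pprod x0 px HB (leqnn p)) (nb_pprod x0 px HB' (leqnn p)).
  by move=> /(_ t)/le_trans; apply; rewrite ler_wpM2r ?nr_ge0 //; lra.
have t0 := nr_ge0 t.
have h1 : ((2 - e) * nr t) ^+ 2 <= nr (X + Y) ^+ 2.
  by rewrite ler_pXn2r // nnegrE ?nr_ge0 // mulr_ge0 // subr_ge0.
have h2 : nr (X - Y) ^+ 2 <= (4 * (p%:R * x) * nr t) ^+ 2.
  by rewrite ler_pXn2r // nnegrE ?nr_ge0 // !mulr_ge0.
have t2 : 0 <= nr t ^+ 2 by rewrite sqr_ge0.
have e2 : 0 <= e ^+ 2 * nr t ^+ 2 by rewrite mulr_ge0 // sqr_ge0.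
rewrite -nr2; move: pol h1 h2 e2; rewrite !(exprMn 2 _ (nr t)) /e; clear.
move: (nr t ^+ 2) (nr (X + Y) ^+ 2) (nr (X - Y) ^+ 2) (rd Y X) (p%:R * x2) (p%:R * x).
move=> T a b r q z; nra.
Qed.

End Perturbation.

(** * Conjugating the moments by the gain operator *)

Section Core.
Variable R : realType.
Local Notation C := (R[i]).
Local Notation herm := (@Defs.hermitian R _).
Variable D : nat.
Variable P : 'M[C]_D.
Hypothesis hP : herm P.
Hypothesis PP : P *m P = P.
Local Notation Q := (1%:M - P).
Variables (k n : nat).
Hypothesis k0 : (0 < k)%N.
Implicit Types g gi : 'M[C]_D.

Lemma lv_ff1 : lv P (ff R k 1) n = k%:R *r 1%:M + sm Q n.
Proof.
rewrite -lv_id // -(lv_cst P) lvD; apply: eq_lv => w.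
by rewrite /ff expr1 natrD.
Qed.

Lemma lv_ffS i : lv P (ff R k i) n *m lv P (ff R k 1) n = lv P (ff R k i.+1) n.
Proof. by rewrite lvM //; apply: eq_lv => w; rewrite /ff expr1 exprSr. Qed.

(** Conjugation distributes over the p factors k + W. As W is one-body and G a product operator,
    each conjugated factor is again k + W plus a one-body term. *)
Lemma conj_pprod g gi p : g *m gi = 1%:M -> gi *m g = 1%:M ->
  tpow gi n *m lv P (ff R k p) n *m tpow g n =
  pprod (fun i => conjT P k n i (gi *m Q *m g - Q)) p *m lv P (ff R k p) n.
Proof.
move=> ggi gig.
have GGi : tpow g n *m tpow gi n = 1%:M by rewrite -tpowM ggi tpow1.
have GiG : tpow gi n *m tpow g n = 1%:M by rewrite -tpowM gig tpow1.
elim: p => [|p IH].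
  have -> : lv P (ff R k 0) n = 1%:M.
    by rewrite -(eq_lv P (f := fun=> 1)) // lv_cst rmorph1 scale1r.
  by rewrite /= !mulmx1.
have -> : tpow gi n *m lv P (ff R k p.+1) n *m tpow g n =
  (tpow gi n *m lv P (ff R k p) n *m tpow g n) *m (tpow gi n *m lv P (ff R k 1) n *m tpow g n).
  by rewrite -lv_ffS !mulmxA -(mulmxA _ (tpow g n)) GGi mulmx1.
rewrite IH /= -[LHS]mulmxA -[RHS]mulmxA; congr (_ *m _).
have -> : tpow gi n *m lv P (ff R k 1) n *m tpow g n =
   lv P (ff R k 1) n + sm (gi *m Q *m g - Q) n.
  have E : tpow gi n *m (sm Q n *m tpow g n) = sm (gi *m Q *m g) n.
    rewrite mulmxA (tpow_sm (b := gi *m Q *m g)); last by rewrite -!mulmxA ggi mulmx1.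
    by rewrite -mulmxA GiG mulmx1.
  rewrite (smB (gi *m Q *m g) Q) -E lv_ff1; rewrite -mulmxA; move: (sm Q n) => S.
  by rewrite !mulmxDl mulmxDr -!scalemxAl mul1mx -scalemxAr GiG; mxring.
move: (gi *m Q *m g - Q) => a.
rewrite mulmxDr mulmxDl mul1mx lv_ffS; congr (_ + _).
have e : lv P (fun w => (ff R k p.+1 w)^-1) n *m lv P (ff R k p.+1) n = 1%:M.
  rewrite lvM // -[RHS]scale1r -(rmorph1 (real_complex R)) -(lv_cst P).
  by apply: eq_lv => w; rewrite mulVf // gt_eqF // ff_gt0.
by rewrite /conjT -[RHS]mulmxA e mulmx1.
Qed.

Variables (z r : R) (h : 'M[C]_D) (gi : 'M[C]_D).
Hypothesis kn : (k <= n)%N.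
Hypothesis z0 : 0 <= z.
Hypothesis z4 : z <= 1 / 4.
Hypothesis hh : herm h.
Hypothesis nh : nb z h.
Local Notation g := (1%:M + h).
Hypothesis ggi : g *m gi = 1%:M.
Hypothesis gig : gi *m g = 1%:M.
Hypothesis hgi : herm gi.
Hypothesis r0 : 0 <= r.
Hypothesis r2 : r ^+ 2 = n%:R / k%:R.

Lemma nb_gi : nb (4 / 3) gi.
Proof.
move=> v; have : nr v >= (1 - z) * nr (gi *m v).
  have E : v = gi *m v + h *m (gi *m v) by rewrite -{1}[gi *m v]mul1mx -mulmxDl mulmxA ggi mul1mx.
  rewrite [X in _ <= nr X]E mulrBl mul1r.
  by apply: le_trans (nrB_ge _ _); rewrite lerB.
have := ler_wpM2r (nr_ge0 (gi *m v)) z4; rewrite mulrBl mul1r; lra.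
Qed.

Lemma gi_sub1 : gi - 1%:M = - (gi *m h).
Proof. by rewrite -gig mulmxDr mulmx1 opprD addNKr. Qed.

Lemma gi_sub1' : gi - 1%:M = - (h *m gi).
Proof. by rewrite -ggi mulmxDl mul1mx opprD addNKr. Qed.

(** The common first-order part of the two conjugations of Q, up to sign ([conj_gi], [conj_g]).
    Being a commutator with a projection, it has no diagonal blocks. *)
Let o := Q *m h - h *m Q.

Lemma nb_o : nb (2 * z) o.
Proof.
have nq := nbQ hP PP; have -> : 2 * z = 1 * z + z * 1 by ring.
by apply: nbB; apply: nbM.
Qed.

Lemma off_o : P *m o *m P = 0 /\ Q *m o *m Q = 0.
Proof.
have h1 := QQ PP; have h2 := QP PP; have h3 := PQ PP.
rewrite /o; move: h1 h2 h3; move: Q => q h1 h2 h3; split.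
  by rewrite mulmxBr mulmxBl !mulmxA h3 -!mulmxA h2 !(mul0mx, mulmx0) subrr.
by rewrite mulmxBr mulmxBl !mulmxA h1 -!mulmxA h1 subrr.
Qed.

Lemma conj_gi : gi *m Q *m g - Q = o - gi *m h *m o.
Proof.
have E : gi *m Q *m g - Q = gi *m o.
  rewrite /o; move: Q => q.
  have E1 : q = gi *m q + gi *m h *m q by rewrite -mulmxDl -{1}[gi]mulmx1 -mulmxDr gig mul1mx.
  by rewrite mulmxDr mulmx1 mulmxBr !mulmxA [X in _ - X = _]E1; mxring.
by rewrite E -{1}[gi](subrK 1%:M) gi_sub1 mulmxDl mul1mx mulNmx addrC.
Qed.

Lemma conj_g : g *m Q *m gi - Q = - o + o *m h *m gi.
Proof.
have E : g *m Q *m gi - Q = - (o *m gi).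
  rewrite /o; move: Q => q.
  have E1 : q = q *m gi + q *m h *m gi.
    by rewrite -mulmxA -mulmxDr -{1}[gi]mul1mx -mulmxDl ggi mulmx1.
  by rewrite !mulmxDl mul1mx mulNmx [X in _ - X = _]E1; mxring.
by rewrite E -{1}[gi](subrK 1%:M) gi_sub1' mulmxDr mulmx1 mulmxN !mulmxA; mxring.
Qed.

Lemma nb_e : nb (3 * z ^+ 2) (gi *m h *m o) /\ nb (3 * z ^+ 2) (o *m h *m gi).
Proof.
have c0 : (0 : R) <= 4 / 3 by lra.
have zz : 0 <= 2 * z by rewrite mulr_ge0.
have z2 : 0 <= z ^+ 2 by rewrite sqr_ge0.
split.
  apply: (nb_ge _ (nbM _ (nbM c0 nb_gi nh) nb_o)); first by lra.
  by rewrite mulr_ge0.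
apply: (nb_ge _ (nbM _ (nbM zz nb_o nh) nb_gi)); first by lra.
by rewrite mulr_ge0.
Qed.

Local Notation y := (z * r).
Hypothesis y1 : y <= 1.
Let a := gi *m Q *m g - Q.
Let a' := g *m Q *m gi - Q.

Lemma nb_conj_a i : (2 * i <= k)%N -> nb (21 * y) (conjT P k n i a) /\ nb (21 * y) (conjT P k n i a').
Proof.
move=> ik; have [o1 o2] := off_o; have [e1 e2] := nb_e.
have zz : 0 <= 2 * z by rewrite mulr_ge0.
have z3 : 0 <= 3 * z ^+ 2 by rewrite mulr_ge0 ?sqr_ge0.
have n1 := nb_conjT_off hP PP k0 r0 r2 zz nb_o ik o1 o2.
have n1' : nb (3 * (2 * z) * r) (conjT P k n i (- o)).
  apply: nb_conjT_off => //; first by apply: nbN; exact: nb_o.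
    by rewrite mulmxN mulNmx o1 oppr0.
  by rewrite mulmxN mulNmx o2 oppr0.
have n2 := nb_conjT hP PP k0 kn r0 r2 z3 (nbN e1) ik.
have n2' := nb_conjT hP PP k0 kn r0 r2 z3 e2 ik.
have y0 : 0 <= y by rewrite mulr_ge0.
have le21 : 3 * (2 * z) * r + 5 * (3 * z ^+ 2) * r ^+ 2 <= 21 * y.
  have -> : 3 * (2 * z) * r + 5 * (3 * z ^+ 2) * r ^+ 2 = 6 * y + 15 * (y * y) by ring.
  have := ler_wpM2l y0 y1; rewrite mulr1; lra.
split; apply: (nb_ge le21).
  rewrite /a conj_gi conjTD; exact: (nbD n1 n2).
rewrite /a' conj_g conjTD; exact: (nbD n1' n2').
Qed.

(** The first-order parts o and -o cancel; the two remainders, 3 z ^+ 2 each, go through the general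
    bound 5 b r ^+ 2. *)
Lemma nb_conj_aa i : (2 * i <= k)%N ->
  nb (30 * y ^+ 2) (conjT P k n i a + conjT P k n i a').
Proof.
move=> ik; have [e1 e2] := nb_e.
rewrite -conjTD /a /a' conj_gi conj_g.
have -> : o - gi *m h *m o + (- o + o *m h *m gi) = - (gi *m h *m o) + o *m h *m gi by mxring.
have z6 : 0 <= 3 * z ^+ 2 + 3 * z ^+ 2 by rewrite -mulrDl mulr_ge0 ?sqr_ge0 // addr_ge0.
have := nb_conjT hP PP k0 kn r0 r2 z6 (nbD (nbN e1) e2) ik.
by apply: nb_ge; rewrite exprMn; lra.
Qed.

Lemma natr_mul_sq p x : p%:R * x ^+ 2 <= (p%:R * x) ^+ 2 :> R.
Proof.
rewrite [leRHS]exprMn ler_wpM2r ?sqr_ge0 // -natrX ler_nat.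
by case: p => // p; rewrite expnS expn1 leq_pmulr.
Qed.

Lemma core_ineq p (w : 'cV[C]_(pw D n)) :
  (2 * p <= k)%N -> 42 * (p%:R * y) <= 1 ->
  (1 - 2676 * (p%:R * y) ^+ 2) * rd w (lv P (ff R k (2 * p)) n *m w)
  <= rd (tpow gi n *m w) (lv P (ff R k (2 * p)) n *m (tpow g n *m w)).
Proof.
move=> pk py.
have hg : herm g by apply: hermitianD=> //; exact: hermitian1.
have GGi : tpow g n *m tpow gi n = 1%:M by rewrite -tpowM ggi tpow1.
have GiG : tpow gi n *m tpow g n = 1%:M by rewrite -tpowM gig tpow1.
have FF : lv P (ff R k (2 * p)) n = lv P (ff R k p) n *m lv P (ff R k p) n.
  by rewrite lvM //; apply: eq_lv => u; rewrite /ff mul2n -addnn exprD.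
have aGi : adj (tpow gi n) = tpow gi n by rewrite adj_tpow hgi.
have aG : adj (tpow g n) = tpow g n by rewrite adj_tpow hg.
(* F_(2p) is split into two halves F_p and the product of G and its inverse is inserted between
   them: one half is conjugated by G, the other by its inverse, as [rd_pprod_ge] expects. *)
have -> : rd (tpow gi n *m w) (lv P (ff R k (2 * p)) n *m (tpow g n *m w)) =
  rd (pprod (fun i => conjT P k n i a') p *m (lv P (ff R k p) n *m w))
     (pprod (fun i => conjT P k n i a) p *m (lv P (ff R k p) n *m w)).
  rewrite (mulmxA (pprod _ p)) -(conj_pprod p gig ggi).
  rewrite (mulmxA (pprod _ p)) -(conj_pprod p ggi gig) FF.
  move: (lv P (ff R k p) n) (adj_lv hP (ff R k p) n) GGi aG.
  move: (tpow g n) (tpow gi n) => G Gi T aT GGi aG.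
  rewrite -!mulmxA [in RHS]rd_adjl aG (mulmxA G Gi) GGi mul1mx.
  by rewrite [in RHS]rd_adjl aT.
have -> : rd w (lv P (ff R k (2 * p)) n *m w) = rd (lv P (ff R k p) n *m w) (lv P (ff R k p) n *m w).
  by rewrite rd_adjl adj_lv // FF mulmxA.
have y0 : 0 <= y by rewrite mulr_ge0.
have p0 : (0 : R) <= p%:R by rewrite ler0n.
have py0 : 0 <= p%:R * y by rewrite mulr_ge0.
set t := _ *m w.
have ip i : (i < p)%N -> (2 * i <= k)%N.
  by move=> lt; apply: leq_trans pk; rewrite leq_mul2l ltnW.
have H := @rd_pprod_ge R _ (fun i => conjT P k n i a) (fun i => conjT P k n i a') p (21 * y) (30 * y ^+ 2) t.
apply: le_trans (H _ _ _ _ _ _ _).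
(* 2676 = 30 + 6 * 21 ^ 2, from the bounds 30 y ^+ 2 and 21 y on the factors. *)
- rewrite ler_wpM2r ?rd_ge0 //.
  have : p%:R * y ^+ 2 <= (p%:R * y) ^+ 2.
    exact: natr_mul_sq.
  move: (y ^+ 2) => Y hY.
  have -> : p%:R * (21 * y) = 21 * (p%:R * y) by ring.
  have -> : p%:R * (30 * Y) = 30 * (p%:R * Y) by ring.
  have -> : (21 * (p%:R * y)) ^+ 2 = 441 * (p%:R * y) ^+ 2 by ring.
  rewrite lerD2l lerN2; move: hY.
  move: (p%:R * Y) ((p%:R * y) ^+ 2) => X Z hY; lra.
- by rewrite mulr_ge0.
- by rewrite mulr_ge0 ?sqr_ge0.
- by have -> : 2 * p%:R * (21 * y) = 42 * (p%:R * y) by ring.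
- have : p%:R * y ^+ 2 <= (p%:R * y) ^+ 2.
    exact: natr_mul_sq.
  have -> : p%:R * (21 * y) = 21 * (p%:R * y) by ring.
  have u2 : 42 * (p%:R * y) ^+ 2 <= p%:R * y by rewrite expr2 mulrA ler_piMl.
  have -> : p%:R * (30 * y ^+ 2) = 30 * (p%:R * y ^+ 2) by ring.
  have -> : (21 * (p%:R * y)) ^+ 2 = 441 * (p%:R * y) ^+ 2 by ring.
  move=> hY; move: hY u2 py.
  move: (p%:R * y ^+ 2) ((p%:R * y) ^+ 2) (p%:R * y) => X Z u *; lra.
- by move=> i lt; have [] := nb_conj_a (ip _ lt).
- by move=> i lt; have [] := nb_conj_a (ip _ lt).
- by move=> i lt; apply: nb_conj_aa; exact: ip.
Qed.

End Core.

(** * The threshold instrument *)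

Section Measurement.
Variable R : realType.
Local Notation C := (R[i]).
Local Notation herm := (@Defs.hermitian R _).
Variable N : nat.
Variable G : 'M[C]_N.
Hypothesis hG : herm G.

Definition resolvent : 'M[C]_N := invmx (1%:M + G *m G).
Local Notation Z := resolvent.

Lemma resolvent_unit : 1%:M + G *m G \in unitmx.
Proof.
rewrite -unitmx_tr unitmxE unitfE; apply/negP => /det0P [v vn0].
move/(congr1 trmx); rewrite trmx_mul trmxK trmx0 => H.
have : rd v^T ((1%:M + G *m G) *m v^T) = 0 by rewrite H rd0r.
rewrite mulmxDl mul1mx rdDr -mulmxA rd_adjr hG => /eqP.
rewrite paddr_eq0 ?rd_ge0 // => /andP[/eqP/rd_eq0 E _].
by move: vn0; rewrite -[v]trmxK E trmx0 eqxx.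
Qed.

Lemma resolventK : Z *m (1%:M + G *m G) = 1%:M.
Proof. exact: mulVmx resolvent_unit. Qed.

Lemma resolventKr : (1%:M + G *m G) *m Z = 1%:M.
Proof. exact: mulmxV resolvent_unit. Qed.

Lemma resolvent_herm : herm Z.
Proof.
have H : adj Z *m (1%:M + G *m G) = 1%:M.
  have <- : adj (1%:M + G *m G) = 1%:M + G *m G by rewrite adjD adj1 adjM hG.
  by rewrite -adjM resolventKr adj1.
by rewrite /Defs.hermitian -[adj Z]mulmx1 -resolventKr mulmxA H mul1mx.
Qed.

Lemma resolvent_split : Z + G *m G *m Z = 1%:M.
Proof. by rewrite -{1}[Z]mul1mx -mulmxDl resolventKr. Qed.

(* true ("Yes") has weight G^2 Z and false ("No") weight Z; each outcome is split into two
   Kraus operators so that the average back-action is -Z [G, [G, F]] Z exactly. *)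
Definition threshold_ins (o : bool) : seq 'M[C]_N :=
  if o then [:: G *m Z; G *m G *m Z] else [:: Z; G *m Z].

Lemma threshold_ins_ok : instrument_ok threshold_ins.
Proof.
rewrite /instrument_ok big_bool /= !big_cons !big_nil !addr0 !adjM hG resolvent_herm.
have E : (Z + Z *m (G *m G)) *m (Z + G *m G *m Z) = 1%:M.
  by rewrite resolvent_split -{1}[Z]mulmx1 -mulmxDr resolventK mulmx1.
by rewrite -[RHS]E mulmxDl !mulmxDr !mulmxA addrC.
Qed.

Definition out_form (F : 'M[C]_N) (o : bool) (v : 'cV[C]_N) : R :=
  \sum_(K <- threshold_ins o) rd (K *m v) (F *m (K *m v)).

Definition out_prob (o : bool) (v : 'cV[C]_N) : R :=
  \sum_(K <- threshold_ins o) rd (K *m v) (K *m v).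

Lemma rd_kraus (s : seq 'M[C]_N) v :
  rd v ((\sum_(K <- s) adj K *m K) *m v) = \sum_(K <- s) rd (K *m v) (K *m v).
Proof.
elim: s => [|K s IH]; first by rewrite !big_nil mul0mx rd0r.
by rewrite !big_cons mulmxDl rdDr IH -mulmxA rd_adjr adjK.
Qed.

Lemma out_probE v : out_prob true v + out_prob false v = rd v v.
Proof.
have := congr1 (fun X => rd v (X *m v)) threshold_ins_ok.
rewrite /= mul1mx => <-; rewrite big_bool mulmxDl rdDr.
by congr (_ + _); rewrite rd_kraus.
Qed.

Lemma nb_out o K : K \in threshold_ins o -> nb 1 K.
Proof.
move=> Ko; apply: nb_sq => // v; rewrite expr1n mul1r -(out_probE v).
have nn o' : 0 <= out_prob o' v by apply: sumr_ge0 => i _; exact: rd_ge0.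
have H : rd (K *m v) (K *m v) <= out_prob o v.
  rewrite /out_prob (big_rem K) //= lerDl; apply: sumr_ge0 => i _; exact: rd_ge0.
apply: (le_trans H); have := nn true; have := nn false; case: (o); lra.
Qed.

(** With z = Z v one has v = z + G^2 z. The total over both outcomes exceeds [rd v (F *m v)] by 2 rd
    (G z) (F G z) - 2 rd z (F G^2 z), and the hypothesis at w = G z bounds this by c rd (G z) (F G
    z), one of the two terms of the No part. *)
Lemma out_supermartingale F gi' c : herm F -> (forall v, 0 <= rd v (F *m v)) -> gi' *m G = 1%:M ->
  0 <= c ->
  (forall w, (1 - c / 2) * rd w (F *m w) <= rd (gi' *m w) (F *m (G *m w))) ->
  forall v, out_form F true v + (1 - c) * out_form F false v <= rd v (F *m v).
Proof.
move=> hF F0 GG c0 H v; rewrite /out_form /threshold_ins big_cons big_seq1 big_cons big_seq1.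
have Ev : v = Z *m v + G *m (G *m (Z *m v)).
  by rewrite !mulmxA -mulmxDl resolvent_split mul1mx.
have := H (G *m (Z *m v)); rewrite (mulmxA gi') GG mul1mx.
have := F0 (Z *m v).
have -> : rd v (F *m v) = rd (Z *m v + G *m (G *m (Z *m v))) (F *m (Z *m v + G *m (G *m (Z *m v)))).
  by rewrite -Ev.
rewrite -!(mulmxA G).
move: (Z *m v) => z.
have sy x y : rd x (F *m y) = rd y (F *m x) by rewrite rdC rd_adjl hF.
rewrite mulmxDr rdDl !rdDr (sy (G *m (G *m z)) z).
move: (rd z (F *m z)) (rd z _) (rd (G *m z) _) (rd _ _) => a b d e a0.
have := mulr_ge0 c0 a0; lra.
Qed.

End Measurement.

(** * Wrong answers are exponentially unlikely while W is small *)

Section Errors.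
Variable R : realType.
Local Notation C := (R[i]).
Local Notation herm := (@Defs.hermitian R _).
Variables (D : nat) (P : 'M[C]_D).
Hypothesis hP : herm P.
Hypothesis PP : P *m P = P.
Local Notation Q := (1%:M - P).
Variables (k n p : nat).
Hypothesis k0 : (0 < k)%N.
Variable s : R.
Hypothesis s0 : 0 < s.
Hypothesis s1 : s <= 1.

Definition lowT : 'M[C]_(pw D n) := tpow (P + s *r Q) n.
Local Notation F := (lv P (ff R k (2 * p)) n).

(** Levels W >= k are paid by the first term, as there k + W >= 2 k; levels W < k by the second, as
    there the damping s^W is no smaller than s^k. *)
Lemma level_split (u : 'cV[C]_(pw D n)) :
  rd u u <= ((2 * k)%:R ^+ (2 * p))^-1 * rd u (F *m u)
            + (s ^+ (2 * k))^-1 * rd (lowT *m u) (lowT *m u).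
Proof.
rewrite /lowT -lv_exp rd_adjl adj_lv // mulmxA lvM // -!rdZr !scalemxAl !lvZ.
rewrite -rdDr -mulmxDl lvD -{2}[u]mul1mx -[1%:M]scale1r -(rmorph1 (real_complex R)) -(lv_cst P).
apply: rd_lv_le => // w; rewrite /ff.
have pos2 : 0 < (2 * k)%:R ^+ (2 * p) :> R by rewrite exprn_gt0 // ltr0n muln_gt0.
have sk : 0 < s ^+ (2 * k) by rewrite exprn_gt0.
have t1 : 0 <= (s ^+ (2 * k))^-1 * (s ^+ w * s ^+ w).
  by rewrite mulr_ge0 ?invr_ge0 ?mulr_ge0 ?exprn_ge0 // ltW.
have t2 : 0 <= ((2 * k)%:R ^+ (2 * p))^-1 * (k + w)%:R ^+ (2 * p) :> R.
  by rewrite mulr_ge0 ?invr_ge0 ?exprn_ge0 ?ler0n // ltW.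
have [kw|wk] := leqP k w.
  suff : 1 <= ((2 * k)%:R ^+ (2 * p))^-1 * (k + w)%:R ^+ (2 * p) :> R by lra.
  rewrite mulrC ler_pdivlMr // mul1r lerXn2r ?nnegrE ?ler0n // ler_nat mul2n -addnn.
  by rewrite leq_add2l.
suff : 1 <= (s ^+ (2 * k))^-1 * (s ^+ w * s ^+ w) by lra.
rewrite mulrC ler_pdivlMr // mul1r -exprD addnn -mul2n.
by apply: ler_wiXn2l => //; [exact: ltW|rewrite leq_mul2l ltnW].
Qed.

Variables (g gi : 'M[C]_D).
Hypothesis hg : herm g.
Hypothesis ggi : g *m gi = 1%:M.
Local Notation G := (tpow g n).
Local Notation Gi := (tpow gi n).

Lemma lin2 (c d B x1 x2 y1 y2 : R) : x1 <= c * y1 + d * B -> x2 <= c * y2 + d * B ->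
  x1 + x2 <= c * (y1 + y2) + d * (2 * B).
Proof. by move=> h1 h2; have := lerD h1 h2; rewrite !mulrDr mulrDl; lra. Qed.

(** Kraus operators of opposite outcomes differ by a factor G. A wrong Yes thus contains G, a wrong
    No its inverse, times a contraction from the other outcome; [b] bounds that factor once it is
    damped by [lowT]. *)
Lemma error_bound o (L : 'M[C]_(pw D n)) b : 0 <= b -> nb b L ->
  (forall K, K \in threshold_ins G o ->
     exists2 K', K' \in threshold_ins G (~~ o) & lowT *m K = L *m K') ->
  forall v, out_prob G o v <= ((2 * k)%:R ^+ (2 * p))^-1 * out_form G F o v
    + (s ^+ (2 * k))^-1 * (2 * (b ^+ 2 * rd v v)).
Proof.
move=> b0 Hb H v.
have hG : herm G by rewrite /Defs.hermitian adj_tpow hg.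
have sk : 0 <= (s ^+ (2 * k))^-1 by rewrite invr_ge0 exprn_ge0 // ltW.
have one K : K \in threshold_ins G o -> rd (K *m v) (K *m v) <=
   ((2 * k)%:R ^+ (2 * p))^-1 * rd (K *m v) (F *m (K *m v)) + (s ^+ (2 * k))^-1 * (b ^+ 2 * rd v v).
  move=> Ko; apply: (le_trans (level_split _)); rewrite lerD2l ler_wpM2l //.
  have [K' K'o E] := H K Ko; rewrite mulmxA E -mulmxA.
  have b1 : nb (b * 1) (L *m K') by apply: nbM => //; apply: nb_out K'o.
  by have := nb_rd v (mulr_ge0 b0 ler01) b1; rewrite mulr1 -mulmxA.
rewrite /out_prob /out_form; case: o H one => H one; rewrite /threshold_ins !(big_seq1, big_cons).
  by apply: lin2; apply: one; rewrite !inE eqxx ?orbT.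
by apply: lin2; apply: one; rewrite !inE eqxx ?orbT.
Qed.

Lemma error_no b : 0 <= b -> nb b (lowT *m Gi) -> forall v,
  out_prob G false v <= ((2 * k)%:R ^+ (2 * p))^-1 * out_form G F false v
    + (s ^+ (2 * k))^-1 * (2 * (b ^+ 2 * rd v v)).
Proof.
move=> b0 Hb; apply: (error_bound b0 Hb) => K; rewrite !inE.
have gig : gi *m g = 1%:M by apply: mulmx1C.
have E X : lowT *m X = lowT *m Gi *m (G *m X).
  by rewrite -mulmxA [Gi *m _]mulmxA -tpowM gig tpow1 mul1mx.
case/orP => /eqP -> {K}; rewrite E.
  by exists (G *m resolvent G); rewrite ?inE ?eqxx.
by exists (G *m G *m resolvent G); rewrite ?inE ?eqxx ?orbT // !mulmxA.
Qed.

Lemma error_yes b : 0 <= b -> nb b (lowT *m G) -> forall v,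
  out_prob G true v <= ((2 * k)%:R ^+ (2 * p))^-1 * out_form G F true v
    + (s ^+ (2 * k))^-1 * (2 * (b ^+ 2 * rd v v)).
Proof.
move=> b0 Hb; apply: (error_bound b0 Hb) => K; rewrite !inE.
case/orP => /eqP -> {K}.
  by exists (resolvent G); rewrite ?inE ?eqxx // mulmxA.
by exists (G *m resolvent G); rewrite ?inE ?eqxx ?orbT // !mulmxA.
Qed.

(** Monotonicity of tensor powers reduces the bound on n copies to an operator inequality on a
    single copy. *)
Lemma nb_tpow a (x : 'M[C]_D) : 0 <= a -> pos (a *r 1%:M - adj x *m x) ->
  nb (Num.sqrt a ^+ n) (tpow x n).
Proof.
move=> a0 H; apply: nb_sq => [|v]; first by rewrite exprn_ge0 ?sqrtr_ge0.
have := pos_rd v (tpow_mono n (pos_sq x) H).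
rewrite tpowZ tpow1 tpowM -adj_tpow mulmxBl rdBr -scalemxAl mul1mx rdZr -mulmxA.
by rewrite -(rd_adjl (tpow x n)) subr_ge0 -exprM mulnC exprM sqr_sqrtr.
Qed.

Lemma nb_lowT_no a : 0 <= a -> herm gi ->
  pos (a *r (g *m g) - (P + (s ^+ 2) *r Q)) ->
  nb (Num.sqrt a ^+ n) (lowT *m Gi).
Proof.
move=> a0 hgi H; rewrite /lowT -tpowM; apply: nb_tpow => //.
have := pos_congr gi H; rewrite hgi.
have gig : gi *m g = 1%:M by apply: mulmx1C.
have -> : gi *m (a *r (g *m g) - (P + s ^+ 2 *r Q)) *m gi =
   a *r 1%:M - gi *m (P + s ^+ 2 *r Q) *m gi.
  rewrite mulmxBr mulmxBl -scalemxAr -scalemxAl; congr (_ *: _ - _).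
  by rewrite !mulmxA gig mul1mx ggi.
have -> : adj ((P + s *r Q) *m gi) *m ((P + s *r Q) *m gi) = gi *m (P + s ^+ 2 *r Q) *m gi.
  have hy : adj (P + s *r Q) = P + s *r Q by rewrite adjD adjZ hP (hQ hP).
  have sq : (P + s *r Q) *m (P + s *r Q) = P + s ^+ 2 *r Q.
    have h1 := QQ PP; have h2 := QP PP; have h3 := PQ PP.
    move: (Q) h1 h2 h3 => q h1 h2 h3.
    rewrite mulmxDl !mulmxDr -!scalemxAl -!scalemxAr PP h1 h2 h3 !scaler0 addr0 add0r.
    by rewrite scalerA -rmorphM -expr2.
  rewrite adjM hgi hy -sq; move: (P + s *r Q) => Y.
  by rewrite !mulmxA.
by [].
Qed.

Lemma nb_lowT_yes a : 0 <= a ->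
  pos (a *r (P + (s ^+ 2)^-1 *r Q) - g *m g) ->
  nb (Num.sqrt a ^+ n) (lowT *m G).
Proof.
move=> a0 H; rewrite /lowT -tpowM -[_ *m g]adjK -adj_tpow.
apply: nb_adj; first by rewrite exprn_ge0 ?sqrtr_ge0.
apply: nb_tpow => //; rewrite adjK.
have h1 := QQ PP; have h2 := QP PP; have h3 := PQ PP; have h4 := hQ hP.
have h5 : P + Q = 1%:M by rewrite addrC subrK.
move: (Q) h1 h2 h3 h4 h5 H => q h1 h2 h3 h4 h5 H.
have hy : herm (P + s *r q) by rewrite /Defs.hermitian adjD adjZ hP h4.
have := pos_congr (P + s *r q) H; rewrite hy mulmxBr mulmxBl.
have -> : (P + s *r q) *m (a *r (P + s ^- 2 *r q)) *m (P + s *r q) = a *r 1%:M.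
  rewrite -scalemxAr -scalemxAl; congr (_ *: _).
  have e x y : (P + x *r q) *m (P + y *r q) = P + (x * y) *r q.
    rewrite mulmxDl !mulmxDr -!scalemxAl -!scalemxAr PP h1 h2 h3 !scaler0 addr0 add0r.
    by rewrite scalerA -rmorphM.
  rewrite !e mulrAC -expr2 mulfV ?rmorph1 ?scale1r //.
  by rewrite expf_neq0 // gt_eqF.
by rewrite adjM hg hy !mulmxA.
Qed.

End Errors.

(** * Gain operators on one copy *)

Section RealBounds.
Variable R : realType.
Implicit Types eta e u A B X Y S x y : R.

Lemma amgm eta e A B : 0 < eta -> 0 < e ->
  4 * eta * (A * B) <= eta * e / 2 * A ^+ 2 + 8 * (eta / e) * B ^+ 2.
Proof.
move=> eta0 e0; have := sqr_ge0 (e * A - 4 * B).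
have -> : (e * A - 4 * B) ^+ 2 = (2 * e / eta) * (eta * e / 2 * A ^+ 2 + 8 * (eta / e) * B ^+ 2 - 4 * eta * (A * B)).
  by field; rewrite !gt_eqF.
by rewrite pmulr_rge0 ?subr_ge0 // divr_gt0 // mulr_gt0.
Qed.

(** [A] and [B] are the norms of the components of a vector along and off psi, [u] is the margin t -
    m, [X] the cross term of the drift. Half of eta e A^2 absorbs 4 |X| by [amgm]; 14 = 8 + 6
    collects [amgm] and 2 |Y|. *)
Lemma gain_ge_real eta e u A B X Y S : 0 < eta -> 0 < e -> e <= 1 -> e / 2 <= u -> 0 <= S ->
  `|X| <= eta * (A * B) -> `|Y| <= 3 * eta * B ^+ 2 ->
  (1 + eta * e / 2) * A ^+ 2 + (1 - 14 * (eta / e)) * B ^+ 2 <=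
  A ^+ 2 + B ^+ 2 + 2 * (eta * u * A ^+ 2 + 2 * X + Y) + S.
Proof.
move=> eta0 e0 e1 H S0; rewrite !ler_norml => /andP[X1 X2] /andP[Y1 Y2].
have am := amgm A B eta0 e0.
have A0 : 0 <= A ^+ 2 by rewrite sqr_ge0.
have B0 : 0 <= B ^+ 2 by rewrite sqr_ge0.
have a1 := ler_wpM2r A0 (ler_wpM2l (ltW eta0) H).
have b1 : eta * B ^+ 2 <= eta / e * B ^+ 2.
  by rewrite ler_wpM2r // ler_pdivlMr // ler_piMr // ltW.
lra.
Qed.

(** Here the square term [S] has the wrong sign: 60 eta <= e makes its A-part at most a quarter of
    eta e A^2, and its B-part turns 14 into 15. *)
Lemma gain_le_real eta e u A B X Y S : 0 < eta -> 0 < e -> e <= 1 -> 60 * eta <= e ->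
  u <= - (e / 2) -> S <= 9 * eta ^+ 2 * (A ^+ 2 + B ^+ 2) ->
  `|X| <= eta * (A * B) -> `|Y| <= 3 * eta * B ^+ 2 ->
  A ^+ 2 + B ^+ 2 + 2 * (eta * u * A ^+ 2 + 2 * X + Y) + S <=
  (1 - eta * e / 4) * A ^+ 2 + (1 + 15 * (eta / e)) * B ^+ 2.
Proof.
move=> eta0 e0 e1 ee H S0; rewrite !ler_norml => /andP[X1 X2] /andP[Y1 Y2].
have am := amgm A B eta0 e0.
have A0 : 0 <= A ^+ 2 by rewrite sqr_ge0.
have B0 : 0 <= B ^+ 2 by rewrite sqr_ge0.
have a1 := ler_wpM2r A0 (ler_wpM2l (ltW eta0) H).
have b1 : eta * B ^+ 2 <= eta / e * B ^+ 2.
  by rewrite ler_wpM2r // ler_pdivlMr // ler_piMr // ltW.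
have c1 : 36 * eta ^+ 2 * A ^+ 2 <= eta * e * A ^+ 2.
  by rewrite ler_wpM2r // expr2 mulrCA ler_wpM2l ?(ltW eta0) //; lra.
have c2 : 9 * eta ^+ 2 * B ^+ 2 <= eta * B ^+ 2.
  by rewrite ler_wpM2r // expr2 mulrCA ler_piMr ?(ltW eta0) //; lra.
lra.
Qed.

(** Here x = eta e and y = eta / e. The constant 30 is large enough for both kinds of error, so one
    damping factor s serves Yes and No. *)
Lemma site_no_real x y A B : 0 <= x -> x <= y -> x <= 1 -> 60 * y <= 1 -> 0 <= A -> 0 <= B ->
  A + (1 - 30 * y) * B <= (1 - x / 4) * ((1 + x / 2) * A + (1 - 14 * y) * B).
Proof.
move=> x0 x1 x2 y2 A0 B0.
have u1 : 1 <= (1 - x / 4) * (1 + x / 2) by nra.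
have u2 : 1 - 30 * y <= (1 - x / 4) * (1 - 14 * y) by nra.
by rewrite mulrDr !mulrA lerD // ?ler_wpM2r // -[leLHS]mul1r ler_wpM2r.
Qed.

Lemma site_yes_real x y A B : 0 <= x -> x <= y -> 60 * y <= 1 -> 0 <= A -> 0 <= B ->
  (1 - x / 4) * A + (1 + 15 * y) * B <= (1 - x / 4) * (A + (1 - 30 * y)^-1 * B).
Proof.
move=> x0 x1 y2 A0 B0.
rewrite mulrDr lerD // mulrA ler_wpM2r // ler_pdivlMr; [nra|lra].
Qed.

End RealBounds.

Section Site.
Variable R : realType.
Local Notation C := (R[i]).
Local Notation herm := (@Defs.hermitian R _).
Variables (D : nat) (psi : 'cV[C]_D) (O : 'M[C]_D) (t eta e : R).
Hypothesis psi1 : adj psi *m psi = 1%:M.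
Hypothesis hO : herm O.
Hypothesis nO : nb 1 O.
Hypothesis t2 : `|t| <= 2.
Hypothesis eta0 : 0 < eta.
Hypothesis e0 : 0 < e.
Hypothesis e1 : e <= 1.
Hypothesis eta_e : 60 * eta <= e.

Definition proj1 : 'M[C]_D := psi *m adj psi.
Definition drift : 'M[C]_D := eta *r (t *r 1%:M - O).
Local Notation P := proj1.
Local Notation Q := (1%:M - P).
Local Notation h := drift.
Local Notation g := (1%:M + h).
Local Notation m := (rd psi (O *m psi)).

Lemma proj1_herm : herm P.
Proof. by rewrite /Defs.hermitian adjM adjK. Qed.

Lemma proj1_idem : P *m P = P.
Proof. by rewrite /proj1 mulmxA -(mulmxA psi) psi1 mulmx1. Qed.

Lemma drift_herm : herm h.
Proof. by apply/hermitianZ/hermitianB => //; apply/hermitianZ/hermitian1. Qed.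

Lemma nb_drift : nb (3 * eta) h.
Proof.
have -> : 3 * eta = `|eta| * (2 * 1 + 1) by rewrite gtr0_norm //; ring.
apply/nbZ/nbB => //.
apply: (nb_ge _ (nbZ t (@nb1 R D))); by rewrite !mulr1.
Qed.

Lemma gain_herm : herm g.
Proof. by apply: hermitianD; [exact: hermitian1|exact: drift_herm]. Qed.

Lemma eta_small : eta <= 1 / 60.
Proof. move: eta_e e1; lra. Qed.

Lemma gain_unit : g \in unitmx.
Proof.
rewrite -unitmx_tr unitmxE unitfE; apply/negP => /det0P [v vn0].
move/(congr1 trmx); rewrite trmx_mul trmxK trmx0 mulmxDl mul1mx => H.
have E : v^T = - (h *m v^T) by apply/eqP; rewrite -addr_eq0 H.
have := nb_drift v^T; rewrite -nrN -E.
have s := eta_small; have n0 := nr_ge0 v^T.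
have [z|nz] := eqVneq (nr v^T) 0.
  have : rd v^T v^T = 0 by rewrite -nr2 z expr0n.
  by move/rd_eq0 => z2; move: vn0; rewrite -[v]trmxK z2 trmx0 eqxx.
have np : 0 < nr v^T by rewrite lt_def nz.
rewrite -{1}[nr _]mul1r ler_pM2r //; lra.
Qed.

Definition gaini : 'M[C]_D := invmx g.

Lemma gaini_r : g *m gaini = 1%:M. Proof. exact: mulmxV gain_unit. Qed.
Lemma gaini_l : gaini *m g = 1%:M. Proof. exact: mulVmx gain_unit. Qed.

Lemma gaini_herm : herm gaini.
Proof.
have H : adj gaini *m g = 1%:M by rewrite -[X in _ *m X]gain_herm -adjM gaini_r adj1.
by rewrite /Defs.hermitian -[adj _]mulmx1 -gaini_r mulmxA H mul1mx.
Qed.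

Lemma proj1_mean : P *m O *m P = m *r P.
Proof.
have E : adj psi *m O *m psi = real_complex R m *: 1%:M.
  have hh : adj (adj psi *m O *m psi) = adj psi *m O *m psi by rewrite !adjM adjK hO mulmxA.
  apply/matrixP => i j; rewrite !ord1 [RHS]mxE [X in _ * X]mxE eqxx mulr1 /rd mulmxA.
  have := congr1 (fun X : 'M[C]_1 => X 0 0) hh; rewrite adjE.
  case: (_ 0 0) => a b [] /eqP; rewrite -subr_eq0 -opprD oppr_eq0 -mulr2n mulrn_eq0 /=.
  by move=> /eqP ->.
rewrite /proj1 !mulmxA -!(mulmxA psi) E.
by rewrite -scalemxAl mul1mx -scalemxAr.
Qed.

Section Vector.
Variable v : 'cV[C]_D.
Local Notation A := (nr (P *m v)).
Local Notation B := (nr (Q *m v)).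

Lemma rdPQ : rd (P *m v) (Q *m v) = 0.
Proof. by rewrite rd_adjl proj1_herm mulmxA (PQ proj1_idem) mul0mx rd0r. Qed.

Lemma split_v : v = P *m v + Q *m v.
Proof. by rewrite -mulmxDl addrC subrK mul1mx. Qed.

Lemma rd_vv : rd v v = A ^+ 2 + B ^+ 2.
Proof.
rewrite !nr2 {1 2}split_v rdDl !rdDr rdPQ (rdC (Q *m v)) rdPQ.
by rewrite addr0 add0r.
Qed.

Lemma rd_vP : rd v (P *m v) = A ^+ 2.
Proof. by rewrite nr2 rd_adjl proj1_herm mulmxA proj1_idem. Qed.

Lemma rd_vQ : rd v (Q *m v) = B ^+ 2.
Proof. by rewrite nr2 rd_adjl (hQ proj1_herm) mulmxA (QQ proj1_idem). Qed.

Lemma rd_PcQ c : rd v ((P + c *r Q) *m v) = A ^+ 2 + c * B ^+ 2.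
Proof. by rewrite -rd_vP -rd_vQ -rdZr -rdDr scalemxAl -mulmxDl. Qed.

Lemma rd_abs (x y : 'cV[C]_D) : `|rd x y| <= nr x * nr y.
Proof.
rewrite ler_norml rd_le_nr andbT lerNl.
by rewrite -rdNr -(nrN y) rd_le_nr.
Qed.

(** P has rank one, so P h P is the scalar eta (t - m) times P. In the cross term the multiple t of
    the identity drops out because P Q = 0, which leaves the factor eta instead of 3 eta. *)
Lemma rd_drift : exists X Y, [/\ rd v (h *m v) = eta * (t - m) * A ^+ 2 + 2 * X + Y,
  `|X| <= eta * (A * B) & `|Y| <= 3 * eta * B ^+ 2].
Proof.
exists (rd (P *m v) (h *m (Q *m v))), (rd (Q *m v) (h *m (Q *m v))).
have sy x y : rd x (h *m y) = rd y (h *m x) by rewrite rdC rd_adjl drift_herm.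
split.
- rewrite {1 2}split_v mulmxDr rdDl !rdDr (sy (Q *m v) (P *m v)).
  have -> : rd (P *m v) (h *m (P *m v)) = eta * (t - m) * A ^+ 2.
    have hPP : P *m h *m P = (eta * (t - m)) *r P.
      rewrite /drift -scalemxAr -scalemxAl mulmxBr mulmxBl -scalemxAr mulmx1 -scalemxAl.
      by rewrite proj1_idem proj1_mean -scalerBl -rmorphB scalerA -rmorphM.
    by rewrite rd_adjl proj1_herm (mulmxA P) (mulmxA _ P) hPP -scalemxAl rdZr rd_vP.
  by rewrite addrA -(addrA (_ * _ ^+ 2)) -mulr2n mulr_natl.
- rewrite /drift -scalemxAl rdZr mulmxBl -scalemxAl mul1mx rdBr rdZr rdPQ mulr0 sub0r.
  rewrite normrM normrN gtr0_norm // ler_wpM2l ?(ltW eta0) //.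
  apply: (le_trans (rd_abs _ _)); rewrite ler_wpM2l ?nr_ge0 //.
  by have := nO (Q *m v); rewrite mul1r.
- apply: (le_trans (rd_abs _ _)).
  have := nb_drift (Q *m v) => /(ler_wpM2l (nr_ge0 (Q *m v))) /le_trans; apply.
  by rewrite le_eqVlt; apply/orP; left; apply/eqP; ring.
Qed.

Lemma rd_gain : rd (g *m v) (g *m v) = rd v v + 2 * rd v (h *m v) + rd (h *m v) (h *m v).
Proof. rewrite mulmxDl mul1mx rdDl !rdDr (rdC (h *m v) v); ring. Qed.

Lemma rd_drift2 : rd (h *m v) (h *m v) <= 9 * eta ^+ 2 * (A ^+ 2 + B ^+ 2).
Proof.
have := nb_rd v (mulr_ge0 (ler0n R 3) (ltW eta0)) nb_drift.
by rewrite -rd_vv exprMn; have -> : 3 ^+ 2 = 9 :> R by ring.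
Qed.

End Vector.

Lemma rd_gg v : rd v (g *m g *m v) = rd (g *m v) (g *m v).
Proof. by rewrite [RHS]rd_adjl gain_herm mulmxA. Qed.

Lemma gain_ge v : e / 2 <= t - m ->
  (1 + eta * e / 2) * nr (P *m v) ^+ 2 + (1 - 14 * (eta / e)) * nr (Q *m v) ^+ 2
  <= rd (g *m v) (g *m v).
Proof.
move=> H; rewrite rd_gain rd_vv; have [X [Y [-> HX HY]]] := rd_drift v.
exact: (gain_ge_real eta0 e0 e1 H (rd_ge0 (h *m v)) HX HY).
Qed.

Lemma gain_le v : e / 2 <= m - t ->
  rd (g *m v) (g *m v) <=
  (1 - eta * e / 4) * nr (P *m v) ^+ 2 + (1 + 15 * (eta / e)) * nr (Q *m v) ^+ 2.
Proof.
move=> H; rewrite rd_gain rd_vv; have [X [Y [-> HX HY]]] := rd_drift v.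
have {}H : t - m <= - (e / 2) by rewrite lerNr opprB.
exact: (gain_le_real eta0 e0 e1 eta_e H (rd_drift2 v) HX HY).
Qed.

Lemma eta_e_bounds : [/\ 0 <= eta * e, eta * e <= eta / e, eta * e <= 1 & 60 * (eta / e) <= 1].
Proof.
have y2 : 60 * (eta / e) <= 1 by rewrite mulrA ler_pdivrMr // mul1r.
have x1 : eta * e <= eta / e by rewrite ler_pM2l // (le_trans e1) // invf_ge1.
by split => //; [rewrite ltW // mulr_gt0|lra].
Qed.

(** Along psi the margin e / 2 gives room to spare; off psi the damping by 30 eta / e pays both for
    the unknown action of the gain and for the cross terms. *)
Lemma site_no : e / 2 <= t - m ->
  pos ((1 - eta * e / 4) *r (g *m g) - (P + (1 - 30 * (eta / e)) *r Q)).
Proof.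
move=> H; apply: rd_pos => [|v].
  apply: hermitianB; first by apply: hermitianZ; rewrite /Defs.hermitian adjM gain_herm.
  by apply: hermitianD; [exact: proj1_herm|apply: hermitianZ; apply: hQ proj1_herm].
rewrite mulmxBl rdBr rd_PcQ -(scalemxAl _ (g *m g)) rdZr rd_gg subr_ge0.
have [x0 x1 x2 y2] := eta_e_bounds.
have w0 : 0 <= 1 - eta * e / 4 by lra.
apply: le_trans (ler_wpM2l w0 (gain_ge v H)).
by apply: site_no_real => //; exact: sqr_ge0.
Qed.

Lemma site_yes : e / 2 <= m - t ->
  pos ((1 - eta * e / 4) *r (P + (1 - 30 * (eta / e))^-1 *r Q) - g *m g).
Proof.
move=> H; apply: rd_pos => [|v].
  apply: hermitianB; last by rewrite /Defs.hermitian adjM gain_herm.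
  by apply/hermitianZ/hermitianD; [exact: proj1_herm|apply: hermitianZ; apply: hQ proj1_herm].
rewrite mulmxBl rdBr -scalemxAl rdZr rd_PcQ rd_gg subr_ge0.
have [x0 x1 x2 y2] := eta_e_bounds.
apply: (le_trans (gain_le v H)).
by apply: site_yes_real => //; exact: sqr_ge0.
Qed.

End Site.

(** * Purification *)

Lemma Re_tr_sum (R : realType) n I (s : seq I) (F : I -> 'M[R[i]]_n) :
  complex.Re (\tr (\sum_(i <- s) F i)) = \sum_(i <- s) complex.Re (\tr (F i)).
Proof.
elim: s => [|x s IH]; first by rewrite !big_nil mxtrace0.
by rewrite !big_cons mxtraceD raddfD /= IH.
Qed.

(* Tensor product of column vectors; the column count 1 * 1 is convertible to 1. *)
Definition tensv (R : realType) a b (x : 'cV[R[i]]_a) (y : 'cV[R[i]]_b) : 'cV[R[i]]_(a * b) :=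
  tensmx x y.

Lemma tensv_mul (R : realType) a b a' b' (A : 'M[R[i]]_(a', a)) (B : 'M[R[i]]_(b', b)) x y :
  (A *t B) *m tensv x y = tensv (A *m x) (B *m y).
Proof. exact: (@tensmx_mul _ _ _ _ _ _ _ A B x y). Qed.

Lemma tensv_outer (R : realType) a b (x : 'cV[R[i]]_a) (y : 'cV[R[i]]_b) :
  tensv x y *m adj (tensv x y) = (x *m adj x) *t (y *m adj y).
Proof.
rewrite -(@tensmx_mul _ _ _ _ _ _ _ x y (adj x) (adj y)); congr (_ *m _).
exact: (@adj_tens _ _ _ _ _ x y).
Qed.

Lemma tensv0l (R : realType) a b (y : 'cV[R[i]]_b) : tensv (0 : 'cV_a) y = 0.
Proof. exact: (@tens0mx _ a 1 b 1 y). Qed.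

Lemma tensvZr (R : realType) a b r (x : 'cV[R[i]]_a) (y : 'cV[R[i]]_b) :
  tensv x (r *r y) = r *r tensv x y.
Proof. exact: (@tensZr _ b 1 a 1 r y x). Qed.

Lemma rd_tensv (R : realType) a b (x : 'cV[R[i]]_a) (y : 'cV[R[i]]_b) :
  rd (tensv x y) (tensv x y) = rd x x * rd y y.
Proof.
have E : adj (tensv x y) *m tensv x y = (adj x *m x) *t (adj y *m y).
  rewrite -(@tensmx_mul _ _ _ _ _ _ _ (adj x) (adj y) x y); congr (_ *m _).
  exact: (@adj_tens _ _ _ _ _ x y).
rewrite {1}/rd E mxE.
have e1 (i : 'I_1) : i = 0 by rewrite ord1.
rewrite !(e1 (mxtens_unindex _).1) !(e1 (mxtens_unindex _).2).
by rewrite !rd_complex -rmorphM.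
Qed.

Section Purification.
Variable R : realType.
Local Notation C := (R[i]).
Local Notation herm := (@Defs.hermitian R _).
Variables d m : nat.
Local Notation D := (d * m)%N.
Implicit Types A : 'M[C]_d.

(* slice b = 1 (x) <b| reads off the b-th component of the purifying register. *)
Definition slice (b : 'I_m) : 'M[C]_(d, D) :=
  \matrix_(i, j) (j == mxtens_index (i, b))%:R.

Lemma slice_tens b (A : 'M[C]_d) : slice b *m (A *t 1%:M) = A *m slice b.
Proof.
apply/matrixP => i j; case: (mxtens_indexP j) => k c.
rewrite !mxE (bigD1 (mxtens_index (i, b))) //= big1 ?addr0 => [|x xi]; last first.
  by rewrite mxE (negbTE xi) mul0r.
rewrite mxE eqxx mul1r tensmxE mxE (bigD1 k) //= big1 ?addr0 => [|x xk]; last first.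
  by rewrite mxE (can_eq (@mxtens_indexK _ _)) xpair_eqE eq_sym (negbTE xk) mulr0.
by rewrite mxE (can_eq (@mxtens_indexK _ _)) xpair_eqE eqxx /= [c == b]eq_sym.
Qed.

Lemma slice_orth b c : slice b *m adj (slice c) = (b == c)%:R *: 1%:M.
Proof.
apply/matrixP => i j; rewrite !mxE (bigD1 (mxtens_index (i, b))) //= big1 ?addr0 => [|x xi]; last first.
  by rewrite mxE (negbTE xi) mul0r.
rewrite adjE !mxE eqxx mul1r rmorph_nat (can_eq (@mxtens_indexK _ _)) xpair_eqE.
by rewrite -natrM mulnb andbC.
Qed.

Lemma slice_sum : \sum_b adj (slice b) *m slice b = 1%:M.
Proof.
apply/matrixP => i j; rewrite summxE.
case: (mxtens_indexP i) => k c; case: (mxtens_indexP j) => l c'.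
rewrite (bigD1 c) //= big1 ?addr0 => [|b bc]; last first.
  rewrite !mxE big1 // => x _; rewrite adjE !mxE rmorph_nat.
  by rewrite (can_eq (@mxtens_indexK _ _)) xpair_eqE [c == b]eq_sym (negbTE bc) andbF mul0r.
rewrite !mxE (bigD1 k) //= big1 ?addr0 => [|x xk]; last first.
  rewrite adjE !mxE rmorph_nat (can_eq (@mxtens_indexK _ _)) xpair_eqE eq_sym (negbTE xk) andFb mul0r //.
by rewrite adjE !mxE rmorph_nat eqxx mul1r eq_sym.
Qed.

Lemma rd_slices (u v : 'cV[C]_D) : rd u v = \sum_b rd (slice b *m u) (slice b *m v).
Proof.
rewrite -{1}[v]mul1mx -slice_sum mulmx_suml /rd mulmx_sumr summxE raddf_sum.
by apply: eq_bigr => b _; rewrite adjM !mulmxA.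
Qed.

Lemma nb_lift A : nb 1 A -> nb 1 (A *t (1%:M : 'M[C]_m)).
Proof.
move=> H; apply: nb_sq => // v; rewrite expr1n mul1r !rd_slices; apply: ler_sum => b _.
rewrite mulmxA slice_tens -mulmxA.
by have := nb_rd (slice b *m v) ler01 H; rewrite expr1n mul1r.
Qed.

Lemma lift_herm A : herm A -> herm (A *t (1%:M : 'M[C]_m)).
Proof. by move=> H; rewrite /Defs.hermitian adj_tens H adj1. Qed.

Variable X : 'M[C]_(d, m).
Definition purif : 'cV[C]_D := \sum_b adj (slice b) *m col b X.
Local Notation rho := (X *m adj X).

Lemma slice_purif b : slice b *m purif = col b X.
Proof.
rewrite /purif mulmx_sumr (bigD1 b) //= big1 ?addr0 => [|c cb].
  by rewrite mulmxA slice_orth eqxx scale1r mul1mx.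
by rewrite mulmxA slice_orth eq_sym (negbTE cb) scale0r mul0mx.
Qed.

Lemma rho_slices : rho = \sum_b (slice b *m purif) *m adj (slice b *m purif).
Proof.
under eq_bigr => b _ do rewrite slice_purif.
apply/matrixP => i j; rewrite mxE summxE; apply: eq_bigr => b _.
by rewrite !mxE big_ord1 !mxE.
Qed.

Lemma rd_purif A : rd purif ((A *t (1%:M : 'M[C]_m)) *m purif) = complex.Re (\tr (A *m rho)).
Proof.
rewrite rd_slices rho_slices [in RHS]mulmx_sumr Re_tr_sum; apply: eq_bigr => b _.
rewrite (mulmxA (slice b) (A *t _)) slice_tens -mulmxA.
by rewrite [in RHS]mulmxA mxtrace_mulC /mxtrace big_ord1 /rd.
Qed.

Lemma rd_purif1 : rd purif purif = complex.Re (\tr rho).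
Proof. by rewrite -[rho]mul1mx -rd_purif tens11 mul1mx. Qed.

(** The Kraus operators of the partial trace over the n purifying registers, one for each string of
    register indices. *)
Fixpoint slices n : seq 'M[C]_(pw d n, pw D n) :=
  if n is n'.+1 return seq 'M[C]_(pw d n, pw D n)
  then [seq slice b *t i | b <- index_enum 'I_m, i <- slices n'] else [:: 1%:M].

Fixpoint vpow (v : 'cV[C]_D) n : 'cV[C]_(pw D n) :=
  if n is n'.+1 return 'cV[C]_(pw D n) then tensv v (vpow v n') else 1%:M.

Lemma slices_sum n : \sum_(i <- slices n) adj i *m i = 1%:M.
Proof.
elim: n => [|n IH] /=; first by rewrite big_seq1 adj1 mulmx1.
rewrite big_allpairs_dep /=.
under eq_bigr => b _.
  under eq_bigr => i _ do rewrite adj_tens tensmx_mul.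
  rewrite -tens_sumr IH; over.
by rewrite -tens_suml slice_sum tens11.
Qed.

Lemma tpow_slices n : tpow rho n = \sum_(i <- slices n) (i *m vpow purif n) *m adj (i *m vpow purif n).
Proof.
elim: n => [|n IH] /=; first by rewrite big_seq1 mul1mx adj1 mulmx1.
rewrite big_allpairs_dep /= IH {1}rho_slices tens_suml; apply: eq_bigr => b _.
rewrite tens_sumr; apply: eq_bigr => i _.
by rewrite tensv_mul tensv_outer.
Qed.

Lemma slices_tpow n A i : i \in slices n -> i *m tpow (A *t (1%:M : 'M[C]_m)) n = tpow A n *m i.
Proof.
elim: n i => [|n IH] i /=; first by rewrite inE => /eqP ->.
case/allpairsP => -[b j] /= [_ jn ->].
by rewrite !tensmx_mul slice_tens IH.
Qed.

Lemma nr_vpow v n : rd (vpow v n) (vpow v n) = rd v v ^+ n.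
Proof.
elim: n => [|n IH] /=; first by rewrite /rd adj1 mulmx1 mxE.
by rewrite rd_tensv IH exprS.
Qed.

Lemma resolvent_intertwine N N' (G : 'M[C]_N) (G' : 'M[C]_N') (i : 'M[C]_(N, N')) :
  herm G -> herm G' -> i *m G' = G *m i -> i *m resolvent G' = resolvent G *m i.
Proof.
move=> hG hG' H.
have E : i *m (1%:M + G' *m G') = (1%:M + G *m G) *m i.
  by rewrite mulmxDr mulmxDl mulmx1 mul1mx mulmxA H -!mulmxA H.
have := congr1 (fun Y => resolvent G *m Y *m resolvent G') E.
by rewrite /= -!mulmxA resolventKr // mulmx1 (mulmxA (resolvent G)) resolventK // mul1mx.
Qed.

Variable n : nat.
Implicit Types vs : seq 'cV[C]_(pw D n).

(** The purified run is a list of unnormalized branch vectors rather than a density matrix: bounds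
    on the instrument are proved for one vector and then summed. *)
Definition reduced vs : 'M[C]_(pw d n) :=
  \sum_(v <- vs) \sum_(i <- slices n) (i *m v) *m adj (i *m v).

Definition evolve (ins : bool -> seq 'M[C]_(pw D n)) o vs :=
  [seq K *m v | v <- vs, K <- ins o].

Lemma reduced_tr vs : complex.Re (\tr (reduced vs)) = \sum_(v <- vs) rd v v.
Proof.
rewrite /reduced Re_tr_sum; apply: eq_bigr => v _.
have -> : rd v v = complex.Re (\tr (adj v *m (\sum_(i <- slices n) adj i *m i) *m v)).
  by rewrite slices_sum mulmx1 /rd /mxtrace big_ord1.
rewrite mulmx_sumr mulmx_suml !Re_tr_sum; apply: eq_bigr => i _.
by rewrite mxtrace_mulC adjM !mulmxA.
Qed.

Lemma reduced_op (K : 'M[C]_(pw d n)) (K' : 'M[C]_(pw D n)) vs :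
  (forall i, i \in slices n -> i *m K' = K *m i) ->
  K *m reduced vs *m adj K = reduced [seq K' *m v | v <- vs].
Proof.
move=> H; rewrite /reduced mulmx_sumr mulmx_suml big_map; apply: eq_bigr => v _.
rewrite mulmx_sumr mulmx_suml big_seq [RHS]big_seq; apply: eq_bigr => i /H E.
have F : i *m (K' *m v) = K *m (i *m v) by rewrite mulmxA E -mulmxA.
by rewrite F !adjM !mulmxA.
Qed.

(** The measurement acts on the copies alone, so every slice intertwines the lifted G and its
    resolvent with the original ones; tracing out the purifying registers commutes with the step. *)
Lemma reduced_evolve (A : 'M[C]_d) o vs : herm A ->
  \sum_(K <- threshold_ins (tpow A n) o) K *m reduced vs *m adj K =
  reduced (evolve (threshold_ins (tpow (A *t (1%:M : 'M[C]_m)) n)) o vs).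
Proof.
move=> hA; set G := tpow A n; set G' := tpow _ n.
have hG : herm G by rewrite /Defs.hermitian adj_tpow hA.
have hG' : herm G' by rewrite /Defs.hermitian adj_tpow lift_herm.
have e1 i : i \in slices n -> i *m G' = G *m i by exact: slices_tpow.
have e2 i : i \in slices n -> i *m resolvent G' = resolvent G *m i.
  by move/e1; apply: resolvent_intertwine.
have mapE (K : 'M[C]_(pw D n)) : reduced [seq K *m v | v <- vs] =
    \sum_(v <- vs) \sum_(i <- slices n) (i *m (K *m v)) *m adj (i *m (K *m v)).
  by rewrite /reduced big_map.
have two (K1 K2 : 'M[C]_(pw d n)) (K1' K2' : 'M[C]_(pw D n)) :
   (forall i, i \in slices n -> i *m K1' = K1 *m i) ->
   (forall i, i \in slices n -> i *m K2' = K2 *m i) ->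
   \sum_(K <- [:: K1; K2]) K *m reduced vs *m adj K =
   reduced [seq K *m v | v <- vs, K <- [:: K1'; K2']].
  move=> H1 H2; rewrite big_cons big_seq1 (reduced_op _ H1) (reduced_op _ H2) !mapE.
  rewrite /reduced big_allpairs_dep /= -big_split; apply: eq_bigr => v _.
  by rewrite big_cons big_seq1.
case: o; rewrite /evolve /threshold_ins; apply: two => i ii.
- by rewrite mulmxA e1 // -mulmxA e2 // mulmxA.
- by rewrite -(mulmxA G') mulmxA e1 // -mulmxA (mulmxA i) e1 // -(mulmxA G i) e2 // !mulmxA.
- exact: e2.
- by rewrite mulmxA e1 // -mulmxA e2 // mulmxA.
Qed.

End Purification.

(** * Transcripts *)

Section History.
Variables (T : Type) (F : seq bool -> bool -> T -> T) (x0 : T).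

Definition hist (os : seq bool) : T :=
  foldl (fun x i => F (take i os) (nth true os i) x) x0 (iota 0 (size os)).

(** Appending an answer changes no earlier prefix or entry, so the fold over a whole transcript is
    an iteration, one answer at a time. *)
Lemma hist_rcons os o : hist (rcons os o) = F os o (hist os).
Proof.
rewrite /hist size_rcons -addn1 iotaD add0n /= foldl_cat /= -cats1 take_size_cat //.
rewrite nth_cat ltnn subnn /=; congr (F _ _ _).
have : forall i, i \in iota 0 (size os) -> (i < size os)%N by move=> i; rewrite mem_iota.
elim: (iota _ _) x0 => //= i s IH x H; rewrite -IH => [|j js]; last by rewrite H // inE js orbT.
have ios : (i < size os)%N by rewrite H // inE eqxx.
by rewrite takel_cat ?(ltnW ios) // nth_cat ios.
Qed.
End History.

(** * Success probability as a recursion over answers *)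

Section Game.
Variables (R : realType) (ell M : nat) (pr : seq bool -> R) (ok : seq bool -> bool -> bool).

(** Being terminal and being correct are tests on a whole transcript; read as a recursion on the
    continuation [t] of [h], they let probabilities be summed answer by answer. *)
Fixpoint play (h t : seq bool) : bool :=
  if t is o :: t' then [&& ~~ halted ell M h, ok h o & play (rcons h o) t'] else halted ell M h.

Lemma playE h t : play h t =
  [&& halted ell M (h ++ t),
      all (fun k => ~~ halted ell M (h ++ take k t)) (iota 0 (size t))
    & all (fun i => ok (h ++ take i t) (nth true t i)) (iota 0 (size t))].
Proof.
elim: t h => [|o t IH] h /=; first by rewrite cats0 !andbT.
rewrite IH !cats0 -cats1 -catA /=.
rewrite (iotaDl 1 0) !all_map.
have -> : all (preim (addn 1) (fun k => ~~ halted ell M (h ++ take k (o :: t)))) (iota 0 (size t))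
  = all (fun k => ~~ halted ell M ((h ++ [:: o]) ++ take k t)) (iota 0 (size t)).
  by apply: eq_all => k; rewrite -catA.
have -> : all (preim (addn 1) (fun i => ok (h ++ take i (o :: t)) (nth true (o :: t) i))) (iota 0 (size t))
  = all (fun i => ok ((h ++ [:: o]) ++ take i t) (nth true t i)) (iota 0 (size t)).
  by apply: eq_all => k; rewrite -catA.
do !bool_congr.
Qed.

Fixpoint succ_mass j h : R :=
  if halted ell M h then pr h
  else if j is j'.+1 then \sum_(o : bool | ok h o) succ_mass j' (rcons h o) else 0.

Lemma sum_tuple0 (f : seq bool -> R) (P : pred (seq bool)) :
  \sum_(t : 0.-tuple bool | P t) f t = if P [::] then f [::] else 0.
Proof.
by rewrite big_mkcond (big_pred1 [tuple]) //= => t; apply/esym/eqP/val_inj; case: t => -[].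
Qed.

Lemma sum_tupleS m (f : seq bool -> R) (P : pred (seq bool)) :
  \sum_(t : m.+1.-tuple bool | P t) f t =
  \sum_(o : bool) \sum_(t : m.-tuple bool | P (o :: t)) f (o :: t).
Proof.
rewrite pair_big_dep /=.
rewrite (reindex (fun p : bool * m.-tuple bool => [tuple of p.1 :: p.2])) //=.
exists (fun t : m.+1.-tuple bool => (thead t, [tuple of behead t])) => [[o t] _|t _] /=.
  by congr (_, _); apply: val_inj.
by rewrite -tuple_eta.
Qed.

Lemma succ_massE j h :
  \sum_(m < j.+1) \sum_(t : m.-tuple bool | play h t) pr (h ++ t) = succ_mass j h.
Proof.
elim: j h => [|j IH] h.
  by rewrite big_ord1 (sum_tuple0 (fun t => pr (h ++ t)) (play h)) /= cats0.
rewrite big_ord_recl (sum_tuple0 (fun t => pr (h ++ t)) (play h)) /= cats0.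
have [hh|hh] := boolP (halted ell M h).
  rewrite big1 ?addr0 // => m _.
  by rewrite (sum_tupleS _ (fun t => pr (h ++ t)) (play h)) big1 // => o _; rewrite big1 // => t; rewrite /= hh.
rewrite add0r [RHS]big_mkcond.
under eq_bigr => m _.
  rewrite (sum_tupleS _ (fun t => pr (h ++ t)) (play h)); over.
rewrite exchange_big /=; apply: eq_bigr => o _.
case ho: (ok h o); last first.
  by rewrite big1 // => m _; rewrite big1 // => t; rewrite andbF.
rewrite -IH; apply: eq_bigr => m _; apply: eq_big => [t|t _]; first by rewrite hh.
by rewrite -cats1 -catA.
Qed.

Hypothesis pr_ge0 : forall h, 0 <= pr h.
Hypothesis pr_split : forall h, pr h = pr (rcons h true) + pr (rcons h false).
Variable V : seq bool -> R.
Hypothesis V_ge0 : forall h, 0 <= V h.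
Hypothesis V_split : forall h, V (rcons h true) + V (rcons h false) <= V h.
Variables A B : R.
Hypothesis A0 : 0 <= A.
Hypothesis B0 : 0 <= B.
Hypothesis err : forall h o, ~~ halted ell M h -> ~~ ok h o ->
  pr (rcons h o) <= A * V (rcons h o) + B * pr h.

(** A wrong answer ends its branch, so the charge A V is paid at most once per branch and [V_split]
    bounds all these charges together by A V h, without a factor M. The charge B pr h recurs at
    every query, for each of the two answers, whence 2 j. *)
Lemma succ_mass_ge j h : (M <= size h + j)%N ->
  pr h - A * V h - 2 * j%:R * B * pr h <= succ_mass j h.
Proof.
elim: j h => [|j IH] h hj /=.
  rewrite /halted; rewrite addn0 in hj; rewrite hj orbT mulr0 !mul0r subr0.
  by rewrite lerBlDr lerDl mulr_ge0.
have jB : 0 <= 2 * j.+1%:R * B * pr h by rewrite !mulr_ge0.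
have [hh|hh] := boolP (halted ell M h).
  have AV : 0 <= A * V h by rewrite mulr_ge0.
  lra.
rewrite big_mkcond big_bool /=.
have one o : pr (rcons h o) - A * V (rcons h o) - 2 * j%:R * B * pr (rcons h o) - B * pr h
    <= (if ok h o then succ_mass j (rcons h o) else 0).
  have Bp : 0 <= B * pr h by rewrite mulr_ge0.
  have [oo|oo] := boolP (ok h o).
    have := IH (rcons h o); rewrite size_rcons addSnnS => /(_ hj); lra.
  have := err hh oo; have : 0 <= 2 * j%:R * B * pr (rcons h o) by rewrite !mulr_ge0.
  lra.
have := one true; have := one false; have := pr_split h; have := ler_wpM2l A0 (V_split h).
have -> : 2 * j.+1%:R * B * pr h = 2 * j%:R * B * pr (rcons h true) + 2 * j%:R * B * pr (rcons h false) + 2 * (B * pr h).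
  rewrite -natr1 {1}pr_split [in RHS](pr_split h); ring.
lra.
Qed.

End Game.

Definition answer_ok (R : realType) d (adv : adversary R d) (rho : 'M[R[i]]_d) (eps : R)
  (h : seq bool) (o : bool) : bool :=
  ((((adv h).2 < expect (adv h).1 rho)%R) ==> ~~ o) && ((expect (adv h).1 rho <= (adv h).2 - eps)%R ==> o).

Lemma success_succ_mass (R : realType) d (alg : algorithm R d) (adv : adversary R d) rho eps ell M pr :
  prob alg adv rho =1 pr ->
  success_prob alg adv rho eps ell M = succ_mass ell M pr (answer_ok adv rho eps) M [::].
Proof.
move=> prE; rewrite -succ_massE /success_prob; apply: eq_bigr => j _.
apply: eq_big => [t|t _]; last exact: prE.
by rewrite playE /terminal /correct andbA.
Qed.

Lemma last_queries (R : realType) d (adv : adversary R d) h : last (0, 0) (queries adv h) = adv h.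
Proof. by rewrite /queries -addn1 iotaD map_cat last_cat /= add0n take_size. Qed.

(** * The algorithm *)

Lemma bernoulli_sub (R : realType) i (z : R) : 0 <= z -> z <= 1 -> 1 - i%:R * z <= (1 - z) ^+ i.
Proof.
move=> z0 z1; elim: i => [|i IH]; first by rewrite mul0r subr0 expr0.
have w0 : 0 <= 1 - z by rewrite subr_ge0.
rewrite exprS; apply: le_trans (ler_wpM2l w0 IH).
have : 0 <= i%:R * (z * z) by rewrite !mulr_ge0.
rewrite -natr1; lra.
Qed.

Lemma discount_step (R : realType) (z x y t : R) j : 0 <= 1 - z -> x + (1 - z) * y <= t ->
  (1 - z) ^+ (j + ~~ true) * x + (1 - z) ^+ (j + ~~ false) * y <= (1 - z) ^+ j * t.
Proof.
move=> z0 h; rewrite addn0 addn1 exprSr -mulrA -mulrDr ler_wpM2l //.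
by rewrite exprn_ge0.
Qed.

Lemma double_discount (R : realType) (a z x : R) : 0 <= a -> 0 <= x -> 1 / 2 <= z ->
  a * x <= 2 * a * (z * x).
Proof. by move=> a0 x0 z0; have := mulr_ge0 (mulr_ge0 a0 x0) (_ : 0 <= z - 1 / 2); rewrite subr_ge0 => /(_ z0); lra. Qed.

Section Algorithm.
Variable R : realType.
Local Notation C := (R[i]).
Local Notation herm := (@Defs.hermitian R _).
Variables (d n : nat) (s e eta : R).

(** The cut lies in the middle of the undecided interval, so a wrong answer on either side has
    margin e / 2. The cap at 2 bounds the drift when s is small and is harmless, as rescaled means
    are at most 1. *)
Definition gain (q : 'M[C]_d * R) : 'M[C]_d :=
  1%:M + drift (s^-1 *r q.1) (Num.min (q.2 / s - e / 2) 2) eta.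

(** [step_ok] concerns every query, hence the fallback for non-Hermitian ones. The factor of
    dimension 1 is a trivial ancilla. The default [(0, 0)] is never read in a run, since [queries]
    is nonempty. *)
Definition sv_step (qs : seq ('M[C]_d * R)) (os : seq bool) (o : bool) : seq 'M[C]_(pw d n * 1) :=
  let q := last (0, 0) qs in
  if adj q.1 == q.1 then [seq K *t (1%:M : 'M[C]_1) | K <- threshold_ins (tpow (gain q) n) o]
  else if o then [:: 1%:M] else [::].

Lemma gain_hermitian q : herm q.1 -> herm (gain q).
Proof. by move=> h; apply: gain_herm; apply: hermitianZ. Qed.

Lemma tpow_hermitian (D : nat) (A : 'M[C]_D) : herm A -> herm (tpow A n).
Proof. by move=> h; rewrite /Defs.hermitian adj_tpow h. Qed.

Lemma sv_step_ok qs os : instrument_ok (sv_step qs os).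
Proof.
rewrite /instrument_ok /sv_step; case: eqP => [h|_]; last first.
  by rewrite big_bool /= big_seq1 big_nil addr0 adj1 mulmx1.
have := threshold_ins_ok (tpow_hermitian (gain_hermitian h)).
rewrite /instrument_ok => /(congr1 (fun X => X *t (1%:M : 'M[C]_1))).
rewrite tens11 tens_suml => <-; apply: eq_bigr => o _.
rewrite big_map tens_suml; apply: eq_bigr => K _.
by rewrite adj_tens adj1 tensmx_mul mulmx1.
Qed.

Definition sv_alg : algorithm R d := Algorithm sv_step_ok.

Variables (m : nat) (X : 'M[C]_(d, m)) (adv : adversary R d).
Local Notation rho := (X *m adj X).
Hypothesis adv_herm : forall h, herm (adv h).1.

Definition site_gain h : 'M[C]_(d * m) := gain (adv h) *t (1%:M : 'M[C]_m).

Definition vecs : seq bool -> seq 'cV[C]_(pw (d * m) n) :=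
  hist (fun h o vs => evolve (threshold_ins (tpow (site_gain h) n)) o vs) [:: vpow (purif X) n].

Lemma vecs_rcons h o : vecs (rcons h o) = evolve (threshold_ins (tpow (site_gain h) n)) o (vecs h).
Proof. by rewrite /vecs hist_rcons. Qed.

Lemma postE os : post sv_alg adv rho os = reduced (vecs os) *t (1%:M : 'M[C]_1).
Proof.
have -> : post sv_alg adv rho os = hist (fun h o sigma =>
   \sum_(K <- sv_step (queries adv h) h o) K *m sigma *m adj K) (init_state sv_alg rho) os by [].
elim/last_ind: os => [|h o IH].
  rewrite /hist /= /vecs /hist /= /reduced big_seq1 -tpow_slices /init_state /=.
  congr (_ *t _); apply/matrixP => i j; rewrite !mxE !ord1 //.
rewrite hist_rcons IH vecs_rcons /sv_step last_queries adv_herm eqxx big_map.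
rewrite -reduced_evolve; last by apply: gain_hermitian.
rewrite [RHS]tens_suml; apply: eq_bigr => K _.
by rewrite adj_tens adj1 !tensmx_mul !mulmx1.
Qed.

Definition mass os : R := \sum_(v <- vecs os) rd v v.

Lemma probE os : prob sv_alg adv rho os = mass os.
Proof. by rewrite /prob postE mxtrace_tens mxtrace1 mulr1 reduced_tr. Qed.

Lemma sum_evolve h o (f : 'cV[C]_(pw (d * m) n) -> R) :
  \sum_(v <- vecs (rcons h o)) f v =
  \sum_(v <- vecs h) \sum_(K <- threshold_ins (tpow (site_gain h) n) o) f (K *m v).
Proof. by rewrite vecs_rcons /evolve big_allpairs_dep. Qed.

Lemma mass_ge0 h : 0 <= mass h.
Proof. by apply: sumr_ge0 => v _; exact: rd_ge0. Qed.

Lemma site_gain_herm h : herm (site_gain h).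
Proof. by apply: lift_herm; apply: gain_hermitian. Qed.

Lemma mass_rcons h o :
  mass (rcons h o) = \sum_(v <- vecs h) out_prob (tpow (site_gain h) n) o v.
Proof. by rewrite /mass sum_evolve. Qed.

Lemma mass_split h : mass h = mass (rcons h true) + mass (rcons h false).
Proof.
rewrite !mass_rcons -big_split /= {1}/mass; apply: eq_bigr => v _; symmetry.
exact: (out_probE (tpow_hermitian (site_gain_herm h)) v).
Qed.

Local Notation psi := (purif X).
Local Notation P := (proj1 psi).
Hypothesis tr_rho : \tr rho = 1.
Variables (k p ell : nat).
Hypothesis k0 : (0 < k)%N.
Hypothesis kn : (k <= n)%N.
Hypothesis pk : (2 * p <= k)%N.
Hypothesis s0 : 0 < s.
Hypothesis e0 : 0 < e.
Hypothesis e1 : e <= 1.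
Hypothesis eta0 : 0 < eta.
Hypothesis eta_e : 60 * eta <= e.
Hypothesis adv_nb : forall h, nb s (adv h).1.
Hypothesis adv_thr : forall h, 0 <= (adv h).2.
Local Notation r := (Num.sqrt (n%:R / k%:R) : R).
Local Notation y := (3 * eta * r).
Local Notation c := (5352 * (p%:R * y) ^+ 2).
Hypothesis y1 : y <= 1.
Hypothesis py : 42 * (p%:R * y) <= 1.
Hypothesis cl : c * ell.+1%:R <= 1 / 4.

Lemma psi1 : adj psi *m psi = 1%:M.
Proof.
apply/matrixP => i j; rewrite !ord1 rd_complex rd_purif1 tr_rho mxE eqxx /=.
by rewrite rmorph1.
Qed.

Local Notation F := (lv P (ff R k (2 * p)) n).
Local Notation hP := (proj1_herm psi).
Local Notation PP := (proj1_idem psi1).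
Local Notation thr h := (Num.min ((adv h).2 / s - e / 2) 2).
Local Notation obs h := ((s^-1 *r (adv h).1) *t (1%:M : 'M[C]_m)).

Lemma site_gainE h : site_gain h = 1%:M + drift (obs h) (thr h) eta.
Proof.
by rewrite /site_gain /gain /drift tensDl tens11 tensZl tensDl tensNl tensZl tens11.
Qed.

Lemma obs_herm h : herm (obs h).
Proof. by apply: lift_herm; apply: hermitianZ. Qed.

Lemma obs_nb h : nb 1 (obs h).
Proof.
apply: nb_lift; apply: (nb_ge _ (nbZ s^-1 (adv_nb h))).
by rewrite gtr0_norm ?invr_gt0 // mulVf // gt_eqF.
Qed.

Lemma thr_le2 h : `|thr h| <= 2.
Proof.
rewrite ler_norml ge_min lexx orbT andbT le_min; apply/andP; split; last by lra.
have := divr_ge0 (adv_thr h) (ltW s0); move: (_ / s) e1 => z e1' z0; lra.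
Qed.

Lemma obs_mean h : rd psi (obs h *m psi) = expect (adv h).1 rho / s.
Proof.
rewrite rd_purif /expect -scalemxAl mxtraceZ [RHS]mulrC.
by case: (\tr _) => a b /=; rewrite mul0r subr0.
Qed.

Lemma obs_mean_le1 h : rd psi (obs h *m psi) <= 1.
Proof.
have n1 : nr psi = 1 by rewrite /nr rd_purif1 tr_rho /= sqrtr1.
apply: (le_trans (rd_le_nr _ _)); rewrite n1 mul1r.
by apply: (le_trans (obs_nb h psi)); rewrite n1 mulr1.
Qed.

Local Notation gi h := (gaini (obs h) (thr h) eta).

Lemma gi_r h : (1%:M + drift (obs h) (thr h) eta) *m gi h = 1%:M.
Proof. exact: (gaini_r (obs_nb h) (thr_le2 h) eta0 e1 eta_e). Qed.

Lemma gi_l h : gi h *m (1%:M + drift (obs h) (thr h) eta) = 1%:M.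
Proof. exact: (gaini_l (obs_nb h) (thr_le2 h) eta0 e1 eta_e). Qed.

Lemma gi_herm h : herm (gi h).
Proof. exact: (gaini_herm (obs_herm h) (obs_nb h) (thr_le2 h) eta0 e1 eta_e). Qed.

Lemma r_sq : r ^+ 2 = n%:R / k%:R.
Proof. by rewrite sqr_sqrtr // divr_ge0. Qed.

Lemma c_ge0 : 0 <= c.
Proof. by rewrite mulr_ge0 // sqr_ge0. Qed.

Lemma F_pos v : 0 <= rd v (F *m v).
Proof. by apply: pos_rd; apply: (pos_lv hP PP) => w; rewrite ltW // ff_gt0. Qed.

Lemma step_supermartingale h v :
  out_form (tpow (site_gain h) n) F true v + (1 - c) * out_form (tpow (site_gain h) n) F false v
  <= rd v (F *m v).
Proof.
have hG := tpow_hermitian (site_gain_herm h).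
rewrite site_gainE in hG *.
have GG : tpow (gi h) n *m tpow (1%:M + drift (obs h) (thr h) eta) n = 1%:M.
  by rewrite -tpowM gi_l tpow1.
apply: (out_supermartingale hG _ F_pos GG c_ge0) => [|w].
  by rewrite /Defs.hermitian adj_lv //; exact: hP.
have z0 : 0 <= 3 * eta by rewrite mulr_ge0 // ltW.
have z4 : 3 * eta <= 1 / 4 by move: eta_e e1; lra.
have := core_ineq hP PP k0 kn z0 z4 (drift_herm (thr h) eta (obs_herm h))
  (nb_drift (obs_nb h) (thr_le2 h) eta0) (gi_r h) (gi_l h) (gi_herm h)
  (sqrtr_ge0 _) r_sq y1 w pk py.
(* [c] is twice the constant of [core_ineq], because [out_supermartingale] asks for 1 - c / 2. *)
by have -> : c / 2 = 2676 * (p%:R * y) ^+ 2 by field.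
Qed.

Local Notation ans_ok := (answer_ok adv rho (e * s)).

Local Notation kappa := (((2 * k)%:R ^+ (2 * p))^-1 : R).
Local Notation sq := (Num.sqrt (1 - 30 * (eta / e))).
Local Notation lambda := ((sq ^+ (2 * k))^-1).
Local Notation b := (Num.sqrt (1 - eta * e / 4) ^+ n).

Lemma sq_bounds : [/\ 0 < sq, sq <= 1 & sq ^+ 2 = 1 - 30 * (eta / e)].
Proof.
have y2 : 60 * (eta / e) <= 1 by rewrite mulrA ler_pdivrMr // mul1r.
have x0 : 0 < eta / e by rewrite divr_gt0.
split; first by rewrite sqrtr_gt0; lra.
  by rewrite -[leRHS]sqrtr1 ler_wsqrtr //; lra.
by rewrite sqr_sqrtr //; lra.
Qed.

Lemma alpha_ge0 : 0 <= 1 - eta * e / 4.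
Proof.
have : eta * e <= 1 by rewrite mulr_ile1 ?(ltW eta0) ?(ltW e0) //; move: eta_e e1; lra.
lra.
Qed.

Lemma step_error h o v : ~~ ans_ok h o ->
  out_prob (tpow (site_gain h) n) o v <=
  kappa * out_form (tpow (site_gain h) n) F o v + lambda * (2 * (b ^+ 2 * rd v v)).
Proof.
have [s_gt0 s_le1 s_sq] := sq_bounds.
have b0 : 0 <= b by rewrite exprn_ge0 ?sqrtr_ge0.
have hg : herm (1%:M + drift (obs h) (thr h) eta) by exact: gain_herm (obs_herm h).
case: o; rewrite /answer_ok /= implybT implybF ?andbT negbK site_gainE => H.
  apply: (error_yes hP PP p k0 s_gt0 s_le1 hg b0).
  apply: (nb_lowT_yes hP PP s_gt0 hg alpha_ge0); rewrite s_sq.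
  apply: (site_yes psi1 (obs_herm h) (obs_nb h) (thr_le2 h) eta0 e0 e1 eta_e).
  have : (adv h).2 / s < rd psi (obs h *m psi) by rewrite obs_mean ltr_pM2r // invr_gt0.
  have := obs_mean_le1 h; move: (rd psi _) ((adv h).2 / s) => mu x mu1 xmu.
  have : Num.min (x - e / 2) 2 <= x - e / 2 by rewrite ge_min lexx.
  lra.
apply: (error_no hP PP p k0 s_gt0 s_le1 hg (gi_r h) b0).
apply: (nb_lowT_no hP PP (gi_r h) alpha_ge0 (gi_herm h)); rewrite s_sq.
apply: (site_no psi1 (obs_herm h) (obs_nb h) (thr_le2 h) eta0 e0 e1 eta_e).
have : rd psi (obs h *m psi) <= (adv h).2 / s - e.
  rewrite obs_mean ler_pdivrMr // mulrBl divfK //; last by rewrite gt_eqF.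
have := obs_mean_le1 h; move: e1; move: (rd psi _) ((adv h).2 / s) => mu x e1' mu1 xmu.
(* The capped case: mu <= 1 and e <= 1 keep mu + e / 2 below 2. *)
have : mu + e / 2 <= Num.min (x - e / 2) 2 by rewrite le_min; apply/andP; split; lra.
lra.
Qed.

Definition potential os : R := (1 - c) ^+ count negb os * \sum_(v <- vecs os) rd v (F *m v).

Lemma c_le : c <= 1 / 4.
Proof.
apply: le_trans cl; rewrite -[leLHS]mulr1 ler_wpM2l ?c_ge0 // ler1n //.
Qed.

Lemma discount_ge j : (j <= ell.+1)%N -> 1 / 2 <= (1 - c) ^+ j.
Proof.
move=> jl; have c0 := c_ge0; have c1 := c_le.
apply: (le_trans _ (bernoulli_sub j c0 _)); last by move: c1; move: c => z; lra.
have : j%:R * c <= 1 / 4.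
  by apply: le_trans cl; rewrite mulrC ler_wpM2l // ler_nat.
by move: (_ * c) => z; lra.
Qed.

Lemma potential_ge0 h : 0 <= potential h.
Proof.
rewrite mulr_ge0 //; last by apply: sumr_ge0 => v _; exact: F_pos.
by rewrite exprn_ge0 //; have := c_le; move: c => z; lra.
Qed.

Lemma potential_rcons h o : potential (rcons h o) =
  (1 - c) ^+ (count negb h + ~~ o) * \sum_(v <- vecs h) out_form (tpow (site_gain h) n) F o v.
Proof.
by rewrite /potential (sum_evolve h o (fun v => rd v (F *m v))) -cats1 count_cat /= addn0.
Qed.

Lemma potential_split h : potential (rcons h true) + potential (rcons h false) <= potential h.
Proof.
rewrite !potential_rcons; apply: discount_step.
  by have := c_le; move: c => z; lra.
by rewrite mulr_sumr -big_split /=; apply: ler_sum => v _; exact: step_supermartingale.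
Qed.

Variable M : nat.

Lemma mass_error h o : ~~ halted ell M h -> ~~ ans_ok h o ->
  mass (rcons h o) <= 2 * kappa * potential (rcons h o) + lambda * (2 * b ^+ 2) * mass h.
Proof.
move=> nh no; rewrite mass_rcons potential_rcons.
(* A running history contains at most [ell] No answers and the current answer may add one; the
   discount up to there is at least 1 / 2, hence the factor 2 in front of [kappa]. *)
have cnt : (count negb h + ~~ o <= ell.+1)%N.
  move: nh; rewrite /halted negb_or -leqNgt => /andP[ch _].
  by rewrite -addn1 leq_add // leq_b1.
have dg := discount_ge cnt.
have kap0 : 0 <= kappa by rewrite invr_ge0 exprn_ge0.
have S0 : 0 <= \sum_(v <- vecs h) out_form (tpow (site_gain h) n) F o v.
  by apply: sumr_ge0 => v _; apply: sumr_ge0 => K _; exact: F_pos.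
have : \sum_(v <- vecs h) out_prob (tpow (site_gain h) n) o v <=
  kappa * \sum_(v <- vecs h) out_form (tpow (site_gain h) n) F o v + lambda * (2 * b ^+ 2) * mass h.
  rewrite /mass !mulr_sumr -big_split /=; apply: ler_sum => v _.
  apply: (le_trans (step_error v no)); rewrite lerD2l.
  by rewrite -!mulrA.
by move=> /le_trans; apply; rewrite lerD2r; exact: double_discount.
Qed.

Lemma lv_vpow f : lv P f n *m vpow psi n = f 0%N *r vpow psi n.
Proof.
elim: n f => [|j IH] f /=; first by rewrite mulmx1.
have Pp : P *m psi = psi by rewrite /proj1 -mulmxA psi1 mulmx1.
have Qp : (1%:M - P) *m psi = 0 by rewrite mulmxBl mul1mx Pp subrr.
by rewrite mulmxDl !tensv_mul Pp Qp IH tensvZr tensv0l addr0.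
Qed.

Lemma psi_vpow1 : rd (vpow psi n) (vpow psi n) = 1.
Proof. by rewrite nr_vpow rd_purif1 tr_rho /= expr1n. Qed.

Lemma mass_nil : mass [::] = 1.
Proof. by rewrite /mass /vecs /hist /= big_seq1 psi_vpow1. Qed.

Lemma potential_nil : potential [::] = k%:R ^+ (2 * p).
Proof.
rewrite /potential /vecs /hist /= big_seq1 expr0 mul1r lv_vpow rdZr psi_vpow1 mulr1.
by rewrite /ff addn0.
Qed.

Lemma success_ge : 1 - 2 * kappa * k%:R ^+ (2 * p) - 2 * M%:R * (lambda * (2 * b ^+ 2)) <=
  success_prob sv_alg adv rho (e * s) ell M.
Proof.
rewrite (success_succ_mass _ _ _ probE).
have kap0 : 0 <= 2 * kappa by rewrite mulr_ge0 // invr_ge0 exprn_ge0.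
have [s_gt0 s_le1 s_sq] := sq_bounds.
have B0 : 0 <= lambda * (2 * b ^+ 2).
  by rewrite mulr_ge0 ?invr_ge0 ?exprn_ge0 ?(ltW s_gt0) // mulr_ge0 // sqr_ge0.
have := @succ_mass_ge R ell M mass ans_ok mass_ge0 mass_split potential potential_ge0 potential_split
  (2 * kappa) (lambda * (2 * b ^+ 2)) kap0 B0 mass_error M [::] (leq_addl _ _).
by rewrite mass_nil potential_nil mulr1.
Qed.

End Algorithm.

(** * Choice of the parameters *)

Section Choices.
Variable R : realType.
Implicit Types x e delta L lm eta : R.

Lemma nat_approx x : 0 <= x -> exists n : nat, x <= n%:R <= x + 1.
Proof.
move=> x0; exists (Num.truncn x).+1; have /andP[h1 h2] := truncn_itv x0.
by rewrite ltW //= -natr1 lerD2r.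
Qed.

Lemma lg_ge1 x : 1 <= lg x.
Proof. by rewrite /lg le_max lexx. Qed.

Lemma le_expR_lg x : x <= expR (lg x).
Proof.
have [x0|x0] := leP x 0; first by apply: (le_trans x0); exact: expR_ge0.
by rewrite -{1}[x]lnK ?posrE // ler_expR /lg le_max lexx orbT.
Qed.

(** Squaring exp (-1/2) >= 1 - 1/2 gives e <= 4. *)
Lemma expR_le_4 (p : nat) : expR p%:R <= 4 ^+ p :> R.
Proof.
rewrite -[p%:R]mulr1 expRM_natl lerXn2r ?nnegrE ?expR_ge0 //.
have h : (1 / 2 : R) <= expR (- (1 / 2)) by have := expR_ge1Dx (- (1 / 2) : R); lra.
have h0 : 0 <= (1 / 2 : R) by lra.
have := ler_pM h0 h0 h h; rewrite -expRD.
have -> : - (1 / 2) + - (1 / 2) = - 1 :> R by lra.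
have -> : 1 / 2 * (1 / 2) = 4^-1 :> R by lra.
by rewrite expRN lef_pV2 ?posrE ?expR_gt0.
Qed.

Lemma expR1_ge : 2 <= expR 1 :> R.
Proof. by have := expR_ge1Dx (1 : R); lra. Qed.

Lemma expR2_ge : 4 <= expR 2 :> R.
Proof.
have -> : expR 2 = expR 1 * expR 1 :> R by rewrite -expRD; congr expR; lra.
have h0 : 0 <= (2 : R) by lra.
have := ler_pM h0 h0 expR1_ge expR1_ge; lra.
Qed.

Lemma expR3_ge : 8 <= expR 3 :> R.
Proof.
have -> : expR 3 = expR 2 * expR 1 :> R by rewrite -expRD; congr expR; lra.
have h0 : 0 <= (2 : R) by lra.
have h1 : 0 <= (4 : R) by lra.
have := ler_pM h1 h0 expR2_ge expR1_ge; lra.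
Qed.

Lemma inv_one_sub_le x : 0 <= x -> x <= 1 / 2 -> (1 - x)^-1 <= expR (2 * x).
Proof.
move=> x0 x1; apply: le_trans (expR_ge1Dx (2 * x)).
have h : 0 < 1 - x by lra.
rewrite -[leLHS]mul1r ler_pdivrMr //; nra.
Qed.

(** Ignoring W < k costs exp (60 (eta / e) k), whereas n >= 480 k / e^2 copies decay as exp (-120
    (eta / e) k). The net exponent has to beat 8 M / delta, and the summand 3 covers 8 <= e^3. *)
Lemma error_term_small (k n M : nat) e delta lm L eta : 0 < e -> e <= 1 -> 0 < eta -> 60 * eta <= e ->
  0 < delta -> 480 * k%:R / e ^+ 2 <= n%:R -> delta^-1 <= expR L -> M%:R <= expR lm ->
  lm + L + 3 <= 60 * (eta / e) * k%:R ->
  2 * M%:R * ((Num.sqrt (1 - 30 * (eta / e)) ^+ (2 * k))^-1 * (2 * (Num.sqrt (1 - eta * e / 4) ^+ n) ^+ 2))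
  <= delta / 2.
Proof.
move=> e0 e1 eta0 ee d0 kn dL Ml H.
have y2 : 60 * (eta / e) <= 1 by rewrite mulrA ler_pdivrMr // mul1r.
have x0 : 0 < eta / e by rewrite divr_gt0.
have ee1 : eta * e <= 1 by rewrite mulr_ile1 ?(ltW eta0) ?(ltW e0) //; lra.
rewrite exprM sqr_sqrtr; last by lra.
rewrite -exprM mulnC exprM sqr_sqrtr; last by lra.
have t1 : ((1 - 30 * (eta / e)) ^+ k)^-1 <= expR (60 * (eta / e) * k%:R).
  rewrite -exprVn expRM_natr lerXn2r ?nnegrE ?invr_ge0 ?expR_ge0 //; first by lra.
  have := @inv_one_sub_le (30 * (eta / e)).
  have -> : 2 * (30 * (eta / e)) = 60 * (eta / e) by ring.
  by apply; lra.
have t2 : (1 - eta * e / 4) ^+ n <= expR (- (120 * (eta / e) * k%:R)).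
  apply: (@le_trans _ _ (expR (- (eta * e / 4)) ^+ n)).
    rewrite lerXn2r ?nnegrE ?expR_ge0 //; first by lra.
    exact: (expR_ge1Dx (- (eta * e / 4))).
  rewrite -expRM_natr ler_expR mulNr lerN2.
  have h : 0 <= eta * e / 4 by rewrite divr_ge0 // mulr_ge0 // ltW.
  have := ler_wpM2l h kn; apply: le_trans.
  by rewrite le_eqVlt; apply/orP; left; apply/eqP; field; rewrite gt_eqF.
have a0 : 0 <= ((1 - 30 * (eta / e)) ^+ k)^-1 by rewrite invr_ge0 exprn_ge0 //; lra.
have b0 : 0 <= (1 - eta * e / 4) ^+ n by rewrite exprn_ge0 //; lra.
have t3 := ler_pM a0 b0 t1 t2; rewrite -expRD in t3.
have E : 60 * (eta / e) * k%:R + - (120 * (eta / e) * k%:R) = - (60 * (eta / e) * k%:R) by ring.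
rewrite E expRN in t3.
have t4 : 8 * M%:R / delta <= expR (60 * (eta / e) * k%:R).
  apply: (@le_trans _ _ (expR (lm + L + 3))); last by rewrite ler_expR.
  have di0 : 0 <= delta^-1 by rewrite invr_ge0 ltW.
  have h1 := ler_pM (ler0n R M) di0 Ml dL.
  have h2 := ler_pM (mulr_ge0 (ler0n R M) di0) (ler0n R 8) h1 expR3_ge.
  rewrite (expRD (lm + L) 3) (expRD lm L); apply: (le_trans _ h2).
  by rewrite -mulrA [leRHS]mulrC mulrA.
have ex0 : 0 < expR (60 * (eta / e) * k%:R) by exact: expR_gt0.
have -> : forall A B : R, 2 * M%:R * (A * (2 * B)) = 4 * M%:R * (A * B) by move=> *; ring.
have m0 : 0 <= 4 * M%:R :> R by rewrite mulr_ge0.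
apply: (le_trans (ler_wpM2l m0 t3)).
rewrite ler_pdivrMr //; move: t4; rewrite ler_pdivrMr //; lra.
Qed.

(** The initial moment over its value at W = k is 4^-p, and the summand 2 supplies the factor 4 <=
    e^2. *)
Lemma moment_term_small (k p : nat) delta L : (0 < k)%N -> 0 < delta -> delta^-1 <= expR L -> L + 2 <= p%:R ->
  2 * ((2 * k)%:R ^+ (2 * p))^-1 * k%:R ^+ (2 * p) <= delta / 2.
Proof.
move=> k0 d0 dL Lp.
have kR : 0 < k%:R :> R by rewrite ltr0n.
have -> : 2 * ((2 * k)%:R ^+ (2 * p))^-1 * k%:R ^+ (2 * p) = 2 / 4 ^+ p :> R.
  have -> : (4 : R) = 2 ^+ 2 by ring.
  rewrite -exprM natrM exprMn invfM mulrA mulfVK // expf_neq0 // gt_eqF //.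
have h : 4 * delta^-1 <= 4 ^+ p.
  apply: le_trans (expR_le_4 p); apply: (@le_trans _ _ (expR (L + 2))); last by rewrite ler_expR.
  rewrite expRD mulrC; apply: ler_pM => //; last exact: expR2_ge.
  by rewrite invr_ge0 ltW.
have p4 : 0 < 4 ^+ p :> R by rewrite exprn_gt0.
rewrite ler_pdivrMr //; move: h; rewrite ler_pdivrMr //; lra.
Qed.

(* p ~ log(1/delta) makes the Markov term 2 / 4^p small, q = n / k ~ 480 / e^2 makes the decay of wrong
   answers beat the cost of W < k, and eta ~ 1 / (p sqrt(q (ell + 1))) keeps c (ell + 1) <= 1 / 4. *)
Lemma parameters (ell M : nat) e delta L lm : 0 < e -> e <= 1 -> 0 < delta ->
  1 <= L -> 1 <= lm -> delta^-1 <= expR L -> M%:R <= expR lm ->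
  exists p k q eta,
    let n := (k * q)%N in let r := Num.sqrt (n%:R / k%:R) in
    [/\ [/\ (0 < k)%N, (k <= n)%N & (2 * p <= k)%N], 0 < eta /\ 60 * eta <= e,
      [/\ 3 * eta * r <= 1, 42 * (p%:R * (3 * eta * r)) <= 1 &
         5352 * (p%:R * (3 * eta * r)) ^+ 2 * ell.+1%:R <= 1 / 4],
      2 * ((2 * k)%:R ^+ (2 * p))^-1 * k%:R ^+ (2 * p) <= delta / 2 /\
      2 * M%:R * ((Num.sqrt (1 - 30 * (eta / e)) ^+ (2 * k))^-1 *
        (2 * (Num.sqrt (1 - eta * e / 4) ^+ n) ^+ 2)) <= delta / 2 &
      n%:R <= 1600 * 1000 * Num.sqrt ell.+1%:R * L ^+ 2 * lm / e ^+ 2 :> R].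
Proof.
move=> e0 e1 d0 L1 lm1 dL Ml.
have [p /andP[p1 p2]] := @nat_approx (L + 2) ltac:(lra).
have e2 : 0 < e ^+ 2 by rewrite exprn_gt0.
have e21 : e ^+ 2 <= 1 by rewrite expr_le1 // ltW.
have [q /andP[q1 q2]] := @nat_approx (480 / e ^+ 2) (divr_ge0 (ler0n _ 480) (ltW e2)).
set T := Num.sqrt ell.+1%:R : R.
have T1 : 1 <= T by rewrite -[leLHS]sqrtr1 ler_wsqrtr // ler1n.
have T2 : T ^+ 2 = ell.+1%:R by rewrite sqr_sqrtr.
have pR : 3 <= p%:R :> R by lra.
have pR1 : 1 <= p%:R :> R by lra.
have w0 : 0 <= 162 * p%:R * T * (lm + L + 3) by rewrite !mulr_ge0 //; lra.
(* 162 is an upper bound for 440 * 22 / 60: 440 from [eta], 22 from [re2], 60 from the exponent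
   required by [error_term_small]. *)
have [k /andP[k1 k2]] := nat_approx w0.
have pT : p%:R <= p%:R * T by rewrite ler_peMr.
have kp : 2 * p%:R <= k%:R :> R.
  apply: le_trans k1; apply: (@le_trans _ _ (162 * p%:R * T * 1)); first by rewrite mulr1 -mulrA; lra.
  by rewrite ler_wpM2l //; [rewrite !mulr_ge0 //|]; lra.
have q480 : 480 <= q%:R :> R.
  by apply: le_trans q1; rewrite ler_pdivlMr // ler_piMr.
have q0 : 0 < q%:R :> R by lra.
have k0 : 0 < k%:R :> R by lra.
have kN : (0 < k)%N by rewrite -(ltr0n R).
set rq := Num.sqrt q%:R : R.
have rq2 : rq ^+ 2 = q%:R by rewrite sqr_sqrtr // ltW.
have rq0 : 0 < rq by rewrite sqrtr_gt0.
have rE : Num.sqrt ((k * q)%N%:R / k%:R) = rq :> R.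
  by rewrite natrM mulrAC mulfV ?mul1r // gt_eqF.
have re1 : 1 <= rq * e.
  rewrite -(@ler_pXn2r _ 2) ?nnegrE ?mulr_ge0 ?(ltW rq0) ?(ltW e0) // expr1n exprMn rq2.
  have := ler_wpM2r (ltW e2) q1; rewrite divfK ?gt_eqF //; lra.
(* Rounding gives q <= 480 / e^2 + 1, hence (rq e)^2 <= 481 <= 22^2. *)
have re2 : rq * e <= 22.
  rewrite -(@ler_pXn2r _ 2) ?nnegrE ?mulr_ge0 ?(ltW rq0) ?(ltW e0) // exprMn rq2.
  have := ler_wpM2r (ltW e2) q2; rewrite mulrDl divfK ?gt_eqF // mul1r; lra.
have den0 : 0 < 440 * p%:R * rq * T by rewrite !mulr_gt0 //; lra.
(* With this choice p (3 eta rq) = 3 / (440 T), and 440 is large enough for 5352 (3 / 440)^2 <= 1 /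
   4. *)
pose eta := (440 * p%:R * rq * T)^-1.
have eta0 : 0 < eta by rewrite invr_gt0.
have etaE : 440 * p%:R * rq * T * eta = 1 by rewrite mulfV // gt_eqF.
have pr0 : 0 < p%:R :> R by lra.
have T0 : 0 < T by lra.
have py : p%:R * (3 * eta * rq) = 3 / 440 / T.
  by rewrite /eta; field; rewrite !gt_eqF.
have iT : T^-1 <= 1 by rewrite invf_le1.
have iT0 : 0 < T^-1 by rewrite invr_gt0.
exists p, k, q, eta; rewrite /= rE py; split.
- split=> //; last by rewrite -(ler_nat R) natrM.
  by rewrite leq_pmulr // -(ltr0n R).
- split=> //; rewrite /eta ler_pdivrMr //.
  have := mulr_ege1 (mulr_ege1 pR1 T1) re1.
  lra.
- split; last 2 first.
  + lra.
  + have -> : 5352 * (3 / 440 / T) ^+ 2 * ell.+1%:R = 5352 * (3 / 440) ^+ 2 by rewrite -T2; field; rewrite gt_eqF.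
    lra.
  have : 3 * eta * rq <= p%:R * (3 * eta * rq).
    by rewrite ler_peMl ?mulr_ge0 ?(ltW eta0) ?(ltW rq0) //; lra.
  rewrite py; lra.
- split; first exact: moment_term_small dL _.
  apply: (error_term_small e0 e1 eta0 _ d0 _ dL Ml).
  + rewrite /eta ler_pdivrMr //.
    have := mulr_ege1 (mulr_ege1 pR1 T1) re1.
    lra.
  + by rewrite natrM mulrAC mulrC ler_wpM2l ?(ltW k0).
  + have -> : 60 * (eta / e) * k%:R = k%:R * (60 / (440 * p%:R * T * (rq * e))).
      by rewrite /eta; field; rewrite !gt_eqF.
    have h0 : 0 < 440 * p%:R * T * (rq * e) by rewrite !mulr_gt0.
    rewrite mulrA ler_pdivlMr //.
    have h1 : 440 * p%:R * T * (rq * e) <= 440 * p%:R * T * 22.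
      by rewrite ler_wpM2l // !mulr_ge0 // ltW.
    have s0 : 0 <= lm + L + 3 by lra.
    have := ler_wpM2l s0 h1; have := ler_wpM2r (ler0n R 60) k1.
    have : 0 <= p%:R * T * (lm + L + 3) by rewrite !mulr_ge0 // ltW.
    lra.
(* Since L and lm are at least 1, p <= 4 L and lm + L + 3 <= 5 lm L; the final constant dominates
   163 * 20 * 481. *)
have LL : L <= lm * L by rewrite ler_peMl //; lra.
have lL : lm <= lm * L by rewrite ler_peMr //; lra.
have s5 : lm + L + 3 <= 5 * (lm * L) by lra.
have p4 : p%:R <= 4 * L by lra.
have kk : k%:R <= 163 * 20 * (T * L ^+ 2 * lm).
  have a : p%:R * T <= 4 * L * T by rewrite ler_wpM2r // ltW.
  have b : p%:R * T * (lm + L + 3) <= 4 * L * T * (5 * (lm * L)).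
    by apply: ler_pM => //; rewrite ?mulr_ge0 ?(ltW T0) //; lra.
  have c : 1 <= p%:R * T * (lm + L + 3).
    by apply: mulr_ege1 (mulr_ege1 pR1 T1) _; lra.
  lra.
have qq : q%:R <= 481 / e ^+ 2.
  have : 1 <= 1 / e ^+ 2 by rewrite ler_pdivlMr // mul1r.
  by move: q2; move: (e ^+ 2) => z; lra.
rewrite natrM; apply: (le_trans (ler_pM (ltW k0) (ltW q0) kk qq)).
have X0 : 0 <= T * L ^+ 2 * lm / e ^+ 2.
  by rewrite divr_ge0 ?(ltW e2) // !mulr_ge0 ?sqr_ge0 ?(ltW T0) //; lra.
lra.
Qed.

End Choices.

(** * The two regimes of the theorem *)

Section QueryNorms.
Variable R : realType.
Local Notation C := (R[i]).
Local Notation herm := (@Defs.hermitian R _).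

Lemma opnorm_nb d (O : 'M[C]_d) : opnorm_le1 O -> nb 1 O.
Proof.
by move=> H; apply: nb_sq => // v; have := H v; rewrite !rd_complex lecR expr1n mul1r.
Qed.

Lemma nb_col n (a : 'cV[C]_n) : nb (nr a) a.
Proof.
apply: nb_sq => [|x]; first exact: nr_ge0.
have E : adj a *m a = (rd a a) *r 1%:M.
  by apply/matrixP => i j; rewrite !ord1 rd_complex !mxE mulr1.
by rewrite nr2 rd_adjl mulmxA E -scalemxAl mul1mx rdZr.
Qed.

(** Cauchy-Schwarz on each row; this turns the bound on tr (O^2) into an operator-norm bound. *)
Lemma nb_frobenius m n (A : 'M[C]_(m, n)) : nb (Num.sqrt (complex.Re (\tr (A *m adj A)))) A.
Proof.
have rowE v : rd (A *m v) (A *m v) = \sum_i rd (row i A *m v) (row i A *m v).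
  rewrite rd_sumsq; apply: eq_bigr => i _.
  by rewrite rd_sumsq big_ord1 -row_mul !mxE.
have trE : complex.Re (\tr (A *m adj A)) = \sum_i nr (adj (row i A)) ^+ 2.
  rewrite /mxtrace raddf_sum; apply: eq_bigr => i _; rewrite nr2 /rd adjK /=.
  by congr complex.Re; rewrite !mxE; apply: eq_bigr => j _; rewrite !adjE !mxE.
have tr0 : 0 <= complex.Re (\tr (A *m adj A)) by rewrite trE sumr_ge0 // => i _; exact: sqr_ge0.
apply: nb_sq => [|v]; first exact: sqrtr_ge0.
rewrite sqr_sqrtr // rowE trE mulr_suml; apply: ler_sum => i _.
apply: nb_rd; first exact: nr_ge0.
rewrite -[X in nb _ X]adjK; apply: nb_adj; first exact: nr_ge0.
exact: nb_col.
Qed.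

Lemma expect_le_nb d m (X : 'M[C]_(d, m)) O c : 0 <= c -> \tr (X *m adj X) = 1 -> nb c O ->
  `|expect O (X *m adj X)| <= c.
Proof.
move=> c0 tr1 H; rewrite /expect.
have colE : complex.Re (\tr (O *m (X *m adj X))) = \sum_b rd (col b X) (O *m col b X).
  rewrite (mulmxA O) mxtrace_mulC /mxtrace raddf_sum; apply: eq_bigr => b _.
  rewrite /rd; congr complex.Re; rewrite !mxE; apply: eq_bigr => i _.
  rewrite !adjE !mxE; congr (_ * _); apply: eq_bigr => j _; by rewrite mxE.
have colE1 : \sum_b rd (col b X) (col b X) = 1.
  have -> : 1 = complex.Re (\tr (X *m adj X)) :> R by rewrite tr1.
  rewrite mxtrace_mulC /mxtrace raddf_sum; apply: eq_bigr => b _.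
  by rewrite /rd; congr complex.Re; rewrite !mxE; apply: eq_bigr => i _; rewrite !adjE !mxE.
rewrite colE; apply: (le_trans (ler_norm_sum _ _ _)).
rewrite -[leRHS]mulr1 -colE1 mulr_sumr; apply: ler_sum => b _.
have le1 (v : 'cV[C]_d) : rd v (O *m v) <= c * rd v v.
  apply: (le_trans (rd_le_nr _ _)); rewrite -nr2 mulrC expr2 mulrA.
  by rewrite ler_wpM2r ?nr_ge0.
rewrite ler_norml le1 andbT lerNl -rdNr -mulmxN.
apply: (le_trans (rd_le_nr _ _)); rewrite mulmxN nrN -nr2 mulrC expr2 mulrA.
by rewrite ler_wpM2r ?nr_ge0.
Qed.

End QueryNorms.

(** * Answering without copies *)

Section Deterministic.
Variable R : realType.
Local Notation C := (R[i]).
Variables (d : nat) (f : 'M[C]_d * R -> bool).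

Definition det_step (qs : seq ('M[C]_d * R)) (os : seq bool) (o : bool) : seq 'M[C]_(pw d 0 * 1) :=
  if o == f (last (0, 0) qs) then [:: 1%:M] else [::].

Lemma det_step_ok qs os : instrument_ok (det_step qs os).
Proof.
rewrite /instrument_ok big_bool /det_step; case: (f _) => /=.
  by rewrite big_seq1 big_nil addr0 adj1 mulmx1.
by rewrite big_seq1 big_nil add0r adj1 mulmx1.
Qed.

Definition det_alg : algorithm R d := Algorithm det_step_ok.

Variables (adv : adversary R d) (rho : 'M[C]_d).

Lemma det_prob_rcons h o : prob det_alg adv rho (rcons h o) =
  if o == f (adv h) then prob det_alg adv rho h else 0.
Proof.
have E os : post det_alg adv rho os = hist (fun h o sigma =>
   \sum_(K <- det_step (queries adv h) h o) K *m sigma *m adj K) (init_state det_alg rho) os by [].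
rewrite /prob !E hist_rcons /det_step last_queries; case: eqP => _.
  by rewrite big_seq1 mul1mx adj1 mulmx1.
by rewrite big_nil mxtrace0.
Qed.

Lemma det_prob_nil : prob det_alg adv rho [::] = 1.
Proof.
rewrite /prob /post /= /init_state /= mxtrace_tens mxtrace1 mul1r /mxtrace big_ord1.
by rewrite mxE.
Qed.

Lemma det_prob_ge0 h : 0 <= prob det_alg adv rho h.
Proof.
elim/last_ind: h => [|h o IH]; first by rewrite det_prob_nil.
by rewrite det_prob_rcons; case: eqP.
Qed.

Lemma det_success eps ell M : (forall h, answer_ok adv rho eps h (f (adv h))) ->
  1 <= success_prob det_alg adv rho eps ell M.
Proof.
move=> H; rewrite (success_succ_mass _ _ _ (fun=> erefl)).
have sp h : prob det_alg adv rho h = prob det_alg adv rho (rcons h true) + prob det_alg adv rho (rcons h false).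
  by rewrite !det_prob_rcons; case: (f _) => /=; rewrite ?addr0 ?add0r.
(* The game bound is used with V = 0 and A = B = 0: a wrong answer has probability zero. *)
have z (h : seq bool) : 0 <= (0 : R) by [].
have zz (h : seq bool) : (0 : R) + 0 <= 0 by rewrite addr0.
have err h o : ~~ halted ell M h -> ~~ answer_ok adv rho eps h o ->
    prob det_alg adv rho (rcons h o) <= 0 * 0 + 0 * prob det_alg adv rho h.
  move=> _ no; rewrite !mul0r addr0 det_prob_rcons; case: eqP => // oE.
  by move: no; rewrite oE H.
have := @succ_mass_ge R ell M _ _ det_prob_ge0 sp (fun=> 0) z zz 0 0 (lexx 0) (lexx 0) err M [::] (leq_addl _ _).
by rewrite det_prob_nil !(mulr0, mul0r) !subr0.
Qed.

End Deterministic.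

(** The mean lies within sqrt B of 0. If it exceeds theta then theta < sqrt B; if it is at most
    theta - eps then theta >= eps - sqrt B >= sqrt B. *)
Lemma small_frobenius_success (R : realType) d (eps B : R) ell M (rho : 'M[R[i]]_d) (adv : adversary R d) :
  2 * Num.sqrt B <= eps -> density rho -> (forall h, valid_query B (adv h)) ->
  1 <= success_prob (det_alg (fun q => Num.sqrt B <= q.2)) adv rho eps ell M.
Proof.
move=> Be [rho0 rho1] adv_ok; have [m [X rhoE]] := psd_factor rho0.
have E : rho = adj X *m adj (adj X) by rewrite adjK.
apply: det_success => h; have [hO _ hB _] := adv_ok h.
have nO : nb (Num.sqrt B) (adv h).1.
  by apply: nb_ge (nb_frobenius _); rewrite hO ler_wsqrtr.
have := @expect_le_nb _ _ _ (adj X) _ _ (sqrtr_ge0 B) _ nO; rewrite -E => /(_ rho1).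
rewrite ler_norml => /andP[h1 h2]; rewrite /answer_ok.
have [h3|h3] := leP (Num.sqrt B) (adv h).2; apply/andP; split=> //; apply/implyP=> //= h4; lra.
Qed.

(** * Comparison with the stated number of copies *)

Section CopyBound.
Variable R : realType.
Implicit Types (B L lm eps s : R).

(** Rescaling contributes s^2 <= s <= 2 sqrt B. Passing from ell + 1 back to ell costs a factor 3 /
    2 for ell >= 1, and the maximum with 1 covers ell = 0. *)
Lemma scale_sqrt_le B s (ell : nat) : 0 <= s -> s <= 1 -> s <= 2 * Num.sqrt B ->
  Num.sqrt ell.+1%:R * s ^+ 2 <= 3 * Num.max 1 (Num.sqrt (B * ell%:R)).
Proof.
move=> s0 s1 sB; have ss : s ^+ 2 <= s by rewrite expr2 ler_piMr.
have T0 : 0 <= Num.sqrt ell.+1%:R :> R by exact: sqrtr_ge0.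
case: ell T0 => [|ell] T0.
  rewrite sqrtr1 mul1r; have : (1 : R) <= Num.max 1 (Num.sqrt (B * 0%:R)) by rewrite le_max lexx.
  by move: (Num.max _ _) => w; lra.
apply: (@le_trans _ _ (3 * Num.sqrt (B * ell.+1%:R))); last first.
  by rewrite ler_wpM2l // le_max lexx orbT.
apply: (@le_trans _ _ (Num.sqrt ell.+2%:R * (2 * Num.sqrt B))).
  by rewrite ler_wpM2l // (le_trans ss).
have [B0|B0] := leP B 0; first by rewrite (ler0_sqrtr B0) !mulr0 mulr_ge0 ?sqrtr_ge0.
have -> : Num.sqrt (B * ell.+1%:R) = Num.sqrt B * Num.sqrt ell.+1%:R by rewrite sqrtrM // ltW.
have b0 : 0 <= Num.sqrt B by exact: sqrtr_ge0.
suff : 2 * Num.sqrt ell.+2%:R <= 3 * Num.sqrt ell.+1%:R :> R.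
  by move=> h; have := ler_wpM2r b0 h; lra.
rewrite -(@ler_pXn2r _ 2) ?nnegrE ?mulr_ge0 ?sqrtr_ge0 // !exprMn !sqr_sqrtr //.
rewrite -(natr1 ell.+1); have : 1 <= ell.+1%:R :> R by rewrite ler1n.
by move: (ell.+1%:R) => z; lra.
Qed.

Lemma sqr_le_powR L : 1 <= L -> L ^+ 2 <= powR L (5%:R / 2%:R).
Proof.
move=> L1; rewrite -powR_mulrn; last by lra.
by rewrite ler_powR //; lra.
Qed.

(** Dividing by (eps / s)^2 produces the s^2 used by [scale_sqrt_le]. The factor [lg B] and the
    extra half power of L are at least 1 and are given away; 5000 exceeds 3 * 1600. *)
Lemma copies_le_bound B eps delta s (ell M n : nat) : 0 < eps -> 0 < s -> s <= 1 -> s <= 2 * Num.sqrt B ->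
  n%:R <= 1600 * 1000 * Num.sqrt ell.+1%:R * lg (1 / (eps * delta)) ^+ 2 * lg M%:R / (eps / s) ^+ 2 ->
  n%:R <= 5000 * 1000 * copy_bound B ell M eps delta.
Proof.
move=> e0 s0 s1 sB; set L := lg _ => H; apply: (le_trans H).
have L1 : 1 <= L := lg_ge1 _.
have lm1 := lg_ge1 (M%:R : R); have lB1 := lg_ge1 B.
have hs := scale_sqrt_le ell (ltW s0) s1 sB.
have hL := sqr_le_powR L1.
rewrite /copy_bound -/L.
move: (lg M%:R) lm1 => lm lm1; move: (lg B) lB1 => lB lB1.
have m0 : 0 <= Num.max 1 (Num.sqrt (B * ell%:R)) by rewrite le_max ler01.
move: (Num.max _ _) m0 hs => m m0 hs.
have T0 : 0 <= Num.sqrt ell.+1%:R * s ^+ 2 by rewrite mulr_ge0 ?sqrtr_ge0 ?sqr_ge0.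
have L0 := sqr_ge0 L.
move: (powR _ _) hL => P hL.
have -> : 1600 * 1000 * Num.sqrt ell.+1%:R * L ^+ 2 * lm / (eps / s) ^+ 2 =
  1600 * 1000 * ((Num.sqrt ell.+1%:R * s ^+ 2) * L ^+ 2) * lm / eps ^+ 2.
  by field; rewrite !gt_eqF.
have h1 := ler_pM T0 L0 hs hL.
have mP : 0 <= 3 * m * P by apply: le_trans h1; rewrite mulr_ge0.
rewrite [leRHS]mulrA ler_pM2r ?invr_gt0 ?exprn_gt0 //.
have lm0 : 0 <= lm by lra.
have h2 := ler_wpM2r lm0 h1.
have mPl : 0 <= m * P * lm by rewrite mulr_ge0 //; lra.
have lB0 : 0 <= lB - 1 by lra.
have h3 := mulr_ge0 mPl lB0.
move: h2 h3 mPl; move: (Num.sqrt _ * _ * _) => w; lra.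
Qed.

Lemma copy_bound_ge0 B ell M eps delta : 0 <= copy_bound B ell M eps delta.
Proof.
rewrite /copy_bound divr_ge0 ?sqr_ge0 // !mulr_ge0 ?powR_ge0 ?le_max ?ler01 //.
Qed.

End CopyBound.

Lemma sv_alg_exists (R : realType) d (eps delta B : R) (ell M : nat) :
  0 < eps -> eps <= 1 -> 0 < delta -> eps < 2 * Num.sqrt B ->
  exists alg : algorithm R d,
    (ncopies alg)%:R <= 5000 * 1000 * copy_bound B ell M eps delta /\
    forall (rho : 'M[R[i]]_d), density rho ->
    forall adv : adversary R d, (forall h, valid_query B (adv h)) ->
      1 - delta <= success_prob alg adv rho eps ell M.
Proof.
move=> eps0 eps1 delta0 epsB.
(* The factor 2 ensures e = eps / s <= 1 as soon as eps < 2 sqrt B, the case left over by the regime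
   without copies. *)
pose s := Num.min 1 (2 * Num.sqrt B).
have s0 : 0 < s by rewrite lt_min ltr01 /=; lra.
have s1 : s <= 1 by rewrite ge_min lexx.
have sB : s <= 2 * Num.sqrt B by rewrite ge_min lexx orbT.
pose e := eps / s.
have es : e * s = eps by rewrite divfK // gt_eqF.
have e0 : 0 < e by rewrite divr_gt0.
have e1 : e <= 1 by rewrite ler_pdivrMr // mul1r le_min eps1 ltW.
have dL : delta^-1 <= expR (lg (1 / (eps * delta))).
  apply: le_trans (le_expR_lg _); rewrite div1r lef_pV2 ?posrE ?mulr_gt0 //.
  by rewrite ler_piMl // ltW.
have [p [k [q [eta]]]] := parameters ell e0 e1 delta0 (lg_ge1 _) (lg_ge1 _) dL (le_expR_lg M%:R).
set n := (k * q)%N => /= -[[k0 kn pk] [eta0 eta_e] [y1 py cl] [b1 b2] n_le].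
exists (sv_alg d n s e eta); split; first exact: copies_le_bound n_le.
move=> rho [rho0 rho1] adv adv_ok; have [m [X rhoE]] := psd_factor rho0.
have E : rho = adj X *m adj (adj X) by rewrite adjK.
have adv_herm h : Defs.hermitian (adv h).1 by case: (adv_ok h).
have adv_thr h : 0 <= (adv h).2 by case: (adv_ok h) => _ _ _ /andP[].
have adv_nb h : nb s (adv h).1.
  rewrite /s; case: leP => _; have [hO h1 hB _] := adv_ok h; first exact: opnorm_nb.
  apply: nb_ge (nb_frobenius _); rewrite hO; apply: (@le_trans _ _ (Num.sqrt B)).
    by rewrite ler_wsqrtr.
  by rewrite ler_peMl ?sqrtr_ge0 // ler1n.
have tr1 : \tr (adj X *m adj (adj X)) = 1 by rewrite -E.
have := success_ge adv_herm tr1 k0 kn pk s0 e0 e1 eta0 eta_e adv_nb adv_thr y1 py cl M.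
rewrite -E es; apply: le_trans; move: b1 b2; lra.
Qed.

Theorem mainTheorem11 :
  forall R : realType, exists Cst : R, 0 < Cst /\
  forall (d : nat) (eps delta B : R) (ell M : nat),
    (0 < d)%N -> 0 < eps <= 1 -> 0 < delta <= 1 ->
    exists alg : algorithm R d,
      (ncopies alg)%:R <= Cst * copy_bound B ell M eps delta /\
      forall (rho : 'M[R[i]]_d), density rho ->
      forall adv : adversary R d, (forall h, valid_query B (adv h)) ->
        1 - delta <= success_prob alg adv rho eps ell M.
Proof.
move=> R; exists (5000 * 1000); split; first by rewrite mulr_gt0.
move=> d eps delta B ell M _ /andP[eps0 eps1] /andP[delta0 delta1].
have [small|large] := leP (2 * Num.sqrt B) eps; last exact: sv_alg_exists.
exists (det_alg (d := d) (fun q => Num.sqrt B <= q.2)); split.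
  by rewrite /= mulr_ge0 ?copy_bound_ge0 ?mulr_ge0.
move=> rho rho_density adv adv_ok.
apply: le_trans (small_frobenius_success ell M small rho_density adv_ok).
by rewrite lerBlDr lerDl ltW.
Qed.
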